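(* Let $m\ge 1$ and $1\le k<n-1$, and consider the system $$z'=F(z,\varepsilon)=\sum_{i=0}^m\varepsilon^iF_i(z),\qquad z\in\mathbb{R}^n,\quad 0<\varepsilon\ll 1,$$ with $F$ sufficiently smooth in both arguments. Suppose that the unperturbed system $z'=F_0(z)$ possesses a $k$-dimensional family of periodic orbits forming an embedded $(k+1)$-dimensional manifold $M_0$, parametrised by the embedding $\Gamma_0:U\times\mathbb{S}^1\to\mathbb{R}^n$ with frequency map $\omega:U\to(0,\infty)$, and that $M_0$ is normally hyperbolic (all as made precise in the context). Then there exist smooth functions $r_x:U\times\mathbb{R}\to\mathbb{R}^k$ and $r_\phi:U\times\mathbb{R}\to\mathbb{R}$ of the form $$r_x(x,\varepsilon)=\sum_{i=1}^m\varepsilon^i r_{x,i}(x),\qquad r_\phi(x,\varepsilon)=\omega(x)+\sum_{i=1}^m\varepsilon^i r_{\phi,i}(x),$$ and an embedding $\Gamma:U\times\mathbb{S}^1\times\mathbb{R}\to\mathbb{R}^n$ of the form $$\Gamma(x,\phi,\varepsilon)=\Gamma_0(x,\phi)+\sum_{i=1}^m\varepsilon^i\Gamma_i(x,\phi),$$ with the following property: if $(x(t),\phi(t))$ is a solution of the skew-product system $$x'=r_x(x,\varepsilon),\qquad \phi'=r_\phi(x,\varepsilon),$$ then $z(t):=\Gamma(x(t),\phi(t),\varepsilon)$ is an approximate solution of the original system, i.e. it satisfies $$z'=F(z,\varepsilon)+\mathcal{O}(\varepsilon^{m+1}).$$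
   Context: Notation: $\mathbb{S}^1=\mathbb{R}/2\pi\mathbb{Z}$, and $'$ denotes $d/dt$. Manifold of periodic orbits. $U\subset\mathbb{R}^k$ is an open set parametrising the periodic orbits. For each $x\in U$, $t\mapsto\gamma_0(x,t)$ is a periodic orbit of $z'=F_0(z)$ with period $\tau(x)>0$ and frequency $\omega(x)=2\pi/\tau(x)$. The period map $x\mapsto\tau(x)$ is smooth and uniformly bounded from below and above, and the same is then true for $\omega$. The map $\Gamma_0:U\times\mathbb{S}^1\to\mathbb{R}^n$, $\Gamma_0(x,\phi):=\gamma_0(x,\omega(x)^{-1}\phi)$, is an embedding with image $M_0$; in particular $D\Gamma_0(x,\phi)$ has full rank $k+1$, and $\partial_\phi\Gamma_0(x,\phi)\,\omega(x)=F_0(\Gamma_0(x,\phi))$. Normal hyperbolicity. For $x\in U$ let $\Phi(x,t,t_0)$ be the transition matrix of the variational equation $\dot\zeta=DF_0(\gamma_0(x,t))\zeta$, i.e. $\partial_t\Phi(x,t,t_0)=DF_0(\gamma_0(x,t))\Phi(x,t,t_0)$ and $\Phi(x,t_0,t_0)=\mathbb{I}_n$. $M_0$ is normally hyperbolic if along each periodic orbit there is a splitting $\mathbb{R}^n=T_zM_0\oplus\mathcal{N}^s_z\oplus\mathcal{N}^u_z$, $z=\gamma_0(x,t)\in M_0$, invariant under $\Phi$ (that is, $\Phi(x,t,t_0)$ maps each summand at $\gamma_0(x,t_0)$ to the corresponding summand at $\gamma_0(x,t)$), with constants $K\ge1$, $\lambda_s,\lambda_u>0$, where $\min\{\lambda_s,\lambda_u\}$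 is bounded away from zero, such that for $v^s\in\mathcal{N}^s_z$, $v^u\in\mathcal{N}^u_z$ with $z=\gamma_0(x,t_0)$, $$\|\Phi(x,t,t_0)v^s\|\le Ke^{-\lambda_s(t-t_0)}\|v^s\|\ (t\ge t_0),\qquad \|\Phi(x,t,t_0)v^u\|\le Ke^{\lambda_u(t-t_0)}\|v^u\|\ (t\le t_0),$$ while solutions starting in $T_zM_0$ stay tangent to $M_0$ and do not exhibit exponential growth or decay relative to each other. In terms of Floquet theory: for every periodic orbit exactly $k+1$ Floquet exponents are $0$ (Floquet multiplier $1$), with $T_zM_0$ as the associated generalised eigenspace, and the remaining $n-k-1$ have nonzero real part.
   Formalization: Γ is shown to be an embedding in (x,φ) for each fixed small ε, not jointly in (x,φ,ε) (false e.g. if F_1=…=F_m=0), and the smallness of ε and the constant in O(ε^{m+1}) are uniform on open subsets of U with compact closure in U rather than on all of U. *)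

(* Defs.v *)
From HB Require Import structures.
From mathcomp Require Import all_boot all_order all_algebra.
From mathcomp Require Import all_classical all_reals all_analysis.

Set Implicit Arguments.
Unset Strict Implicit.
Unset Printing Implicit Defensive.
Import Order.TTheory GRing.Theory Num.Theory.
Import numFieldNormedType.Exports.

Local Open Scope classical_set_scope.
Local Open Scope ring_scope.

(* Conventions.  R^n is the space of column vectors 'cV[R]_n with the library
   norm (the sup norm); every estimate below involves a constant that is
   existentially quantified, so the choice of norm is immaterial.  A function
   on S^1 = R / 2 pi Z is a 2 pi-periodic function of a real variable. *)

(* f is of class C^r on the (open) set A.  In finite dimension, f is C^(r+1) iff
   it is differentiable and all its directional derivatives are C^r. *)
Fixpoint Cr (R : realType) (V W : normedModType R) (r : nat) (A : set V)
    (f : V -> W) : Prop :=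
  if r is r'.+1 then
    (forall x, A x -> differentiable f x) /\
    (forall v : V, Cr r' A (fun x => 'D_v f x))
  else forall x, A x -> {for x, continuous f}.

(* Differentiability classes are indexed by [option nat]: [Some r] is C^r and
   [None] is C^infinity. *)
Definition Cclass (R : realType) (V W : normedModType R) (q : option nat)
    (A : set V) (f : V -> W) : Prop :=
  if q is Some r then Cr r A f else forall r, Cr r A f.

(* The class with l more derivatives. *)
Definition class_add (q : option nat) (l : nat) : option nat :=
  omap (addn^~ l) q.

(* At least C^1. *)
Definition class_ge1 (q : option nat) : Prop :=
  if q is Some r then (1 <= r)%N else True.

(* G is a C^q embedding of V x S^1 into R^n: an injective immersion that is a
   homeomorphism onto its image (it is open onto its image; open sets of V x S^1
   and of its cover V x R have the same images). *)
Definition embedding (R : realType) (k n : nat) (q : option nat)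
    (V : set 'cV[R]_k) (G : 'cV[R]_k -> R -> 'cV[R]_n) : Prop :=
  let G' := fun p : 'cV[R]_k * R => G p.1 p.2 in
  let D : set ('cV[R]_k * R) := V `*` setT in
  [/\ forall x phi, V x -> G x (phi + 2 * pi) = G x phi,
      Cclass q D G',
      forall x y phi psi, V x -> V y -> G x phi = G y psi ->
        x = y /\ exists j : int, psi = phi + j%:~R * (2 * pi),
      forall p, D p -> injective ('d G' p)
    & forall O : set ('cV[R]_k * R), open O -> O `<=` D ->
        exists2 O' : set 'cV[R]_n, open O' & G' @` O = G' @` D `&` O'].

Definition frequency (R : realType) (k : nat) (tau : 'cV[R]_k -> R) :
    'cV[R]_k -> R :=
  fun x => 2 * pi / tau x.

(* Gamma_0 (x, phi) = gamma_0 (x, phi / omega x) *)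
Definition phase_param (R : realType) (k n : nat)
    (gamma0 : 'cV[R]_k -> R -> 'cV[R]_n) (tau : 'cV[R]_k -> R) :
    'cV[R]_k -> R -> 'cV[R]_n :=
  fun x phi => gamma0 x (phi / frequency tau x).

(* A family of periodic orbits of z' = F0 z of period tau x, x in U, whose union
   is a C^p-embedded manifold. *)
Definition periodic_family (R : realType) (k n : nat) (p : option nat)
    (F0 : 'cV[R]_n -> 'cV[R]_n) (U : set 'cV[R]_k)
    (gamma0 : 'cV[R]_k -> R -> 'cV[R]_n) (tau : 'cV[R]_k -> R) : Prop :=
  [/\ forall x t, U x -> is_derive t (1 : R) (gamma0 x) (F0 (gamma0 x t)),
      forall x t, U x -> gamma0 x (t + tau x) = gamma0 x t,
      exists a b : R, 0 < a /\ (forall x, U x -> a <= tau x <= b),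
      Cclass p U (tau : 'cV[R]_k -> R^o)
    & embedding p U (phase_param gamma0 tau)].

(* T_z M_0 at z = G (x, phi), as the range of the derivative of G. *)
Definition tangent (R : realType) (k n : nat)
    (G : 'cV[R]_k -> R -> 'cV[R]_n) (x : 'cV[R]_k) (phi : R) :
    {vspace 'cV[R]_n} :=
  limg (linfun ('d (fun p : 'cV[R]_k * R^o => G p.1 p.2) (x, phi)
                : 'cV[R]_k * R^o -> 'cV[R]_n)).

(* Phi x t t0 is the transition matrix of zeta' = DF0 (gamma0 x t) zeta. *)
Definition transition_matrix (R : realType) (k n : nat)
    (F0 : 'cV[R]_n -> 'cV[R]_n) (U : set 'cV[R]_k)
    (gamma0 : 'cV[R]_k -> R -> 'cV[R]_n)
    (Phi : 'cV[R]_k -> R -> R -> 'M[R]_n) : Prop :=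
  forall x t0, U x ->
    Phi x t0 t0 = 1%:M /\
    forall t (v : 'cV[R]_n),
      is_derive t (1 : R) (fun s => Phi x s t0 *m v)
        ('d F0 (gamma0 x t) (Phi x t t0 *m v)).

(* Ns z and Nu z are the stable and unstable spaces at z in M_0.  The constants
   K, ls, lu may depend on the orbit x, the rates being uniformly bounded away
   from zero.  The last clause says that the tangential dynamics has neither
   exponential growth nor exponential decay (it bounds Phi x t t0 and its
   inverse Phi x t0 t on the tangent spaces). *)
Definition normally_hyperbolic (R : realType) (k n : nat)
    (F0 : 'cV[R]_n -> 'cV[R]_n) (U : set 'cV[R]_k)
    (gamma0 : 'cV[R]_k -> R -> 'cV[R]_n) (tau : 'cV[R]_k -> R) : Prop :=
  let T x t := tangent (phase_param gamma0 tau) x (frequency tau x * t) in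
  exists (Phi : 'cV[R]_k -> R -> R -> 'M[R]_n)
    (Ns Nu : 'cV[R]_n -> {vspace 'cV[R]_n})
    (K ls lu : 'cV[R]_k -> R) (l0 : R),
  [/\ transition_matrix F0 U gamma0 Phi,
      0 < l0 /\
        (forall x, U x -> [/\ 1 <= K x, l0 <= ls x & l0 <= lu x]),
      forall x t, U x ->
        (T x t + Ns (gamma0 x t) + Nu (gamma0 x t))%VS = fullv /\
        directv (T x t + Ns (gamma0 x t) + Nu (gamma0 x t)),
      forall x t t0 v, U x ->
        [/\ v \in T x t0 -> Phi x t t0 *m v \in T x t,
            v \in Ns (gamma0 x t0) -> Phi x t t0 *m v \in Ns (gamma0 x t)
          & v \in Nu (gamma0 x t0) -> Phi x t t0 *m v \in Nu (gamma0 x t)]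
    & forall x, U x ->
        [/\ forall t0 v, v \in Ns (gamma0 x t0) -> forall t, t0 <= t ->
              `|Phi x t t0 *m v| <= K x * expR (- ls x * (t - t0)) * `|v|,
            forall t0 v, v \in Nu (gamma0 x t0) -> forall t, t <= t0 ->
              `|Phi x t t0 *m v| <= K x * expR (lu x * (t - t0)) * `|v|
          & forall d : R, 0 < d -> exists C : R,
              forall t0 v, v \in T x t0 -> forall t,
                `|Phi x t t0 *m v| <= C * expR (d * `|t - t0|) * `|v| ] ].

Definition eps_field (R : realType) (n m : nat)
    (F : nat -> 'cV[R]_n -> 'cV[R]_n) (z : 'cV[R]_n) (eps : R) : 'cV[R]_n :=
  \sum_(0 <= i < m.+1) eps ^+ i *: F i z.

(* (x, phi) solves x' = rx (x, eps), phi' = rphi (x, eps) on the interval I,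
   with x in V; phi is a lift to R of the angle. *)
Definition skew_solution (R : realType) (k : nat)
    (rx : 'cV[R]_k -> R -> 'cV[R]_k) (rphi : 'cV[R]_k -> R -> R)
    (eps : R) (V : set 'cV[R]_k) (I : set R)
    (x : R -> 'cV[R]_k) (phi : R -> R) : Prop :=
  forall t, I t ->
    [/\ V (x t),
        is_derive t (1 : R) x (rx (x t) eps)
      & is_derive t (1 : R) (phi : R -> R^o) (rphi (x t) eps)].

(* Main.v *)
Require Import Defs.
From HB Require Import structures.
From mathcomp Require Import all_boot all_order all_algebra.
From mathcomp Require Import all_classical all_reals all_analysis.
From mathcomp Require Import ring lra.

Set Implicit Arguments.
Unset Strict Implicit.
Unset Printing Implicit Defensive.
Import Order.TTheory GRing.Theory Num.Theory.
Import numFieldNormedType.Exports.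

Local Open Scope classical_set_scope.
Local Open Scope ring_scope.

(* Expand Gamma and the reduced vector field r in powers of eps. At each order the
   conjugacy equation DGamma . r = F(Gamma, eps) reduces to the homological equation
     omega d_phi u = DF_0(Gamma_0) u + g - DGamma_0 rho
   along every periodic orbit, for a periodic u = u(x, phi) and a rho = rho(x).
   Write M for the monodromy matrix. By variation of constants the equation becomes a
   linear system for (u(x, 0), rho): u(0) = M u(0) + (secular tangent response to rho)
   + (forcing), together with the phase condition DGamma_0^T u(0) = 0. The system is
   square and, by normal hyperbolicity, injective: 1 - M is injective on the stable
   and unstable spaces, it maps the tangent space to itself, and the response is an
   isomorphism onto the tangent space. Cramer's rule then gives u and rho as smooth
   functions of x.

   The remainder of order N is kept as eps^N H with H smooth, by Hadamard division,
   so no Taylor expansion of the F_i is ever written down.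

   For small eps, compactness of the closure of V and the local injectivity of
   DGamma_0 give a bound c |p - p'| <= |Gamma(p, eps) - Gamma(p', eps)| modulo the
   periods, from which injectivity, immersivity and openness onto the image follow. *)

(** Normal hyperbolicity provides a transition matrix orbit by orbit, with no regularity in x.
    Dependence on parameters must therefore be recovered from the equation: a Gronwall estimate
    gives uniqueness and continuity and, applied to difference quotients, differentiability of
    solutions in x. With a zero coefficient matrix the same results cover integrals with a parameter
    and the symmetry of mixed derivatives. The operator 1 - M alone is never invertible, since M
    fixes the flow direction; and M need not be the identity on the tangent space, because
    neighbouring orbits have different frequencies. Hence the two devices: the phase condition
    annihilates the tangent part of u(0), and the tangent part of the equation then determines rho.
    The variation of the frequency enters the response only through a unipotent shear, which does
    not affect injectivity. Injectivity of the perturbed embedding is a global statement, which an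
    inverse function argument at single points does not reach. The lower bound is therefore proved
    near pairs of points, and compactness is applied to the set of pairs. *)

(** * Differentiability and the calculus of C^r functions in finite dimension *)

Section DiffEps.
Context {R : realType} {V W : normedModType R}.
Implicit Types (f : V -> W) (x : V).

Lemma diff_eps f x (e : R) : differentiable f x -> 0 < e ->
  \forall h \near (0 : V), `|f (h + x) - f x - 'd f x h| <= e * `|h|.
Proof.
move=> /diff_locally /eqaddoP /(_ _) H e0; have := H e e0.
by apply: filterS => h; rewrite /= opprD addrA.
Qed.

Lemma differentiable_eps f x (L : V -> W) : linear L ->
  (forall e : R, 0 < e ->
    \forall h \near (0 : V), `|f (h + x) - f x - L h| <= e * `|h|) ->
  continuous L ->
  differentiable f x /\ ('d f x : V -> W) = L.
Proof.
move=> linL H cL.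
pose L' : {linear V -> W} := HB.pack L (GRing.isLinear.Build R V W *:%R L linL).
have E : f \o shift x = cst (f x) + L' +o_ 0 id.
  apply/eqaddoP => e e0; have := H e e0.
  by apply: filterS => h; rewrite /= opprD addrA.
have E' : ('d f x : V -> W) = L' by apply: diff_unique.
split=> //; apply/diff_locallyP; rewrite E'; split=> //.
Qed.

Lemma near_eq_differentiable f g x : (\near x, f x = g x) ->
  differentiable f x -> differentiable g x /\ ('d g x : V -> W) = 'd f x.
Proof.
move=> fg df; apply: differentiable_eps => //; last exact: diff_continuous.
  by move=> k u v; rewrite linearP.
move=> e e0; have := diff_eps df e0.
have: \forall h \near (0 : V), f (h + x) = g (h + x).
  by rewrite [\forall x \near _, _](near_shift x) sub0r; near do rewrite /= subrK.
apply: filterS2 => h ->; by rewrite (nbhs_singleton fg).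
Unshelve. all: by end_near. Qed.

End DiffEps.

Lemma continuous_at_sum (R : realType) (T : topologicalType)
    (W : normedModType R) (I : Type) (s : seq I) (P : pred I) (F : I -> T -> W) x :
  (forall i, P i -> {for x, continuous (F i)}) ->
  {for x, continuous (fun y => \sum_(i <- s | P i) F i y)}.
Proof.
move=> cF; elim: s => [|i s IHs].
  rewrite (_ : (fun y => _) = cst 0); first exact: cvg_cst.
  by apply/funext => y; rewrite big_nil.
rewrite (_ : (fun y => _) = fun y => (if P i then F i y else 0) +
    \sum_(i <- s | P i) F i y); last first.
  by apply/funext => y; rewrite big_cons; case: ifP => //; rewrite add0r.
apply: cvgD; last exact: IHs.
by case: ifP => Pi; [exact: cF|exact: cvg_cst].
Qed.

Section Lines.
Context {R : realType} {V W : normedModType R}.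
Implicit Types (f : V -> W) (x v : V).

(** Both sides have literally the same difference quotient, so the equivalence holds even where [f]
    has only a directional derivative. *)
Lemma is_derive_line f x v (t : R) (d : W) :
  is_derive t (1 : R) (fun s : R => f (s *: v + x)) d <->
  is_derive (t *: v + x) v f d.
Proof.
set g := fun s : R => f (s *: v + x).
have E : (fun h : R => h^-1 *: ((g \o shift t) (h *: (1 : R)) - g t)) =
    (fun h : R => h^-1 *: ((f \o shift (t *: v + x)) (h *: v) - f (t *: v + x))).
  by apply/funext => h; rewrite /g /= [h *: 1]mulr1 scalerDl addrA.
have E1 : derivable g t (1 : R) = derivable f (t *: v + x) v by rewrite /derivable E.
have E2 : 'D_(1 : R) g t = 'D_v f (t *: v + x) by rewrite /derive E.
by split=> -[h <-]; split; rewrite ?E1 ?E2// -?E1.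
Qed.

End Lines.

Section MVTline.
Context {R : realType} {V : normedModType R}.
Implicit Types (f : V -> R) (x v : V).

(** The mean value theorem is applied on [[0, 1]] with the step [c] as a scaling factor, which
    avoids any case distinction on the sign of [c]. *)
Lemma mvt_line f x v (c : R) :
  (forall t : R, 0 <= t <= 1 -> derivable f ((t * c) *: v + x) v) ->
  exists2 t : R, 0 <= t <= 1 &
    f (c *: v + x) - f x = c * 'D_v f ((t * c) *: v + x).
Proof.
move=> df; pose g t := f ((t * c) *: v + x).
have dg (t : R) : 0 <= t <= 1 -> is_derive t (1 : R) g ('D_v f ((t * c) *: v + x) * c).
  move=> /df /derivableP /is_derive_line H.
  have := @is_derive1_comp R (fun s => f (s *: v + x)) (fun t => t * c) t _ c H.
  apply.
  have -> : (fun t => t * c) = c \*: (id : R -> R) by apply/funext => s; rewrite /= mulrC.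
  have := @is_deriveZ R R R id c t 1 1 (is_derive_id _ _).
  by rewrite [c *: 1]mulr1.
have [||t tI] := @MVT_segment R g (fun t => 'D_v f ((t * c) *: v + x) * c) 0 1 ler01.
- by move=> t; rewrite in_itv/= => /andP[? ?]; apply: dg; apply/andP; split; exact: ltW.
- apply: continuous_in_subspaceT => t; rewrite inE/= in_itv/= => tI.
  apply: differentiable_continuous; apply/derivable1_diffP.
  by have [] := dg t tI.
- rewrite /g mul1r mul0r scale0r add0r subr0 mulr1 => E; exists t.
  - by move: tI; rewrite in_itv.
  - by rewrite E mulrC.
Qed.

End MVTline.

(* [V] ranges over iterated products of ['cV[R]_n] and [R]; with their sup norms
   the standard coordinates are 1-Lipschitz, which [bcoord_le] records. *)
Record finBasis (R : realType) (V : normedModType R) := FinBasis {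
  fdim : nat;
  bvec : 'I_fdim -> V;
  bcoord : 'I_fdim -> V -> R;
  bcoordP : forall i (a : R) u v,
    bcoord i (a *: u + v) = a * bcoord i u + bcoord i v;
  bcoord_le : forall i v, `|bcoord i v| <= `|v|;
  bcoordK : forall v, v = \sum_i bcoord i v *: bvec i;
  bcoord_bvec : forall i j, bcoord i (bvec j) = (i == j)%:R }.
Arguments bvec {R V} b i : rename.
Arguments bcoord {R V} b i v : rename.
Arguments bcoordP {R V} b i a u v : rename.
Arguments bcoord_le {R V} b i v : rename.
Arguments bcoordK {R V} b v : rename.
Arguments bcoord_bvec {R V} b i j : rename.

Section FinBasis.
Context {R : realType} {V : normedModType R} (b : finBasis V).

Lemma bcoord_linear i : linear (bcoord b i : V -> R).
Proof. by move=> a u v; rewrite bcoordP. Qed.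

Lemma bcoordB i u v : bcoord b i (u - v) = bcoord b i u - bcoord b i v.
Proof. by rewrite -scaleN1r addrC bcoordP mulN1r addrC. Qed.

Lemma bcoord0 i : bcoord b i 0 = 0.
Proof. by rewrite -[X in bcoord _ _ X](subrr 0) bcoordB subrr. Qed.

Lemma bcoordD i u v : bcoord b i (u + v) = bcoord b i u + bcoord b i v.
Proof. by have := bcoordP b i 1 u v; rewrite scale1r mul1r. Qed.

Lemma bcoordZ i a u : bcoord b i (a *: u) = a * bcoord b i u.
Proof. by have := bcoordP b i a u 0; rewrite bcoord0 !addr0. Qed.

Lemma bcoord_sum i n (F : 'I_n -> V) :
  bcoord b i (\sum_j F j) = \sum_j bcoord b i (F j).
Proof. by apply: (big_morph (bcoord b i)); [exact: bcoordD|exact: bcoord0]. Qed.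

Lemma bcoord_comb (r : 'I_(fdim b) -> R) i :
  bcoord b i (\sum_j r j *: bvec b j) = r i.
Proof.
rewrite bcoord_sum (bigD1 i) //= bcoordZ bcoord_bvec eqxx mulr1 big1 ?addr0 // => j ji.
by rewrite bcoordZ bcoord_bvec eq_sym (negPf ji) mulr0.
Qed.

Lemma bcoord_continuous i : continuous (bcoord b i : V -> R).
Proof.
move=> x; apply/cvgrPdist_le => e e0.
have : \forall y \near x, `|x - y| <= e by apply: cvgr_dist_le.
by apply: filterS => y; apply: le_trans; rewrite -bcoordB bcoord_le.
Qed.

Lemma linear_bcoord (W : normedModType R) (L : V -> W) v : linear L ->
  L v = \sum_i bcoord b i v *: L (bvec b i).
Proof.
move=> linL.
pose L' : {linear V -> W} := HB.pack L (GRing.isLinear.Build R V W *:%R L linL).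
rewrite -[L]/(L' : V -> W) {1}(bcoordK b v) linear_sum.
by apply: eq_bigr => i _; rewrite linearZ.
Qed.

End FinBasis.

Section StrictDiff.
Context {R : realType} {V : normedModType R} (b : finBasis V).

(** One goes from [q] to [p] along a staircase that changes one coordinate at a time; the mean value
    theorem turns each step into a partial derivative at a nearby point. Both endpoints are free,
    which is what the lower bound for the perturbed embedding needs later; [q = x] gives
    differentiability. *)
Lemma strict_diff (f : V -> R) x :
  (forall i, \forall y \near x, derivable f y (bvec b i)) ->
  (forall i, {for x, continuous ('D_(bvec b i) f)}) ->
  forall e : R, 0 < e -> exists2 d : R, 0 < d & forall p q,
    `|p - x| < d -> `|q - x| < d ->
    `|f p - f q - \sum_i bcoord b i (p - q) * 'D_(bvec b i) f x| <= e * `|p - q|.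
Proof.
move=> df cf e e0.
set N := fdim b.
pose eta := e / N.+1%:R.
have eta0 : 0 < eta by rewrite divr_gt0.
have : \forall y \near x, forall i : 'I_N, derivable f y (bvec b i) /\
    `|'D_(bvec b i) f x - 'D_(bvec b i) f y| <= eta.
  apply: filter_forall => i; near=> y; split; first by near: y; exact: df.
  by near: y; apply: cvgr_dist_le => //; exact: cf.
move=> /nbhs_ballP[d0 /= d00 Hd0].
pose M := \sum_i `|bvec b i|.
have M0 : 0 <= M by apply: sumr_ge0.
(* The steps from [q] move by at most [2 * d * M] in total and [q] is within [d] of [x]; since
   [2 * d * M + d = d0], the staircase stays in the ball of radius [d0]. *)
pose d := d0 / (2 * M + 1).
have d1 : 0 < 2 * M + 1 by rewrite ltr_wpDl // mulr_ge0.
exists d; first by rewrite divr_gt0.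
move=> p q px qx; set h := p - q.
have hd : `|h| <= 2 * d.
  have -> : h = (p - x) - (q - x) by rewrite /h opprB addrA subrK.
  rewrite (le_trans (ler_normB _ _)) // mulr_natl mulr2n.
  by rewrite lerD // ltW.
have hM : 2 * d * M + d = d0 by rewrite /d; field; rewrite gt_eqF.
(* The staircase after [j] steps, relative to [q]; the increment of [f] telescopes along it. *)
pose part (j : nat) := \sum_(i < N | (i < j)%N) bcoord b i h *: bvec b i.
pose F j := f (part j + q).
have stepP (j : 'I_N) : part j.+1 = bcoord b j h *: bvec b j + part j.
  rewrite /part (bigD1 j) //=; congr (_ + _); apply: eq_bigl => i.
  by rewrite ltnS ltn_neqAle andbC -val_eqE.
have FN : F N = f p.
  rewrite /F; congr f; rewrite /part.
  rewrite (eq_bigl xpredT); last by move=> i; rewrite ltn_ord.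
  by rewrite -bcoordK /h subrK.
have F0 : F 0%N = f q by rewrite /F /part big_pred0 // add0r.
rewrite -FN -F0 -telescope_sumr // big_mkord -sumrB.
have step (j : 'I_N) : `|F j.+1 - F j - bcoord b j h * 'D_(bvec b j) f x| <= eta * `|h|.
  have near_t t : 0 <= t <= 1 ->
      ball x d0 ((t * bcoord b j h) *: bvec b j + (part j + q)).
    move=> /andP[t0 t1]; rewrite -ball_normE /=.
    have -> : x - (t * bcoord b j h *: bvec b j + (part j + q)) =
       (x - q) - (t * bcoord b j h *: bvec b j + part j).
       by rewrite (addrA _ _ q) [_ + q]addrC opprD addrA.
    rewrite (le_lt_trans (ler_normB _ _)) // -hM addrC ler_ltD //; last first.
      by rewrite distrC.
    apply: (@le_trans _ _ (\sum_(i < N) `|h| * `|bvec b i|)); last first.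
      by rewrite -mulr_sumr ler_wpM2r.
    rewrite (bigD1 j) //= (le_trans (ler_normD _ _)) // lerD //.
      rewrite normrZ ler_wpM2r // normrM ger0_norm // -[leRHS]mul1r.
      by rewrite ler_pM ?bcoord_le.
    rewrite /part (le_trans (ler_norm_sum _ _ _)) //.
    rewrite [leLHS]big_mkcond [leRHS]big_mkcond ler_sum // => i _.
    case: ifPn => [ij|_]; last by case: ifP => // _; rewrite mulr_ge0.
    rewrite neq_ltn ij normrZ ler_wpM2r // bcoord_le //.
  have [t t01 E] : exists2 t : R, 0 <= t <= 1 &
    f (bcoord b j h *: bvec b j + (part j + q)) - f (part j + q) =
      bcoord b j h * 'D_(bvec b j) f ((t * bcoord b j h) *: bvec b j + (part j + q)).
    apply: mvt_line => t t01; by have [] := Hd0 _ (near_t t t01) j.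
  rewrite /F stepP -[_ *: _ + _ + q]addrA E -mulrBr normrM mulrC.
  rewrite ler_pM ?bcoord_le // distrC.
  by have [] := Hd0 _ (near_t t t01) j.
rewrite (le_trans (ler_norm_sum _ _ _)) //.
apply: (@le_trans _ _ (\sum_(i < N) eta * `|h|)); first by apply: ler_sum.
rewrite sumr_const card_ord -[_ *+ _]mulr_natl mulrA ler_wpM2r //.
rewrite /eta mulrCA mulrC -[leRHS]mul1r ler_wpM2r ?ltW //.
by rewrite ltr_pdivrMr // mul1r ltr_nat.
Unshelve. all: by end_near. Qed.

Lemma partials_differentiable (f : V -> R) x :
  (forall i, \forall y \near x, derivable f y (bvec b i)) ->
  (forall i, {for x, continuous ('D_(bvec b i) f)}) ->
  differentiable f x /\
  forall v, 'd f x v = \sum_i bcoord b i v * 'D_(bvec b i) f x.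
Proof.
move=> df cf; pose L v := \sum_i bcoord b i v * 'D_(bvec b i) f x.
have linL : linear (L : V -> R).
  move=> a u v; rewrite /L scaler_sumr -big_split /=; apply: eq_bigr => i _.
  by rewrite bcoordP mulrDl -mulrA.
have cL : continuous (L : V -> R).
  move=> v; apply: continuous_at_sum => i _.
  by apply: continuousM; [exact: bcoord_continuous|exact: cvg_cst].
suff [? E] : differentiable f x /\ ('d f x : V -> R) = L.
  by split=> // v; rewrite E.
apply: differentiable_eps => // e e0.
have [d d0 H] := strict_diff df cf e0.
apply/nbhs_ballP; exists d => //= h; rewrite -ball_normE /= sub0r normrN => hd.
have := H (h + x) x; rewrite addrK subrr normr0; exact.
Qed.

End StrictDiff.

Section CrVector.
Context {R : realType} {V W : normedModType R}.
Implicit Types (f g : V -> W) (A : set V).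

Lemma open_near A (P : V -> Prop) x : open A -> A x -> (forall y, A y -> P y) ->
  \near x, P x.
Proof.
move=> oA Ax AP; have : nbhs x A by apply: open_nbhs_nbhs.
by apply: filterS.
Qed.

Lemma Cr_ext r A f g : open A -> (forall x, A x -> f x = g x) ->
  Cr r A f -> Cr r A g.
Proof.
move=> oA; elim: r f g => [|r IH] f g fg /=.
  move=> cf x Ax; have near_fg := open_near oA Ax fg.
  rewrite /prop_for /continuous_at -fg //.
  apply: cvg_trans (cf x Ax); apply: near_eq_cvg.
  by apply: filterS near_fg.
move=> [df Df]; split=> [x Ax|v].
  by have [] := near_eq_differentiable (open_near oA Ax fg) (df x Ax).
apply: IH (Df v) => x Ax.
by apply: near_eq_derive; exact: open_near fg.
Qed.

Lemma Cr_subset r A A' f : A' `<=` A -> Cr r A f -> Cr r A' f.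
Proof.
move=> A'A; elim: r f => [|r IH] f /=; first by move=> H x /A'A /H.
by move=> [df Df]; split=> [x /A'A /df|v] //; exact: IH.
Qed.

Lemma CrS r A f : Cr r.+1 A f -> Cr r A f.
Proof.
elim: r f => [|r IH] f.
  by move=> [df _] x Ax; apply: differentiable_continuous; exact: df.
move=> /= [df Df]; split=> // v; exact: IH.
Qed.

Lemma CrW r s A f : (r <= s)%N -> Cr s A f -> Cr r A f.
Proof.
by elim: s => [|s IH]; [rewrite leqn0 => /eqP->|rewrite leq_eqVlt ltnS =>
  /orP[/eqP->//|rs /CrS]; exact: IH].
Qed.

Lemma Cr_continuous r A f x : Cr r A f -> A x -> {for x, continuous f}.
Proof. by move=> /(CrW (leq0n _)); exact. Qed.

Lemma Cr_cst r A (a : W) : Cr r A (fun=> a : W).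
Proof.
elim: r a => [|r IH] a /=; first by move=> x _; exact: cvg_cst.
split=> [x _|v]; first exact: differentiable_cst.
rewrite (_ : 'D_v _ = fun=> 0); first exact: IH.
by apply/funext => x; rewrite derive_cst.
Qed.

Lemma Cr_linear r A f : linear f -> continuous f -> Cr r A f.
Proof.
move=> linf cf.
pose f' : {linear V -> W} := HB.pack f (GRing.isLinear.Build R V W *:%R f linf).
case: r => [|r] /=; first by move=> x _; exact: cf.
have df x : differentiable (f' : V -> W) x by apply: linear_differentiable.
split=> [x _|v]; first exact: df.
rewrite (_ : 'D_v _ = fun=> f v); first exact: Cr_cst.
by apply/funext => x; rewrite -[f]/(f' : V -> W) deriveE // diff_lin.
Qed.

Lemma CrD r A f g : open A -> Cr r A f -> Cr r A g -> Cr r A (fun x => f x + g x).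
Proof.
move=> oA; elim: r f g => [|r IH] f g /=.
  by move=> cf cg x Ax; exact: (cvgD (cf x Ax) (cg x Ax)).
move=> [df Df] [dg Dg]; split=> [x Ax|v].
  exact: (differentiableD (df x Ax) (dg x Ax)).
apply: (Cr_ext oA _ (IH _ _ (Df v) (Dg v))) => x Ax.
by rewrite -deriveD; [|apply: diff_derivable; exact: df|apply: diff_derivable; exact: dg].
Qed.

Lemma Cr_sum r A (I : Type) (s : seq I) (P : pred I) (F : I -> V -> W) : open A ->
  (forall i, P i -> Cr r A (F i)) -> Cr r A (fun x => \sum_(i <- s | P i) F i x).
Proof.
move=> oA CF; elim: s => [|i s IHs].
  apply: (Cr_ext oA _ (@Cr_cst r A 0)) => x _; by rewrite big_nil.
have C : Cr r A (fun x => (if P i then F i x else 0) + \sum_(i <- s | P i) F i x).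
  by apply: CrD => //; case Pi: (P i); [exact: CF|exact: Cr_cst].
apply: (Cr_ext oA _ C) => x _; by rewrite big_cons; case: ifP => //; rewrite add0r.
Qed.

End CrVector.

Lemma linear_is_diff (R : realType) (V W : normedModType R) (L : V -> W) x :
  linear L -> continuous L -> is_diff x L L.
Proof.
move=> linL cL.
pose L' : {linear V -> W} := HB.pack L (GRing.isLinear.Build R V W *:%R L linL).
apply: DiffDef; first exact: (@linear_differentiable _ _ _ L').
exact: (@diff_lin _ _ _ L').
Qed.

Lemma derive_lincomp (R : realType) (V W W' : normedModType R) (c : W -> W')
    (g : V -> W) x v : linear c -> continuous c -> differentiable g x ->
  differentiable (fun y => c (g y)) x /\ 'D_v (fun y => c (g y)) x = c ('D_v g x).
Proof.
move=> linc cc dg; have [dc Ec] := linear_is_diff (g x) linc cc.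
have dcg : differentiable (fun y => c (g y)) x by exact: (differentiable_comp dg dc).
by split=> //; rewrite !deriveE // (diff_comp dg dc) /= Ec.
Qed.

Section CrLincomp.
Context {R : realType} {V W W' : normedModType R}.

Lemma Cr_lincomp r (A : set V) (c : W -> W') (g : V -> W) : open A ->
  linear c -> continuous c -> Cr r A g -> Cr r A (fun x => c (g x)).
Proof.
move=> oA linc cc.
elim: r g => [|r IH] g /=.
  move=> cg x Ax.
  exact: (@continuous_comp _ _ _ g c x (cg x Ax) (cc _)).
move=> [dg Dg]; split=> [x Ax|v].
  by have [] := derive_lincomp 0 linc cc (dg x Ax).
apply: (Cr_ext oA _ (IH _ (Dg v))) => x Ax.
by have [] := derive_lincomp v linc cc (dg x Ax).
Qed.

(** The derivative along [v] of the composite is the composite of the derivative of [f] along the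
    constant direction [L v], so the induction closes without coordinates. *)
Lemma Cr_comp_affine r (A : set W) (B : set V) (L : V -> W) (w : W) (f : W -> W') :
  open B -> linear L -> continuous L -> (forall x, B x -> A (L x + w)) ->
  Cr r A f -> Cr r B (fun x => f (L x + w)).
Proof.
move=> oB linL cL BA.
have dL x : is_diff x (fun x => L x + w) L.
  have dLx := linear_is_diff x linL cL.
  have := @is_diffD R V W L (cst w) L 0 x dLx (is_diff_cst w x).
  by rewrite addr0.
elim: r f => [|r IH] f /=.
  move=> cf x Bx; apply: (@continuous_comp _ _ _ (fun x => L x + w) f); last first.
    exact/cf/BA.
  by apply: differentiable_continuous; have [] := dL x.
move=> [df Df].
have dc x : B x -> differentiable (fun x => f (L x + w)) x.
  move=> Bx; apply: (@differentiable_comp _ _ _ _ (fun x => L x + w) f).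
    by have [] := dL x.
  exact/df/BA.
split=> // v; apply: (Cr_ext oB _ (IH _ (Df (L v)))) => x Bx.
rewrite deriveE; last exact/df/BA.
rewrite deriveE; last exact: dc.
rewrite (@diff_comp _ _ _ _ (fun x => L x + w) f) /=; first by have [_ ->] := dL x.
- by have [] := dL x.
- exact/df/BA.
Qed.

End CrLincomp.

Section CrScalar.
Context {R : realType} {V : normedModType R}.
Implicit Types (f g : V -> R) (A : set V).

Lemma CrM r A f g : open A -> Cr r A f -> Cr r A g -> Cr r A (fun x => f x * g x).
Proof.
move=> oA; elim: r f g => [|r IH] f g.
  by move=> cf cg x Ax; exact: (cvgM (cf x Ax) (cg x Ax)).
move=> /[dup] /CrS Cf [df Df] /[dup] /CrS Cg [dg Dg]; split=> [x Ax|v].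
  exact: (differentiableM (df x Ax) (dg x Ax)).
have C := CrD oA (IH _ _ Cf (Dg v)) (IH _ _ Cg (Df v)).
apply: (Cr_ext oA _ C) => x Ax.
by rewrite -deriveM; [|apply: diff_derivable; exact: df|apply: diff_derivable; exact: dg].
Qed.

Lemma CrN r A f : open A -> Cr r A f -> Cr r A (fun x => - f x).
Proof.
move=> oA Cf; have := CrM oA (@Cr_cst R V R r A (-1)) Cf.
by apply: Cr_ext => // x _; rewrite mulN1r.
Qed.

Lemma CrB r A f g : open A -> Cr r A f -> Cr r A g -> Cr r A (fun x => f x - g x).
Proof. by move=> oA Cf Cg; apply: CrD => //; exact: CrN. Qed.

Lemma Cr_prod r A (I : Type) (s : seq I) (P : pred I) (F : I -> V -> R) : open A ->
  (forall i, P i -> Cr r A (F i)) -> Cr r A (fun x => \prod_(i <- s | P i) F i x).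
Proof.
move=> oA CF; elim: s => [|i s IHs].
  apply: (Cr_ext oA _ (@Cr_cst R V R r A 1)) => x _; by rewrite big_nil.
have C : Cr r A (fun x => (if P i then F i x else 1) * \prod_(i <- s | P i) F i x).
  by apply: CrM => //; case Pi: (P i); [exact: CF|exact: Cr_cst].
apply: (Cr_ext oA _ C) => x _; by rewrite big_cons; case: ifP => //; rewrite mul1r.
Qed.

Lemma CrX r A f n : open A -> Cr r A f -> Cr r A (fun x => f x ^+ n).
Proof.
move=> oA Cf; elim: n => [|n IH].
  by apply: (Cr_ext oA _ (@Cr_cst R V R r A 1)) => x _; rewrite expr0.
by apply: (Cr_ext oA _ (CrM oA Cf IH)) => x _; rewrite exprS.
Qed.

Lemma CrV r A f : open A -> (forall x, A x -> f x != 0) ->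
  Cr r A f -> Cr r A (fun x => (f x)^-1).
Proof.
move=> oA f0; elim: r => [|r IH].
  by move=> cf x Ax; exact: (cvgV (f0 x Ax) (cf x Ax)).
move=> /[dup] /CrS /IH CVf [df Df]; split=> [x Ax|v].
  exact: (differentiableV (df x Ax) (f0 x Ax)).
have C := CrN oA (CrM oA (CrM oA CVf CVf) (Df v)).
apply: (Cr_ext oA _ C) => x Ax.
rewrite deriveV; [|exact: f0|apply: diff_derivable; exact: df].
by rewrite [RHS]mulNr -exprVn expr2.
Qed.

Lemma Cr_scalev r A (W : normedModType R) f (w : W) : open A ->
  Cr r A f -> Cr r A (fun x => f x *: w).
Proof.
move=> oA; apply: (@Cr_lincomp _ V (R : normedModType R) W r A (fun a => a *: w)) => //.
  by move=> a u v; rewrite scalerDl scalerA.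
by move=> x; apply: scalel_continuous.
Qed.

Lemma Cr_det r A n (M : V -> 'M[R]_n) : open A ->
  (forall i j, Cr r A (fun x => M x i j)) -> Cr r A (fun x => \det (M x)).
Proof.
move=> oA CM; rewrite /determinant.
apply: Cr_sum => // s _; apply: CrM => //; first exact: Cr_cst.
by apply: Cr_prod.
Qed.

Lemma Cr_invmx r A n (M : V -> 'M[R]_n) i j : open A ->
  (forall x, A x -> M x \in unitmx) ->
  (forall i j, Cr r A (fun x => M x i j)) -> Cr r A (fun x => invmx (M x) i j).
Proof.
move=> oA uM CM.
have Cadj : Cr r A (fun x => (\det (M x))^-1 * (\adj (M x)) i j).
  apply: CrM => //.
    apply: CrV => //; last exact: Cr_det.
    by move=> x /uM; rewrite unitmxE unitfE.
  apply: (@Cr_ext _ _ _ _ _ (fun x => cofactor (M x) j i)) => //.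
    by move=> x _; rewrite mxE.
  rewrite /cofactor; apply: CrM => //; first exact: Cr_cst.
  apply: Cr_det => // i' j'.
  apply: (@Cr_ext _ _ _ _ _ (fun x => M x (lift j i') (lift i j'))) => //.
  by move=> x _; rewrite !mxE.
by apply: (Cr_ext oA _ Cadj) => x Ax; rewrite /invmx uM // !mxE.
Qed.

(** [Cr] quantifies over all directions; once the partials are continuous, [f] is differentiable and
    every directional derivative is a fixed linear combination of them. *)
Lemma Cr_partials r A (b : finBasis V) f : open A ->
  (forall i x, A x -> derivable f x (bvec b i)) ->
  (forall i, Cr r A ('D_(bvec b i) f)) -> Cr r.+1 A f.
Proof.
move=> oA df CDf.
have D x : A x -> differentiable f x /\
    forall v, 'd f x v = \sum_i bcoord b i v * 'D_(bvec b i) f x.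
  move=> Ax; apply: partials_differentiable => i.
    by apply: (open_near oA Ax) => y; exact: df.
  exact: Cr_continuous (CDf i) Ax.
split=> [x /D[]//|v].
apply: (@Cr_ext _ _ _ _ _ (fun x => \sum_i bcoord b i v * 'D_(bvec b i) f x)) => //.
  by move=> x /D[dfx E]; rewrite deriveE.
by apply: Cr_sum => // i _; apply: CrM => //; exact: Cr_cst.
Qed.

End CrScalar.

Section CrBasis.
Context {R : realType} {V W : normedModType R} (b : finBasis W).

Lemma Cr_coord r (A : set V) (g : V -> W) i : open A ->
  Cr r A g -> Cr r A (fun x => bcoord b i (g x)).
Proof.
move=> oA; apply: Cr_lincomp => //; [exact: bcoord_linear|exact: bcoord_continuous].
Qed.

Lemma Cr_of_coord r (A : set V) (g : V -> W) : open A ->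
  (forall i, Cr r A (fun x => bcoord b i (g x))) -> Cr r A g.
Proof.
move=> oA Cg.
apply: (@Cr_ext _ _ _ _ _ (fun x => \sum_i bcoord b i (g x) *: bvec b i)) => //.
  by move=> x _; rewrite -bcoordK.
by apply: Cr_sum => // i _; apply: Cr_scalev.
Qed.

Lemma derive_comp_basis (f : W -> R) (g : V -> W) x v :
  differentiable g x -> differentiable f (g x) ->
  'D_v (fun y => f (g y)) x =
    \sum_i 'D_v (fun y => bcoord b i (g y)) x * 'D_(bvec b i) f (g x).
Proof.
move=> dg df.
rewrite deriveE; last exact: (differentiable_comp dg df).
rewrite (diff_comp dg df) /= (linear_bcoord b); last by move=> a u w; rewrite linearP.
apply: eq_bigr => i _; rewrite (deriveE _ df).
have [_ ->] := derive_lincomp v (@bcoord_linear _ _ b i) (@bcoord_continuous _ _ b i) dg.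
by rewrite deriveE.
Qed.

(** The chain rule differentiates [f] in the direction ['D_v g x], which varies with [x], while [Cr]
    only speaks of constant directions. Expanding it in a basis restores constant directions and
    makes the induction possible. *)
Lemma Cr_comp r (A : set V) (B : set W) (f : W -> R) (g : V -> W) :
  open A -> (forall x, A x -> B (g x)) ->
  Cr r B f -> Cr r A g -> Cr r A (fun x => f (g x)).
Proof.
move=> oA AB; elim: r f => [|r IH] f.
  move=> cf cg x Ax; apply: (@continuous_comp _ _ _ g f); first exact: cg.
  exact/cf/AB.
move=> [df Df] /[dup] /CrS Cg [dg Dg].
split=> [x Ax|v].
  by apply: (@differentiable_comp _ _ _ _ g f); [exact: dg|exact/df/AB].
apply: (@Cr_ext _ _ _ _ _ (fun x => \sum_i bcoord b i ('D_v g x) *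
    'D_(bvec b i) f (g x))) => //.
  move=> x Ax; rewrite derive_comp_basis; [|exact: dg|exact/df/AB].
  apply: eq_bigr => i _; congr (_ * _).
  by have [] := derive_lincomp v (@bcoord_linear _ _ b i) (@bcoord_continuous _ _ b i) (dg x Ax).
apply: Cr_sum => // i _; apply: CrM => //; first exact: (Cr_coord i oA (Dg v)).
exact: (IH _ (Df _) Cg).
Qed.

End CrBasis.

Section Bases.
Context {R : realType}.

Definition basisR : finBasis (R : normedModType R).
refine (@FinBasis R R 1 (fun _ => 1) (fun _ v => v) _ _ _ _) => //.
- by move=> v; rewrite big_ord1 [_ *: _]mulr1.
- by move=> i j; rewrite !ord1 eqxx.
Defined.

Lemma coord_le_norm n (v : 'cV[R]_n) i : `|v i 0| <= `|v|.
Proof.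
rewrite [leRHS]/Num.Def.normr/= mx_normrE.
exact: (le_bigmax _ (fun ij : 'I_n * 'I_1 => `|v ij.1 ij.2|) (i, 0)).
Qed.

Definition basis_cV n : finBasis ('cV[R]_n : normedModType R).
refine (@FinBasis R 'cV[R]_n n (fun i => delta_mx i 0) (fun i v => v i 0) _ _ _ _).
- by move=> i a u v; rewrite !mxE.
- by move=> i v; apply: coord_le_norm.
- move=> v; rewrite {1}[v]matrix_sum_delta; apply: eq_bigr => i _.
  by rewrite big_ord1.
- by move=> i j; rewrite mxE eqxx andbT.
Defined.

Definition basisX (V W : normedModType R) (b : finBasis V) (c : finBasis W) :
  finBasis (V * W : normedModType R)%type.
refine (@FinBasis R (V * W : normedModType R)%type (fdim b + fdim c)
  (fun i => match fintype.split i with inl j => (bvec b j, 0) | inr j => (0, bvec c j) end)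
  (fun i v => match fintype.split i with inl j => bcoord b j v.1 | inr j => bcoord c j v.2 end)
  _ _ _ _).
- by move=> i a u v; case: fintype.split => j /=; rewrite bcoordP.
- move=> i v; rewrite [leRHS]/Num.norm /= le_max.
  by case: fintype.split => j /=; rewrite bcoord_le ?orbT.
- move=> [v w]; rewrite big_split_ord /=.
  rewrite [X in _ = X + _](_ : _ = (v, 0)); last first.
    rewrite {2}[v](bcoordK b).
    rewrite (_ : (_, 0) = (fun v => (v, 0) : V * W)
      (\sum_i bcoord b i v *: bvec b i)) //.
    rewrite (big_morph (fun v => (v, 0) : V * W) (id1 := 0) (op1 := +%R)) //=.
      apply: eq_bigr => i _; rewrite (unsplitK (inl _ i)) /=.
      by congr (_, _); rewrite scaler0.
    by move=> x y; congr (_, _); rewrite addr0.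
  rewrite [X in _ = _ + X](_ : _ = (0, w)); last first.
    rewrite {2}[w](bcoordK c).
    rewrite (_ : (0, _) = (fun w => (0, w) : V * W)
      (\sum_i bcoord c i w *: bvec c i)) //.
    rewrite (big_morph (fun w => (0, w) : V * W) (id1 := 0) (op1 := +%R)) //=.
      apply: eq_bigr => i _; rewrite (unsplitK (inr _ i)) /=.
      by congr (_, _); rewrite scaler0.
    by move=> x y; congr (_, _); rewrite addr0.
  transitivity (v + 0, 0 + w) => //; by rewrite addr0 add0r.
- move=> i j.
  case: (split_ordP i) => i' ->; case: (split_ordP j) => j' ->;
    rewrite ?(unsplitK (inl _ _)) ?(unsplitK (inr _ _)) /=
      ?bcoord_bvec ?bcoord0 ?eq_lshift ?eq_rshift ?eq_lrshift ?eq_rlshift //.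
Defined.

End Bases.

(** * Linear differential equations: Gronwall estimate, uniqueness, smooth dependence on a
    parameter *)

Section DeriveFun.
Context {R : realType} {V W : normedModType R}.

Lemma is_derive_conv (f : V -> W) x v (d d' : W) :
  is_derive x v f d -> d = d' -> is_derive x v f d'.
Proof. by move=> H <-. Qed.

Lemma is_derive_addf (f g : V -> W) x v (d e : W) :
  is_derive x v f d -> is_derive x v g e -> is_derive x v (fun y => f y + g y) (d + e).
Proof. exact: is_deriveD. Qed.

Lemma is_derive_subf (f g : V -> W) x v (d e : W) :
  is_derive x v f d -> is_derive x v g e -> is_derive x v (fun y => f y - g y) (d - e).
Proof. exact: is_deriveB. Qed.

Lemma is_derive_mulf (f g : V -> R) x v (d e : R) :
  is_derive x v f d -> is_derive x v g e ->
  is_derive x v (fun y => f y * g y) (d * g x + f x * e).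
Proof.
move=> Hf Hg; have H : is_derive x v (f * g) (f x *: e + g x *: d).
  exact: is_deriveM.
rewrite addrC [d * _]mulrC; exact: H.
Qed.

Lemma is_derive_sumf (I : Type) (s : seq I) (f : I -> V -> W) x v (d : I -> W) :
  (forall i, is_derive x v (f i) (d i)) ->
  is_derive x v (fun y => \sum_(i <- s) f i y) (\sum_(i <- s) d i).
Proof.
move=> H; elim: s => [|i s IH].
  rewrite big_nil (_ : (fun _ => _) = cst 0); first exact: is_derive_cst.
  by apply/funext => y; rewrite big_nil.
rewrite big_cons (_ : (fun _ => _) = fun y => f i y + \sum_(j <- s) f j y).
  exact: is_derive_addf.
by apply/funext => y; rewrite big_cons.
Qed.

End DeriveFun.

Section Energy.
Context {R : realType}.
Implicit Types (y : R -> R).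

Lemma is_derive_affine (W : normedModType R) (y : R -> W) (a c s : R) (d : W) :
  is_derive (a * s + c) (1 : R) y d ->
  is_derive s (1 : R) (fun r : R => y (a * r + c)) (a *: d).
Proof.
move=> [dy <-]; have df := (derivable1_diffP _ _).1 dy.
have da : is_diff s (fun r : R => a * r + c) (fun r : R => a * r).
  have dL : is_diff s (fun r : R => a * r) (fun r : R => a * r).
    apply: linear_is_diff; first by move=> u v w; rewrite mulrDr mulrCA.
    by move=> u; apply: mulrl_continuous.
  have := @is_diffD R R R _ (cst c) _ 0 s dL (is_diff_cst c s).
  by rewrite addr0.
have [da1 Ea] := da.
have dc := differentiable_comp da1 df.
apply: DeriveDef; first exact/derivable1_diffP.
by rewrite deriveE // (diff_comp da1 df) /= Ea deriveE // -linearZ.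
Qed.

Lemma is_derive_dilate (W : normedModType R) (y : R -> W) (a s : R) (d : W) :
  is_derive (a * s) (1 : R) y d ->
  is_derive s (1 : R) (fun r : R => y (a * r)) (a *: d).
Proof.
rewrite -[a * s]addr0 => /is_derive_affine.
by rewrite (_ : (fun r => _) = (fun r => y (a * r))) //; apply/funext => r; rewrite addr0.
Qed.

(** Gronwall for the sum of squares E. Young's inequality gives E' <= M (E + n d^2) with M = 2 n C +
    1, so (E + n d^2) exp(- M s) does not increase on [[0, 1]]. *)
Lemma energy n (B : 'I_n -> 'I_n -> R -> R) (b y : 'I_n -> R -> R) (C d : R) :
  0 <= C -> 0 <= d ->
  (forall s i, is_derive s (1 : R) (y i) (\sum_j B i j s * y j s + b i s)) ->
  (forall s, 0 <= s <= 1 -> forall i j, `|B i j s| <= C) ->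
  (forall s, 0 <= s <= 1 -> forall i, `|b i s| <= d) ->
  \sum_i y i 1 ^+ 2 <=
    (\sum_i y i 0 ^+ 2 + n%:R * d ^+ 2) * expR (2 * n%:R * C + 1).
Proof.
move=> C0 d0 ode HB Hb.
set M := 2 * n%:R * C + 1.
pose E s := \sum_i y i s ^+ 2.
pose E' s := \sum_i 2 * y i s * (\sum_j B i j s * y j s + b i s).
have dE s : is_derive s (1 : R) E (E' s).
  apply: is_derive_sumf => i.
  under [X in is_derive _ _ X _]eq_fun do rewrite expr2.
  by apply: (is_derive_conv (is_derive_mulf (ode s i) (ode s i))); ring.
have E0 s : 0 <= E s by apply: sumr_ge0 => i _; rewrite sqr_ge0.
have bnd s : 0 <= s <= 1 -> E' s <= M * (E s + n%:R * d ^+ 2).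
  move=> s01.
  have step i : 2 * y i s * (\sum_j B i j s * y j s + b i s) <=
      C * n%:R * y i s ^+ 2 + C * E s + y i s ^+ 2 + d ^+ 2.
    have H1 : 2 * y i s * b i s <= y i s ^+ 2 + d ^+ 2.
      have /ler_normlP[h1 h2] := Hb s s01 i.
      apply: (@le_trans _ _ (y i s ^+ 2 + b i s ^+ 2)).
        by have := sqr_ge0 (y i s - b i s); rewrite sqrrB; lra.
      have := mulr_ge0 (_ : 0 <= d - b i s) (_ : 0 <= d + b i s).
      by rewrite subr_ge0 => /(_ h2); nra.
    have H2 j : 2 * y i s * (B i j s * y j s) <= C * y i s ^+ 2 + C * y j s ^+ 2.
      have /ler_normlP[h1 h2] := HB s s01 i j.
      have := sqr_ge0 (y i s - y j s); have := sqr_ge0 (y i s + y j s).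
      rewrite sqrrB sqrrD => h3 h4.
      have [p|p] := leP 0 (y i s * y j s).
        have : B i j s * (y i s * y j s) <= C * (y i s * y j s) by rewrite ler_wpM2r.
        have : 0 <= C * (y i s ^+ 2 - y i s * y j s *+ 2 + y j s ^+ 2) by rewrite mulr_ge0.
        by nra.
      have : (- B i j s) * (- (y i s * y j s)) <= C * (- (y i s * y j s)).
        by rewrite ler_wpM2r // oppr_ge0 ltW.
      have : 0 <= C * (y i s ^+ 2 + y i s * y j s *+ 2 + y j s ^+ 2) by rewrite mulr_ge0.
      by nra.
    rewrite mulrDr -addrA lerD // mulr_sumr.
    apply: (le_trans (ler_sum _ (fun j _ => H2 j))).
    by rewrite big_split /= sumr_const card_ord -mulr_sumr -[_ *+ _]mulr_natr (mulrAC C).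
  apply: (le_trans (ler_sum _ (fun i _ => step i))).
  rewrite !big_split /= -mulr_sumr !sumr_const card_ord -/(E s) -[_ *+ n]mulr_natl -[d ^+ 2 *+ n]mulr_natl.
  rewrite /M; have := E0 s.
  have : 0 <= n%:R * C * (n%:R * d ^+ 2) by rewrite !mulr_ge0 // sqr_ge0.
  by nra.
pose g s := (E s + n%:R * d ^+ 2) * expR (- M * s).
pose g' s := (E' s - M * (E s + n%:R * d ^+ 2)) * expR (- M * s).
have dg s : is_derive s (1 : R) g (g' s).
  have dexp : is_derive s (1 : R) (fun s => expR (- M * s)) (- M * expR (- M * s)).
    by apply: is_derive_dilate; apply: is_derive_expR.
  apply: (is_derive_conv (is_derive_mulf (is_derive_addf (dE s) (is_derive_cst (n%:R * d ^+ 2) s 1)) dexp)).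
  by rewrite /g' /cst; ring.
have [|t tI] := @MVT_segment R g g' 0 1 ler01.
apply: continuous_subspaceT => s; apply: differentiable_continuous.
  by apply/derivable1_diffP; have [] := dg s.
rewrite subr0 mulr1 => Eg.
have : g 1 - g 0 <= 0.
  rewrite Eg /g' mulr_le0_ge0 ?expR_ge0 // subr_le0; apply: bnd.
  by move: tI; rewrite in_itv.
rewrite /g mulr0 expR0 !mulr1 subr_le0 expRN ler_pdivrMr ?expR_gt0 //.
by apply: le_trans; rewrite lerDl; apply: mulr_ge0; rewrite ?ler0n ?sqr_ge0.
Qed.

End Energy.

Lemma continuous_dist_le (R : realType) (T : topologicalType)
    (W : normedModType R) (f : T -> W) x (e : R) : 0 < e ->
  {for x, continuous f} -> \forall y \near x, `|f x - f y| <= e.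
Proof. by move=> e0 /cvgrPdist_le; apply. Qed.

Section NearSegment.
Context {R : realType}.

(** The tube lemma: compactness of the segment makes a neighbourhood of [x] uniform in [s]. *)
Lemma segment_near (T : topologicalType) (P : T -> R -> Prop) (x : T) (c d : R) :
  (forall s, c <= s <= d -> \forall s' \near s & y \near x, P y s') ->
  \forall y \near x, forall s, c <= s <= d -> P y s.
Proof.
move=> H; have := @segment_compact R c d => /compact_near_coveringP.
move=> /(_ T (nbhs x) P _) K.
have : \forall y \near x, `[c, d]%classic `<=` P y.
  by apply: K => s; rewrite /= in_itv /=; exact: H.
by apply: filterS => y sub s sT; apply: sub; rewrite /= in_itv.
Qed.

Lemma near_segment (T : topologicalType) (P : T -> R -> Prop) (x : T) (t : R) :
  (forall s, `|s| <= t -> \forall s' \near s & y \near x, P y s') ->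
  \forall y \near x, forall s, `|s| <= t -> P y s.
Proof.
move=> H; have : \forall y \near x, forall s, - t <= s <= t -> P y s.
  by apply: segment_near => s; rewrite -ler_norml; exact: H.
by apply: filterS => y sub s sT; apply: sub; rewrite -ler_norml.
Qed.

(** The bound itself, tending to infinity, plays the part of the parameter in the covering form of
    compactness. *)
Lemma segment_bounded (f : R -> R) (t : R) : continuous f ->
  exists2 C, 0 <= C & forall s, `|s| <= t -> `|f s| <= C.
Proof.
move=> cf.
have /compact_near_coveringP := @segment_compact R (- t) t.
move=> /(_ R +oo%R (fun C s => `|f s| <= C) _) K.
have : \forall C \near +oo%R, `[- t, t]%classic `<=` (fun s => `|f s| <= C).
  apply: K => s _.
  have : \forall s' \near s, `|f s - f s'| <= 1 by apply: continuous_dist_le => //; exact: cf.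
  move=> H; exists ([set s' | `|f s - f s'| <= 1], [set C | `|f s| + 1 <= C]).
    by split=> //=; apply: nbhs_pinfty_ge; rewrite num_real.
  move=> [s' C] /= [h hC]; apply: le_trans hC.
  rewrite -[f s'](subKr (f s)) (le_trans (ler_normB _ _)) //.
  by rewrite (le_trans (lerD (lexx _) h)).
move=> H; have [C [C0 HC]] := filter_ex (filterI (nbhs_pinfty_ge (num_real (0 : R))) H).
exists C => // s; rewrite ler_norml => sT; apply: HC; rewrite /= in_itv; exact: sT.
Unshelve. all: by end_near. Qed.

Lemma segment_bounded_fin (I : finType) (f : I -> R -> R) (t : R) :
  (forall i, continuous (f i)) ->
  exists2 C, 0 <= C & forall s, `|s| <= t -> forall i, `|f i s| <= C.
Proof.
move=> cf; have /choice[C HC] : forall i, exists C, 0 <= C /\ forall s, `|s| <= t -> `|f i s| <= C.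
  by move=> i; have [C C0 HC] := segment_bounded t (cf i); exists C.
exists (\sum_i C i); first by apply: sumr_ge0 => i _; have [] := HC i.
move=> s st i; rewrite (le_trans ((HC i).2 s st)) //.
rewrite (bigD1 i) //= lerDl; apply: sumr_ge0 => j _; by have [] := HC j.
Qed.

Context {V : normedModType R}.
Implicit Types (A : set V).

(** Uniformity in [s] on a compact interval. In a tube around [(x, s)] both terms are compared with
    the value at the centre, whence the halves of [e]. *)
Lemma near_slab_continuous (f : V * R -> R) (x : V) (t e : R) : 0 < e ->
  (forall s, {for (x, s), continuous f}) ->
  \forall y \near x, forall s, `|s| <= t -> `|f (y, s) - f (x, s)| <= e.
Proof.
move=> e0 cf; apply: near_segment => s _.
have e20 : 0 < e / 2 by rewrite divr_gt0.
have H : \forall p \near (x, s), `|f (x, s) - f p| <= e / 2.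
  by apply: continuous_dist_le => //; exact: cf.
have [[/= P Q] [Px Qs] PQ] := H.
exists (Q, P) => //= -[s' y] /= [Qs' Py].
have h1 := PQ (y, s') (conj Py Qs').
have h2 := PQ (x, s') (conj (nbhs_singleton Px) Qs').
have -> : f (y, s') - f (x, s') = (f (x, s) - f (x, s')) - (f (x, s) - f (y, s')) by ring.
by rewrite (le_trans (ler_normB _ _)) // [leRHS](splitr e) lerD.
Qed.

(** By the mean value theorem the quotient is a directional derivative at an intermediate point;
    continuity of that derivative and the tube lemma make the convergence uniform in [s]. *)
Lemma near_slab_derive A (f : V * R -> R) (x v : V) (t e : R) : open A -> A x ->
  0 < e -> Cr 1 (A `*` setT) f ->
  \forall h \near (0 : R)^', forall s, `|s| <= t ->
    `|h^-1 * (f (h *: v + x, s) - f (x, s)) - 'D_(v, 0) f (x, s)| <= e.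
Proof.
move=> oA Ax e0 [df Df].
(* The tube lemma is used with full neighbourhoods of 0, so the puncture is carried as the premise
   [h != 0]. *)
have key : \forall h \near (0 : R), forall s, `|s| <= t -> h != 0 ->
    `|h^-1 * (f (h *: v + x, s) - f (x, s)) - 'D_(v, 0) f (x, s)| <= e.
  apply: near_segment => s _.
  have e20 : 0 < e / 2 by rewrite divr_gt0.
  have H : \forall p \near (x, s), A p.1 /\
      `|'D_(v, 0) f (x, s) - 'D_(v, 0) f p| <= e / 2.
    near=> p; split.
      near: p; exists (A, setT) => /=; last by move=> p [].
      by split; [exact: open_nbhs_nbhs|exact: filterT].
    by near: p; apply: (@continuous_dist_le _ _ _ ('D_(v, 0) f)) => //; apply: Df; split.
  have [[/= P Q] [/nbhs_ballP[d /= d0 dP] Qs] PQ] := H.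
  have v10 : 0 < `|v| + 1 by rewrite ltr_wpDl.
  exists (Q, ball (0 : R) (d / (`|v| + 1))).
    by split => //; apply: nbhsx_ballx; rewrite divr_gt0.
  move=> [s' h] /= [Qs']; rewrite -ball_normE /= sub0r normrN => hd h0.
  have Ph (r : R) : 0 <= r <= 1 -> P ((r * h) *: v + x).
    move=> /andP[r0 r1]; apply: dP.
    rewrite -ball_normE /= opprD addrC subrK normrN normrZ normrM ger0_norm //.
    apply: (@le_lt_trans _ _ (`|h| * `|v|)).
      by rewrite ler_wpM2r // ler_piMl.
    apply: (@le_lt_trans _ _ (`|h| * (`|v| + 1))); first by rewrite ler_wpM2l // lerDl.
    by rewrite -ltr_pdivlMr.
  have Ph' (r : R) : 0 <= r <= 1 -> A ((r * h) *: v + x, s').1 /\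
     `|'D_(v, 0) f (x, s) - 'D_(v, 0) f ((r * h) *: v + x, s')| <= e / 2.
    by move=> r01; apply: PQ; split => //=; exact: Ph.
  have line (r : R) : r *: (v, 0) + (x, s') = (r *: v + x, s') :> V * R.
    by congr (_, _); rewrite /= scaler0 add0r.
  have [r r01] : exists2 r : R, 0 <= r <= 1 &
      f (h *: (v, 0) + (x, s')) - f (x, s') = h * 'D_(v, 0) f ((r * h) *: (v, 0) + (x, s')).
    apply: mvt_line => r r01; rewrite line; apply: diff_derivable; apply: df.
    by split=> //; have [] := Ph' r r01.
  rewrite !line => ->; rewrite mulKf //.
  have [_ h1] := Ph' r r01.
  have [_] := Ph' 0 (introT andP (conj (lexx _) ler01)).
  rewrite mul0r scale0r add0r => h2.
  rewrite (_ : _ - _ = ('D_(v, 0) f (x, s) - 'D_(v, 0) f (x, s')) -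
    ('D_(v, 0) f (x, s) - 'D_(v, 0) f ((r * h) *: v + x, s'))); last by ring.
  by rewrite (le_trans (ler_normB _ _)) // [leRHS](splitr e) lerD.
rewrite /dnbhs near_withinE; apply: filterS key => h H h0 s st; exact: H.
Unshelve. all: by end_near. Qed.

End NearSegment.

Section LinearODE.
Context {R : realType} {n : nat}.

Definition lin_ode (B : 'I_n -> 'I_n -> R -> R) (b y : 'I_n -> R -> R) :=
  forall s i, is_derive s (1 : R) (y i) (\sum_j B i j s * y j s + b i s).

(** The Gronwall estimate in the form used for all limits below: [d] depends only on the bounds and
    not on the equation. Rescaling time by [t] reduces [[0, t]] to [[0, 1]] and treats both signs of
    [t] at once. *)
Lemma ode_small (C T e : R) : 0 <= C -> 0 <= T -> 0 < e ->
  exists2 d : R, 0 < d & forall B b y, lin_ode B b y ->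
    (forall s, `|s| <= T -> forall i j, `|B i j s| <= C) ->
    (forall s, `|s| <= T -> forall i, `|b i s| <= d) ->
    (forall i, `|y i 0| <= d) ->
    forall s, `|s| <= T -> forall i, `|y i s| <= e.
Proof.
move=> C0 T0 e0.
pose X := expR (2 * n%:R * (T * C) + 1).
(* [K] bounds the factor in front of [d ^+ 2] when initial values are at most [d] and the rescaled
   forcing at most [T * d]. Since [1 <= K], the choice [d = e / K] gives [K * d ^+ 2 <= e ^+ 2]. *)
pose K := n.+1%:R * (1 + T ^+ 2) * X.
have X1 : 1 <= X.
  by rewrite -expR0 ler_expR addr_ge0 // !mulr_ge0.
have T1 : 1 <= 1 + T ^+ 2 by rewrite lerDl sqr_ge0.
have n1 : 1 <= n.+1%:R :> R by rewrite ler1n.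
have K1 : 1 <= K.
  by rewrite /K -[leLHS]mulr1 ler_pM // -[leLHS]mulr1 ler_pM.
have K0 : 0 < K by rewrite (lt_le_trans _ K1).
exists (e / K); first by rewrite divr_gt0.
have d0 : 0 <= e / K by rewrite divr_ge0 // ltW.
move=> B b y ode HB Hb Hy t tT i.
have ode' : forall s i, is_derive s (1 : R) (fun r => y i (t * r))
    (\sum_j (t * B i j (t * s)) * y j (t * s) + t * b i (t * s)).
  move=> s k; apply: (is_derive_conv (is_derive_dilate (ode (t * s) k))).
  rewrite [_ *: _]mulrDr mulr_sumr; congr (_ + _).
  by apply: eq_bigr => j _; rewrite mulrA.
have st (s : R) : 0 <= s <= 1 -> `|t * s| <= T.
  move=> /andP[s0 s1]; rewrite normrM (ger0_norm s0) (le_trans _ tT) //.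
  by rewrite ler_piMr.
have TC0 : 0 <= T * C by rewrite mulr_ge0.
have Td0 : 0 <= T * (e / K) by rewrite mulr_ge0.
have := energy TC0 Td0 ode'.
rewrite !mulr1 mulr0 -/X => EN.
have H : \sum_i y i t ^+ 2 <= e ^+ 2.
  apply: (@le_trans _ _ ((\sum_i y i 0 ^+ 2 + n%:R * (T * (e / K)) ^+ 2) * X)).
    by apply: EN => s s01 *; rewrite normrM ler_pM // ?HB ?Hb //; exact: st.
  have h1 : \sum_i y i 0 ^+ 2 <= n%:R * (e / K) ^+ 2.
    apply: (@le_trans _ _ (\sum_(i < n) (e / K) ^+ 2)); last first.
      by rewrite sumr_const card_ord mulr_natl.
    apply: ler_sum => k _; have := Hy k; rewrite ler_norml => /andP[h h'].
    by have := mulr_ge0 (_ : 0 <= e / K - y k 0) (_ : 0 <= e / K + y k 0); nra.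
  apply: (@le_trans _ _ (K * (e / K) ^+ 2)); last first.
    rewrite exprMn mulrCA -[leRHS]mulr1 ler_wpM2l ?sqr_ge0 //.
    by rewrite expr2 mulrA mulfV ?gt_eqF // mul1r invf_le1.
  rewrite (_ : K * _ = (n.+1%:R * (1 + T ^+ 2) * (e / K) ^+ 2) * X); last first.
    by rewrite /K; ring.
  rewrite ler_wpM2r //; first by rewrite (le_trans _ X1).
  rewrite exprMn -natr1; have := sqr_ge0 T; have := sqr_ge0 (e / K) => s1 s2.
  have n0 : 0 <= n%:R :> R by [].
  have := mulr_ge0 s2 s1; nra.
have : y i t ^+ 2 <= e ^+ 2.
  apply: le_trans H; rewrite (bigD1 i) //= lerDl.
  by apply: sumr_ge0 => j _; rewrite sqr_ge0.
by rewrite -[y i t ^+ 2]real_normK ?num_real // ler_sqr ?nnegrE // ltW.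
Qed.

Lemma lin_ode_sub B b b' y y' : lin_ode B b y -> lin_ode B b' y' ->
  lin_ode B (fun i s => b i s - b' i s) (fun i s => y i s - y' i s).
Proof.
move=> H H' s i; apply: (is_derive_conv (is_derive_subf (H s i) (H' s i))).
rewrite opprD addrACA; congr (_ + _); rewrite -sumrB; apply: eq_bigr => j _.
by rewrite mulrBr.
Qed.

Lemma lin_ode_shift B b y (t : R) : lin_ode B b y ->
  lin_ode (fun i j s => B i j (s + t)) (fun i s => b i (s + t)) (fun i s => y i (s + t)).
Proof.
move=> H s i; have := @is_derive_affine R R (y i) 1 t s _ _.
rewrite mul1r => /(_ _ (H (s + t) i)); rewrite [1 *: _]mul1r.
by rewrite (_ : (fun r => _) = (fun r => y i (r + t))) //; apply/funext => r; rewrite mul1r.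
Qed.

(** The difference, shifted so that [t0] becomes 0, has zero data and zero forcing, hence is smaller
    than every [e] by [ode_small]. *)
Lemma lin_ode_uniq B b y y' (t0 : R) : (forall i j, continuous (B i j)) ->
  lin_ode B b y -> lin_ode B b y' -> (forall i, y i t0 = y' i t0) ->
  forall i t, y i t = y' i t.
Proof.
move=> cB H H' E i t.
have Hs := lin_ode_shift t0 (lin_ode_sub H H').
have cBs i1 j : continuous (fun s => B i1 j (s + t0)).
  move=> s; apply: (@continuous_comp _ _ _ (fun s => s + t0) (B i1 j)); last exact: cB.
  by apply: cvgD; [exact: cvg_id|exact: cvg_cst].
have [C C0 HC] := segment_bounded_fin (I := ('I_n * 'I_n)%type)
   (f := fun ij s => B ij.1 ij.2 (s + t0)) `|t - t0| (fun ij => cBs ij.1 ij.2).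
apply/eqP; rewrite -subr_eq0 -normr_le0; apply/ler_addgt0Pr => e e0; rewrite add0r.
have [d d0 Hd] := ode_small C0 (normr_ge0 (t - t0)) e0.
have := Hd _ _ _ Hs _ _ _ (t - t0) (lexx _) i; rewrite subrK; apply.
- by move=> s sT i' j; exact: (HC s sT (i', j)).
- by move=> s sT i'; rewrite subrr normr0 ltW.
- by move=> i'; rewrite add0r E subrr normr0 ltW.
Qed.

End LinearODE.

Section ParamODE.
Context {R : realType} {V : normedModType R} {n : nat}.
Implicit Types (A : set V) (B : 'I_n -> 'I_n -> V * R -> R) (b w : 'I_n -> V * R -> R).

Definition par_ode A B b w := forall x, A x ->
  lin_ode (fun i j s => B i j (x, s)) (fun i s => b i (x, s)) (fun i s => w i (x, s)).

(* Existence for a fixed parameter is a hypothesis: it is obtained below by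
   variation of constants from a given transition matrix, so that no
   Picard-Lindelof theorem is needed. *)
Definition solvable A B := forall x, A x ->
  forall c : 'I_n -> R -> R, (forall i, continuous (c i)) -> forall y0 : 'I_n -> R,
  exists2 eta, lin_ode (fun i j s => B i j (x, s)) c eta & forall i, eta i 0 = y0 i.

Lemma slice_continuous (f : V * R -> R) x :
  (forall s, {for (x, s), continuous f}) -> continuous (fun s => f (x, s)).
Proof.
move=> cf s; apply: (@continuous_comp _ _ _ (fun s => (x, s)) f); last exact: cf.
exact: (cvg_pair (cvg_cst x) cvg_id).
Qed.

Lemma ode_continuous (B : 'I_n -> 'I_n -> R -> R) (b y : 'I_n -> R -> R) i : lin_ode B b y -> continuous (y i).
Proof.
move=> H s; apply: differentiable_continuous; apply/derivable1_diffP.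
by have [] := H s i.
Qed.

Lemma ler_sum_card (F : 'I_n -> R) (c : R) : (forall i, `|F i| <= c) ->
  `|\sum_i F i| <= n%:R * c.
Proof.
move=> H; apply: (le_trans (ler_norm_sum _ _ _)).
apply: (le_trans (ler_sum _ (fun i _ => H i))).
by rewrite sumr_const card_ord mulr_natl.
Qed.

(** The difference of the solutions at [x] and [x0] solves the equation at [x] with a forcing built
    from the increments of [B] and [b]. These are small uniformly on a time interval, so [ode_small]
    applies; continuity in time handles the rest. *)
Lemma par_ode_continuous A B b w : open A -> par_ode A B b w ->
  (forall i j, Cr 0 (A `*` setT) (B i j)) -> (forall i, Cr 0 (A `*` setT) (b i)) ->
  (forall i, Cr 0 A (fun x => w i (x, 0))) -> forall i, Cr 0 (A `*` setT) (w i).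
Proof.
move=> oA ode cB cb cw i [x0 t0] [/= Ax0 _].
have cB0 i1 j s : {for (x0, s), continuous (B i1 j)} by apply: cB.
have cb0 i1 s : {for (x0, s), continuous (b i1)} by apply: cb.
apply/cvgrPdist_le => e e0.
pose T := `|t0| + 1.
have T0 : 0 <= T by rewrite addr_ge0.
have cwx i1 : continuous (fun s => w i1 (x0, s)) by apply: ode_continuous (ode x0 Ax0).
have [CB CB0 HCB] := segment_bounded_fin (I := ('I_n * 'I_n)%type)
   (f := fun ij s => B ij.1 ij.2 (x0, s)) T
   (fun ij => slice_continuous (cB0 ij.1 ij.2)).
have [C0 C00 HC0] := segment_bounded_fin (I := 'I_n) T cwx.
have e20 : 0 < e / 2 by rewrite divr_gt0.
have [d d0 Hd] := @ode_small R n (CB + 1) T _ (addr_ge0 CB0 ler01) T0 e20.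
pose K := n%:R * C0 + 1.
have K1 : 1 <= K by rewrite lerDr mulr_ge0.
have K0 : 0 < K by rewrite (lt_le_trans _ K1).
(* The bound 1 keeps the coefficients at nearby parameters below [CB + 1]; the bound [d / K] makes
   the forcing of the difference at most [d]. *)
pose d2 := Num.min 1 (d / K).
have d20 : 0 < d2 by rewrite lt_min ltr01 divr_gt0.
have N1 : \forall x \near x0, forall ij : 'I_n * 'I_n, forall s, `|s| <= T ->
    `|B ij.1 ij.2 (x, s) - B ij.1 ij.2 (x0, s)| <= d2.
  by apply: filter_forall => ij; apply: near_slab_continuous.
have N2 : \forall x \near x0, forall i, forall s, `|s| <= T ->
    `|b i (x, s) - b i (x0, s)| <= d2.
  by apply: filter_forall => k; apply: near_slab_continuous.
have N3 : \forall x \near x0, forall i, `|w i (x0, 0) - w i (x, 0)| <= d.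
  apply: filter_forall => k.
  by apply: (@continuous_dist_le _ _ _ (fun x => w k (x, 0))) => //; exact: cw.
have N4 : \forall s \near t0, `|s| <= T.
  have : \forall s \near t0, `|t0 - s| <= 1.
    by apply: (@continuous_dist_le _ _ _ (fun s : R => s)) => //; exact: cvg_id.
  apply: filterS => s h; rewrite -[s](subKr t0) (le_trans (ler_normB _ _)) //.
  by rewrite lerD.
have N5 : \forall s \near t0, `|w i (x0, t0) - w i (x0, s)| <= e / 2.
  by apply: (@continuous_dist_le _ _ _ (fun s => w i (x0, s))) => //; exact: cwx.
have N6 : \forall x \near x0, A x by apply: open_nbhs_nbhs.
exists ([set x | [/\ A x, forall ij : 'I_n * 'I_n, forall s, `|s| <= T ->
    `|B ij.1 ij.2 (x, s) - B ij.1 ij.2 (x0, s)| <= d2,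
    forall i, forall s, `|s| <= T -> `|b i (x, s) - b i (x0, s)| <= d2
    & forall i, `|w i (x0, 0) - w i (x, 0)| <= d]],
   [set s | `|s| <= T /\ `|w i (x0, t0) - w i (x0, s)| <= e / 2]) => /=.
  split; last by apply: filterS2 N4 N5.
  near=> x; split; first by near: x.
  - by near: x.
  - by near: x.
  - by near: x.
move=> [x s] /= [[Ax h1 h2 h3] [sT h5]].
have ode_d : lin_ode (fun i j s => B i j (x, s))
   (fun i s => \sum_j (B i j (x, s) - B i j (x0, s)) * w j (x0, s) + (b i (x, s) - b i (x0, s)))
   (fun i s => w i (x, s) - w i (x0, s)).
  move=> r k; apply: (is_derive_conv (is_derive_subf (ode x Ax r k) (ode x0 Ax0 r k))).
  rewrite addrA opprD addrACA; congr (_ + _); rewrite -sumrB -big_split /=.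
  by apply: eq_bigr => j _; ring.
have := Hd _ _ _ ode_d _ _ _ s sT i => Hs.
rewrite (_ : _ - _ = (w i (x0, t0) - w i (x0, s)) - (w i (x, s) - w i (x0, s))); last by ring.
rewrite (le_trans (ler_normB _ _)) // [leRHS](splitr e) lerD //.
apply: Hs.
- move=> r rT k j; rewrite -[B k j (x, r)](subrK (B k j (x0, r))) addrC.
  rewrite (le_trans (ler_normD _ _)) // lerD //; first exact: (HCB r rT (k, j)).
  by rewrite (le_trans (h1 (k, j) r rT)) // ge_min lexx.
- move=> r rT k.
  have dK : d2 <= d / K by rewrite ge_min lexx orbT.
  apply: (@le_trans _ _ (n%:R * (d2 * C0) + d2)).
    rewrite (le_trans (ler_normD _ _)) // lerD //; last exact: h2.
    by apply: ler_sum_card => j; rewrite normrM ler_pM //; [exact: (h1 (k, j))|exact: HC0].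
  rewrite (_ : _ + _ = d2 * K); last by rewrite /K; ring.
  by rewrite -ler_pdivlMr.
- by move=> k; rewrite distrC.
Unshelve. all: by end_near. Qed.

(** The candidate [eta] solves the formally differentiated equation. Quotient minus candidate solves
    a linear equation whose initial value and forcing tend to 0 with [h], so [ode_small] forces it
    to 0. *)
Lemma par_ode_derivable A B b w (v : V) (dw0 : 'I_n -> V -> R) : open A -> par_ode A B b w ->
  (forall i j, Cr 1 (A `*` setT) (B i j)) -> (forall i, Cr 1 (A `*` setT) (b i)) ->
  (forall i x, A x -> is_derive x v (fun x => w i (x, 0)) (dw0 i x)) ->
  forall x eta, A x ->
  lin_ode (fun i j s => B i j (x, s))
    (fun i s => \sum_j 'D_(v, 0) (B i j) (x, s) * w j (x, s) + 'D_(v, 0) (b i) (x, s)) eta ->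
  (forall i, eta i 0 = dw0 i x) ->
  forall i t, is_derive (x, t) (v, 0) (w i) (eta i t).
Proof.
move=> oA ode CB Cb dw x eta Ax oeta eta0 i t.
have cB0 i1 j s : {for (x, s), continuous (B i1 j)} by apply: Cr_continuous (CB _ _) _.
suff L : h^-1 *: ((w i \o shift (x, t)) (h *: ((v, 0) : V * R)) - w i (x, t)) @[h --> 0^'] --> eta i t.
  split; first by apply/cvg_ex; exists (eta i t).
  exact/cvg_lim.
apply/cvgrPdist_le => e e0.
pose T := `|t|.
have T0 : 0 <= T by rewrite /T.
have cwx i1 : continuous (fun s => w i1 (x, s)) by apply: ode_continuous (ode x Ax).
have [CB1 CB0 HCB] := segment_bounded_fin (I := ('I_n * 'I_n)%type)
   (f := fun ij s => B ij.1 ij.2 (x, s)) T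
   (fun ij => slice_continuous (cB0 ij.1 ij.2)).
have [C0 C00 HC0] := segment_bounded_fin (I := 'I_n) T cwx.
have [C1 C10 HC1] := segment_bounded_fin (I := 'I_n) T (fun k => @ode_continuous _ _ _ k oeta).
have [d d0 Hd] := @ode_small R n (CB1 + 1) T _ (addr_ge0 CB0 ler01) T0 e0.
pose K := n%:R * C0 + n%:R * C1 + 1.
have K1 : 1 <= K by rewrite lerDr addr_ge0 // mulr_ge0.
have K0 : 0 < K by rewrite (lt_le_trans _ K1).
pose d2 := Num.min 1 (d / K).
have d20 : 0 < d2 by rewrite lt_min ltr01 divr_gt0.
have line : \forall h \near (0 : R)^', A (h *: v + x).
  have c : {for 0, continuous (fun h : R => h *: v + x)}.
    by apply: cvgD; [exact: scalel_continuous|exact: cvg_cst].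
  have nA : nbhs (0 *: v + x) A by rewrite scale0r add0r; exact: open_nbhs_nbhs.
  by apply: cvg_within; exact: (c _ nA).
have N1 : \forall h \near (0 : R)^', forall ij : 'I_n * 'I_n, forall s, `|s| <= T ->
    `|B ij.1 ij.2 (h *: v + x, s) - B ij.1 ij.2 (x, s)| <= d2.
  apply: filter_forall => ij.
  have c : {for 0, continuous (fun h : R => h *: v + x)}.
    by apply: cvgD; [exact: scalel_continuous|exact: cvg_cst].
  have := @near_slab_continuous R V (B ij.1 ij.2) x T d2 d20 (cB0 _ _).
  rewrite -[x in \forall y \near x, _]add0r -(scale0r v) => H.
  by apply: cvg_within; exact: (c _ H).
have N2 : \forall h \near (0 : R)^', forall ij : 'I_n * 'I_n, forall s, `|s| <= T ->
    `|h^-1 * (B ij.1 ij.2 (h *: v + x, s) - B ij.1 ij.2 (x, s)) -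
      'D_(v, 0) (B ij.1 ij.2) (x, s)| <= d2.
  by apply: filter_forall => ij; exact: (near_slab_derive v T oA Ax d20 (CB _ _)).
have N3 : \forall h \near (0 : R)^', forall i, forall s, `|s| <= T ->
    `|h^-1 * (b i (h *: v + x, s) - b i (x, s)) - 'D_(v, 0) (b i) (x, s)| <= d2.
  by apply: filter_forall => k; exact: (near_slab_derive v T oA Ax d20 (Cb _)).
have N4 : \forall h \near (0 : R)^', forall i,
    `|dw0 i x - h^-1 * (w i (h *: v + x, 0) - w i (x, 0))| <= d.
  apply: filter_forall => k.
  have [Dw Ew] := dw k x Ax.
  have L : h^-1 *: (((fun x => w k (x, 0)) \o shift x) (h *: v) - w k (x, 0)) @[h --> 0^'] --> dw0 k x.
    by rewrite -Ew; exact: Dw.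
  by move/cvgrPdist_le : L => /(_ d d0).
have N5 : \forall h \near (0 : R)^', h != 0 by apply: nbhs_dnbhs_neq.
near=> h.
have Ah : A (h *: v + x) by near: h.
have h1 : forall ij : 'I_n * 'I_n, forall s, `|s| <= T ->
    `|B ij.1 ij.2 (h *: v + x, s) - B ij.1 ij.2 (x, s)| <= d2 by near: h.
have h2 : forall ij : 'I_n * 'I_n, forall s, `|s| <= T ->
    `|h^-1 * (B ij.1 ij.2 (h *: v + x, s) - B ij.1 ij.2 (x, s)) -
      'D_(v, 0) (B ij.1 ij.2) (x, s)| <= d2 by near: h.
have h3 : forall i, forall s, `|s| <= T ->
    `|h^-1 * (b i (h *: v + x, s) - b i (x, s)) - 'D_(v, 0) (b i) (x, s)| <= d2 by near: h.
have h4 : forall i, `|dw0 i x - h^-1 * (w i (h *: v + x, 0) - w i (x, 0))| <= d by near: h.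
have h0 : h != 0 by near: h.
have -> : (w i \o shift (x, t)) (h *: ((v, 0) : V * R)) = w i (h *: v + x, t).
  by rewrite /=; congr (w i (_, _)); rewrite /= scaler0 add0r.
(* The coefficient matrix is taken at the displaced parameter; the forcing then consists of the
   errors of the quotients of [B] and [b], plus the increment of [B] applied to [eta]. *)
have ode_d : lin_ode (fun i j s => B i j (h *: v + x, s))
   (fun i s => (\sum_j (h^-1 * (B i j (h *: v + x, s) - B i j (x, s)) - 'D_(v, 0) (B i j) (x, s)) * w j (x, s)
     + \sum_j (B i j (h *: v + x, s) - B i j (x, s)) * eta j s)
     + (h^-1 * (b i (h *: v + x, s) - b i (x, s)) - 'D_(v, 0) (b i) (x, s)))
   (fun i s => h^-1 * (w i (h *: v + x, s) - w i (x, s)) - eta i s).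
  move=> r k.
  have D1 := is_derive_subf (ode _ Ah r k) (ode x Ax r k).
  have D2 := is_derive_mulf (is_derive_cst h^-1 r 1) D1.
  apply: (is_derive_conv (is_derive_subf D2 (oeta r k))).
  rewrite mul0r add0r /cst.
  set b1 := b k (h *: v + x, r); set b0 := b k (x, r); set db := 'D_(v, 0) (b k) (x, r).
  rewrite (_ : \sum_j B k j (h *: v + x, r) * (h^-1 * (w j (h *: v + x, r) - w j (x, r)) - eta j r) =
     h^-1 * (\sum_j B k j (h *: v + x, r) * w j (h *: v + x, r) - \sum_j B k j (h *: v + x, r) * w j (x, r))
      - \sum_j B k j (h *: v + x, r) * eta j r); last first.
    rewrite -sumrB mulr_sumr -sumrB; apply: eq_bigr => j _; ring.
  rewrite (_ : \sum_j (h^-1 * (B k j (h *: v + x, r) - B k j (x, r)) - 'D_(v, 0) (B k j) (x, r)) * w j (x, r)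
    = h^-1 * (\sum_j B k j (h *: v + x, r) * w j (x, r) - \sum_j B k j (x, r) * w j (x, r))
      - \sum_j 'D_(v, 0) (B k j) (x, r) * w j (x, r)); last first.
    rewrite -sumrB mulr_sumr -sumrB; apply: eq_bigr => j _; ring.
  rewrite (_ : \sum_j (B k j (h *: v + x, r) - B k j (x, r)) * eta j r =
    \sum_j B k j (h *: v + x, r) * eta j r - \sum_j B k j (x, r) * eta j r); last first.
    rewrite -sumrB; apply: eq_bigr => j _; ring.
  by ring.
have := Hd _ _ _ ode_d _ _ _ t (lexx _) i => Hs.
rewrite distrC; apply: Hs.
- move=> r rT k j; rewrite -[B k j (_, r)](subrK (B k j (x, r))) addrC.
  rewrite (le_trans (ler_normD _ _)) // lerD //; first exact: (HCB r rT (k, j)).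
  by rewrite (le_trans (h1 (k, j) r rT)) // ge_min lexx.
- move=> r rT k.
  have dK : d2 <= d / K by rewrite ge_min lexx orbT.
  apply: (@le_trans _ _ (n%:R * (d2 * C0) + n%:R * (d2 * C1) + d2)).
    rewrite (le_trans (ler_normD _ _)) // lerD //; last exact: h3.
    rewrite (le_trans (ler_normD _ _)) // lerD //.
      by apply: ler_sum_card => j; rewrite normrM ler_pM //; [exact: (h2 (k, j))|exact: HC0].
    by apply: ler_sum_card => j; rewrite normrM ler_pM //; [exact: (h1 (k, j))|exact: HC1].
  rewrite (_ : _ + _ = d2 * K); last by rewrite /K; ring.
  by rewrite -ler_pdivlMr.
- by move=> k; rewrite eta0 distrC.
Unshelve. all: by end_near. Qed.

End ParamODE.

Section Antiderivative.
Context {R : realType}.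

Lemma antiderivative_right (f : R -> R) : continuous f ->
  exists2 F : R -> R, F 0 = 0 & forall t : R, -1 < t -> is_derive t (1 : R) F (f t).
Proof.
move=> cf; pose mu := @lebesgue_measure R.
pose G x := (\int[mu]_(t in [set` `[-1, x]]) (f t))%R.
have dG (t : R) : -1 < t -> is_derive t (1 : R) G (f t).
  move=> t1.
  have fi : mu.-integrable [set` `[-1, t + 1]] (EFin \o f).
    apply: continuous_compact_integrable; first exact: segment_compact.
    exact: continuous_subspaceT.
  have tt : t < t + 1 by rewrite ltrDl.
  have [D E] := continuous_FTC1_closed tt fi t1 (cf t).
  by split=> //; rewrite -derive1E.
exists (fun t => G t - G 0); first by rewrite subrr.
move=> t /dG H; apply: (is_derive_conv (is_derive_subf H (is_derive_cst (G 0) t 1))).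
by rewrite subr0.
Qed.

(** An integral starting at -1 has the right derivative only to the right of -1, and its reflection
    only to the left of 1. On the overlap up to 0 the two have the same derivative and vanish at 0,
    so they can be glued there. *)
Lemma antiderivative (f : R -> R) : continuous f ->
  exists2 F : R -> R, F 0 = 0 & forall t, is_derive t (1 : R) F (f t).
Proof.
move=> cf; have [F1 F10 dF1] := antiderivative_right cf.
have cfN : continuous (fun t => f (- t)).
  by move=> t; apply: (@continuous_comp _ _ _ -%R f); [exact: opp_continuous|exact: cf].
have [F2 F20 dF2] := antiderivative_right cfN.
have dF2' (t : R) : t < 1 -> is_derive t (1 : R) (fun s => - F2 (-1 * s)) (f t).
  move=> t1; have t1' : -1 < -1 * t by rewrite mulN1r ltrN2.
  have := is_derive_dilate (dF2 _ t1'); rewrite mulN1r opprK => H.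
  by apply: (is_derive_conv (is_deriveN H)); rewrite scaleN1r opprK.
have agree (t : R) : -1 < t -> t <= 0 -> F1 t = - F2 (-1 * t).
  move=> t1 t0.
  pose g s := F1 s - - F2 (-1 * s).
  have dg (s : R) : -1 < s -> s < 1 -> is_derive s (1 : R) g 0.
    by move=> s0 s1; apply: (is_derive_conv (is_derive_subf (dF1 s s0) (dF2' s s1))); rewrite subrr.
  have lt1 (s : R) : t <= s -> s <= 0 -> -1 < s /\ s < 1.
    by move=> h h'; split; [exact: lt_le_trans h|rewrite (le_lt_trans h')].
  have [||s _] := @MVT_segment R g (fun=> 0) t 0 t0.
  - by move=> s; rewrite in_itv /= => /andP[/ltW h /ltW h']; have [] := lt1 s h h'; exact: dg.
  - apply: continuous_in_subspaceT => s; rewrite inE /= in_itv /= => /andP[h h'].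
    apply: differentiable_continuous; apply/derivable1_diffP.
    by have [? ?] := lt1 s h h'; have [] := dg s.
  rewrite mul0r /g mulr0 F10 F20 oppr0 subrr sub0r => /eqP.
  by rewrite oppr_eq0 subr_eq0 => /eqP.
exists (fun t => if 0 <= t then F1 t else - F2 (-1 * t)); first by rewrite lexx.
move=> t; have [t1|t1] := ltP (-1) t.
  apply: near_eq_is_derive (dF1 t t1).
  have : \forall s \near t, -1 < s by exact: lt_nbhsr.
  by apply: filterS => s s1; case: ifPn => //; rewrite -ltNge => /ltW; exact: agree.
have t0 : t < 0 by rewrite (le_lt_trans t1).
apply: near_eq_is_derive (dF2' t (lt_trans t0 ltr01)).
have : \forall s \near t, s < 0 by exact: lt_nbhsl.
by apply: filterS => s s1; rewrite leNgt s1.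
Qed.
End Antiderivative.

Lemma open_slab (R : realType) (V : normedModType R) (A : set V) : open A ->
  open (A `*` [set: R]).
Proof.
move=> oA; rewrite openE => -[x t] [/= Ax _].
exists (A, setT) => //=.
by split; [apply: open_nbhs_nbhs|exact: filterT].
Qed.

Section ParamODESmooth.
Context {R : realType} {V : normedModType R} {n : nat}.
Implicit Types (A : set V) (B : 'I_n -> 'I_n -> V * R -> R) (b w : 'I_n -> V * R -> R).

(** [solvable] produces the solution of the differentiated equation with the right initial value,
    and [par_ode_derivable] identifies it with the derivative. The result is again a parametrised
    equation with the same matrix [B]. *)
Lemma par_ode_variation A B b w (v : V) : open A -> solvable A B -> par_ode A B b w ->
  (forall i j, Cr 1 (A `*` setT) (B i j)) -> (forall i, Cr 1 (A `*` setT) (b i)) ->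
  (forall i, Cr 1 A (fun x => w i (x, 0))) ->
  [/\ forall x t i, A x -> derivable (w i) (x, t) (v, 0),
      par_ode A B (fun i p => \sum_j 'D_(v, 0) (B i j) p * w j p + 'D_(v, 0) (b i) p)
        (fun i => 'D_(v, 0) (w i))
    & forall x i, A x -> 'D_(v, 0) (w i) (x, 0) = 'D_v (fun x => w i (x, 0)) x].
Proof.
move=> oA sol ode CB Cb Cw.
have cDB x i j s : A x -> {for (x, s), continuous ('D_(v, 0) (B i j))}.
  by move=> Ax; apply: (CB i j).2.
have cDb x i s : A x -> {for (x, s), continuous ('D_(v, 0) (b i))}.
  by move=> Ax; apply: (Cb i).2.
have key x : A x -> exists2 eta,
   lin_ode (fun i j s => B i j (x, s))
    (fun i s => \sum_j 'D_(v, 0) (B i j) (x, s) * w j (x, s) + 'D_(v, 0) (b i) (x, s)) eta &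
   forall i, eta i 0 = 'D_v (fun x => w i (x, 0)) x.
  move=> Ax; apply: sol => // i s; apply: cvgD; last first.
    exact: (slice_continuous (fun s => cDb x i s Ax)).
  apply: continuous_at_sum => j _; apply: cvgM.
    exact: (slice_continuous (fun s => cDB x i j s Ax)).
  exact: (ode_continuous (ode x Ax)).
have dw i x : A x -> is_derive x v (fun x => w i (x, 0)) ('D_v (fun x => w i (x, 0)) x).
  by move=> Ax; apply/derivableP/diff_derivable/(Cw i).1.
have key2 x eta (Ax : A x) oeta eta0 :=
  par_ode_derivable (dw0 := fun i x => 'D_v (fun x => w i (x, 0)) x) oA ode CB Cb dw
    (x := x) (eta := eta) Ax oeta eta0.
split.
- move=> x t i Ax; have [eta oeta eta0] := key x Ax.
  by have [] := key2 x eta Ax oeta eta0 i t.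
- move=> x Ax s i; have [eta oeta eta0] := key x Ax.
  have E k : (fun s => 'D_(v, 0) (w k) (x, s)) = eta k.
    by apply/funext => r; have [] := key2 x eta Ax oeta eta0 k r.
  rewrite E; apply: (is_derive_conv (oeta s i)); congr (_ + _).
  by apply: eq_bigr => j _; rewrite -E.
- move=> x i Ax; have [eta oeta eta0] := key x Ax.
  by rewrite -eta0; have [] := key2 x eta Ax oeta eta0 i 0.
Qed.

Lemma is_derive_slice (f : V * R -> R) (x : V) (t d : R) :
  is_derive t (1 : R) (fun s => f (x, s)) d <-> is_derive (x, t) ((0, 1) : V * R) f d.
Proof.
have := @is_derive_line R (V * R)%type R f (x, 0) ((0, 1) : V * R) t d.
have -> : (fun s : R => f (s *: ((0, 1) : V * R) + (x, 0))) = fun s => f (x, s).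
  apply/funext => s; congr (f (_, _)) => /=; first by rewrite scaler0 add0r.
  by rewrite addr0 [_ *: _]mulr1.
have -> : t *: ((0, 1) : V * R) + (x, 0) = (x, t).
  by congr (_, _) => /=; [rewrite scaler0 add0r|rewrite addr0 [_ *: _]mulr1].
by [].
Qed.

Lemma bvecX (bV : finBasis V) (i : 'I_(fdim (basisX bV basisR))) :
  (exists j, bvec (basisX bV basisR) i = (bvec bV j, 0)) \/
  bvec (basisX bV basisR) i = ((0, 1) : V * R).
Proof. by rewrite /=; case: fintype.split => j; [left; exists j|right]. Qed.

(* A parameter derivative of [w] solves the linear equation with the same [B],
   hence the induction on [r]. *)
Lemma par_ode_Cr (bV : finBasis V) r A B b w : open A -> solvable A B ->
  par_ode A B b w ->
  (forall i j, Cr r (A `*` setT) (B i j)) -> (forall i, Cr r (A `*` setT) (b i)) ->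
  (forall i, Cr r A (fun x => w i (x, 0))) ->
  forall i, Cr r (A `*` setT) (w i).
Proof.
move=> oA sol; elim: r b w => [|r IH] b w ode CB Cb Cw.
  exact: par_ode_continuous ode CB Cb Cw.
have oAT := open_slab oA.
have CB' i j : Cr r (A `*` setT) (B i j) by exact: CrS.
have Cb' i : Cr r (A `*` setT) (b i) by exact: CrS.
have Cwr i : Cr r (A `*` setT) (w i).
  by apply: (IH b) => // k; apply: CrS.
have D1 i x t : A x -> is_derive (x, t) ((0, 1) : V * R) (w i)
    (\sum_j B i j (x, t) * w j (x, t) + b i (x, t)).
  by move=> Ax; apply/is_derive_slice; exact: ode.
have W1 : forall f, Cr r.+1 (A `*` setT) f -> Cr 1 (A `*` [set: R]) (f : V * R -> R).
  by move=> f; apply: CrW.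
have W1' : forall f, Cr r.+1 A f -> Cr 1 A (f : V -> R) by move=> f; apply: CrW.
have var v := par_ode_variation v oA sol ode (fun i j => W1 _ (CB i j))
  (fun i => W1 _ (Cb i)) (fun i => W1' _ (Cw i)).
move=> i; apply: (Cr_partials (b := basisX bV basisR)) => //.
  move=> k [x t]; case: (bvecX k) => [[j ->]|->] [/= Ax _].
    by have [H _ _] := var (bvec bV j); exact: H.
  by have [] := D1 i x t Ax.
(* A derivative in a direction of [V] solves the varied equation, whose forcing is C^r because [w]
   already is; the time derivative is read off the equation itself. *)
move=> k; case: (bvecX k) => [[j ->]|->].
  have [_ ode' E] := var (bvec bV j).
  apply: IH ode' _ _ _ _ => //.
    move=> i1; apply: CrD => //; last exact: (Cb i1).2.
    by apply: Cr_sum => // j1 _; apply: CrM => //; exact: (CB i1 j1).2.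
  move=> i1; apply: (Cr_ext oA _ ((Cw i1).2 (bvec bV j))) => x Ax.
  by rewrite E.
apply: (@Cr_ext _ _ _ _ _ (fun p => \sum_j B i j p * w j p + b i p)) => //.
  by move=> [x t] [/= Ax _]; have [_ ->] := D1 i x t Ax.
by apply: CrD => //; apply: Cr_sum => // j _; exact: CrM.
Qed.

End ParamODESmooth.

(** * Integrals with a parameter, mixed derivatives, division by the parameter *)

Section IndefiniteIntegral.
Context {R : realType}.

Lemma derive_uniq (f g d : R -> R) : (forall t, is_derive t (1 : R) f (d t)) ->
  (forall t, is_derive t (1 : R) g (d t)) -> f 0 = g 0 -> forall t, f t = g t.
Proof.
move=> Hf Hg E t.
have H s : is_derive s (1 : R) (fun t => f t - g t) 0.
  by apply: (is_derive_conv (is_derive_subf (Hf s) (Hg s))); rewrite subrr.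
by have /= := is_derive_0_is_cst t 0 H; rewrite E subrr => /subr0_eq.
Qed.

Lemma solvable0 (V : normedModType R) n (A : set V) :
  solvable A (fun (_ _ : 'I_n) (_ : V * R) => 0).
Proof.
move=> x Ax c cc y0.
have /choice[F HF] : forall i, exists F : R -> R, F 0 = 0 /\ forall t, is_derive t (1 : R) F (c i t).
  by move=> i; have [F F0 dF] := antiderivative (cc i); exists F.
exists (fun i t => F i t + y0 i); last by move=> i; rewrite (HF i).1 add0r.
move=> s i; apply: (is_derive_conv (is_derive_addf ((HF i).2 s) (is_derive_cst (y0 i) s 1))).
by rewrite addr0 big1 ?add0r // => j _; rewrite mul0r.
Qed.

End IndefiniteIntegral.

Section ParamIntegral.
Context {R : realType} {V : normedModType R} (bV : finBasis V).
Implicit Types (A : set V) (f g : V * R -> R).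

Lemma par_ode1 A (g w : V * R -> R) :
  (forall x s, A x -> is_derive s (1 : R) (fun s => w (x, s)) (g (x, s))) ->
  par_ode A (fun (_ _ : 'I_1) (_ : V * R) => 0) (fun _ => g) (fun _ => w).
Proof.
move=> H x Ax s i; apply: (is_derive_conv (H x s Ax)).
by rewrite big1 ?add0r // => j _; rewrite mul0r.
Qed.

(** Integration is the one-dimensional equation with zero coefficient, so regularity in the
    parameter is an instance of [par_ode_Cr], with no differentiation under the integral sign. One
    [w] serves every [r], as the C^infinity case requires. *)
Lemma par_antiderivative A g : open A -> Cr 0 (A `*` setT) g ->
  exists w : V * R -> R,
  [/\ forall x, A x -> w (x, 0) = 0,
      forall x s, A x -> is_derive s (1 : R) (fun s => w (x, s)) (g (x, s))
    & forall r, Cr r (A `*` setT) g -> Cr r (A `*` setT) w].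
Proof.
move=> oA Cg.
have /choice[F HF] : forall x, exists F : R -> R, A x ->
    F 0 = 0 /\ forall t, is_derive t (1 : R) F (g (x, t)).
  move=> x; have [Ax|nAx] := pselect (A x); last by exists (fun=> 0).
  have [|F F0 dF] := @antiderivative R (fun t => g (x, t)); last by exists F.
  by apply: slice_continuous => s; apply: Cg.
exists (fun p => F p.1 p.2); split => /=.
- by move=> x /HF[].
- by move=> x s /HF[_ ]; exact.
- move=> r Cgr; apply: (@par_ode_Cr R V 1 bV r A _ _ (fun _ => (fun p => F p.1 p.2)) oA (@solvable0 R V 1 A)
   (@par_ode1 A g _ _) (fun _ _ => Cr_cst _ _ _) (fun _ => Cgr) _ ord0) => /=.
    by move=> x s /HF[_ ]; exact.
  move=> _; apply: (Cr_ext oA _ (@Cr_cst R V R r A 0)) => x /HF[-> _] //.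
Qed.

(** Symmetry of second derivatives: [f] solves the trivial equation whose forcing is its own time
    derivative, and the variation in [x] of that equation is the claim. *)
Lemma derive_swap A (f : V * R -> R) (v : V) : open A -> Cr 2 (A `*` setT) f ->
  forall x t, A x -> is_derive t (1 : R) (fun s => 'D_(v, 0) f (x, s))
    ('D_(v, 0) ('D_((0, 1) : V * R) f) (x, t)).
Proof.
move=> oA [df Df] x t Ax.
have ode : par_ode A (fun (_ _ : 'I_1) (_ : V * R) => 0) (fun _ => 'D_((0, 1) : V * R) f) (fun _ => f).
  apply: par_ode1 => y s Ay; apply/is_derive_slice.
  by apply/derivableP/diff_derivable/df; split.
have C0 : Cr 1 A (fun x => f (x, 0)).
  have -> : (fun x => f (x, 0)) = (fun x => f ((x, 0) + (0, 0))).
    by apply/funext => y; congr f; congr (_, _); rewrite /= addr0.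
  apply: (@Cr_comp_affine R V (V * R)%type R 1 (A `*` setT) A (fun x => (x, 0)) (0, 0)) => //.
  - by move=> a u u'; congr (_, _) => /=; rewrite scaler0 addr0.
  - by move=> y; apply: (cvg_pair cvg_id (cvg_cst _)).
  - by move=> y Ay; split => //=; rewrite addr0.
  - exact/CrS.
have [_ H _] := par_ode_variation v oA (@solvable0 R V 1 A) ode
  (fun _ _ => Cr_cst _ _ _) (fun _ => Df _) (fun _ => C0).
apply: (is_derive_conv (H x Ax t ord0)).
rewrite !big_ord1 mul0r add0r.
have -> : 'D_(v, 0) (fun _ : V * R => 0 : R) (x, t) = 0 by rewrite derive_cst.
by rewrite mul0r add0r.
Qed.

End ParamIntegral.

Section CrPair.
Context {R : realType} {V W W' : normedModType R}.

Lemma Cr_pair r (A : set V) (f : V -> W) (g : V -> W') : open A ->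
  Cr r A f -> Cr r A g -> Cr r A (fun x => (f x, g x)).
Proof.
move=> oA Cf Cg.
have C1 : Cr r A (fun x => (f x, 0 : W')).
  apply: (Cr_lincomp (c := fun u => (u, 0 : W')) oA _ _ Cf).
    by move=> a u v; congr (_, _); rewrite /= scaler0 addr0.
  by move=> u; apply: (cvg_pair cvg_id (cvg_cst _)).
have C2 : Cr r A (fun x => (0 : W, g x)).
  apply: (Cr_lincomp (c := fun u => (0 : W, u)) oA _ _ Cg).
    by move=> a u v; congr (_, _); rewrite /= scaler0 addr0.
  by move=> u; apply: (cvg_pair (cvg_cst _) cvg_id).
apply: (Cr_ext oA _ (CrD oA C1 C2)) => x _.
by congr (_, _); rewrite /= ?addr0 ?add0r.
Qed.

Lemma Cr_fst r (A : set (W * W')) : Cr r A (fst : W * W' -> W).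
Proof. by apply: Cr_linear => // p; exact: cvg_fst. Qed.

Lemma Cr_snd r (A : set (W * W')) : Cr r A (snd : W * W' -> W').
Proof. by apply: Cr_linear => // p; exact: cvg_snd. Qed.

Lemma Cr_id r (A : set V) : Cr r A (id : V -> V).
Proof. by apply: Cr_linear => // p; exact: cvg_id. Qed.

End CrPair.

Lemma Cr_slice (R : realType) (V W : normedModType R) r (A : set V) (f : V * R -> W) t :
  open A -> Cr r (A `*` setT) f -> Cr r A (fun x => f (x, t)).
Proof.
move=> oA Cf.
have := @Cr_comp_affine R V (V * R)%type W r (A `*` setT) A (fun x => (x, 0)) (0, t) f oA.
have -> : (fun x => f ((x, 0) + (0, t))) = (fun x => f (x, t)).
  by apply/funext => x; congr (f (_, _)); rewrite /= ?addr0 ?add0r.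
apply => //.
- by move=> a v v'; congr (_, _) => /=; rewrite scaler0 addr0.
- by move=> y; apply: (cvg_pair cvg_id (cvg_cst _)).
- by move=> y Ay; split => //=; rewrite addr0.
Qed.

Section Hadamard.
Context {R : realType} {V : normedModType R} (bV : finBasis V).

(* [g (x, e)] is the integral of [s |-> d_e f (x, s e)] over [0, 1]. *)
Lemma hadamard (A : set V) (f : V * R -> R) : open A -> Cr 1 (A `*` setT) f ->
  exists g : V * R -> R,
  [/\ forall x e, A x -> f (x, e) = f (x, 0) + e * g (x, e),
      forall x, A x -> g (x, 0) = 'D_((0, 1) : V * R) f (x, 0),
      forall x y, A x -> A y -> (forall e, f (x, e) = f (y, e)) ->
        forall e, g (x, e) = g (y, e)
    & forall r, Cr r.+1 (A `*` setT) f -> Cr r (A `*` setT) g].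
Proof.
move=> oA Cf; have oAT := open_slab oA; have oATT := open_slab oAT.
pose h (p : (V * R) * R) := 'D_((0, 1) : V * R) f (p.1.1, p.2 * p.1.2).
have Ch r : Cr r.+1 (A `*` setT) f -> Cr r ((A `*` setT) `*` setT) h.
  move=> [_ Df].
  apply: (@Cr_comp R ((V * R) * R)%type (V * R)%type (basisX bV basisR) r _ (A `*` setT)
    ('D_((0, 1) : V * R) f) (fun p => (p.1.1, p.2 * p.1.2))) => //.
  - by move=> [[x e] s] [[/= Ax _] _].
  - exact: Df.
  have C1 : Cr r ((A `*` setT) `*` setT) (fst : (V * R) * R -> V * R) by exact: Cr_fst.
  apply: Cr_pair => //.
    by apply: Cr_lincomp C1 => // p; exact: cvg_fst.
  apply: CrM => //; first exact: Cr_snd.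
  by apply: Cr_lincomp C1 => // p; exact: cvg_snd.
have [w [w0 dw Cw]] := @par_antiderivative R (V * R)%type (basisX bV basisR) _ h oAT (Ch 0%N Cf).
pose g p := w (p, 1).
suff [gP1 gP2 gP3] : [/\ forall x e, A x -> f (x, e) = f (x, 0) + e * g (x, e),
      forall x, A x -> g (x, 0) = 'D_((0, 1) : V * R) f (x, 0)
    & forall r, Cr r.+1 (A `*` setT) f -> Cr r (A `*` setT) g].
  exists g; split=> // x y Ax Ay fxy e.
  (* This clause is what carries periodicity in the angle through the division: for [e != 0] the
     quotient is determined by [f], and at 0 it is the derivative of [f] in [e]. *)
  have [->|e0] := eqVneq e 0.
    rewrite !gP2 //.
    have df z : A z -> derivable f (z, 0) (0, 1) by move=> Az; apply/diff_derivable/Cf.1; split.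
    have H1 := (is_derive_slice _ _ _ _).2 (derivableP (df x Ax)).
    have H2 := (is_derive_slice _ _ _ _).2 (derivableP (df y Ay)).
    have E : (fun s => f (x, s)) = (fun s => f (y, s)) by exact/funext.
    by rewrite E in H1; have [_ <-] := H1; have [_ <-] := H2.
  by apply: (mulfI e0); apply: (addrI (f (x, 0))); rewrite -(gP1 x e Ax) (fxy e) (fxy 0) -gP1.
rewrite /g; split.
- move=> x e Ax.
  have d1 s : is_derive s (1 : R) (fun s => f (x, s * e)) (e * h ((x, e), s)).
    have H : is_derive (e * s) (1 : R) (fun r => f (x, r)) ('D_((0, 1) : V * R) f (x, e * s)).
      by apply/is_derive_slice/derivableP/diff_derivable/Cf.1.
    have := is_derive_dilate H; rewrite /h /= [s * e]mulrC.
    by rewrite (_ : (fun r => f (x, e * r)) = (fun r => f (x, r * e))) //;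
      apply/funext => r; rewrite mulrC.
  have d2 s : is_derive s (1 : R) (fun s => f (x, 0) + e * w ((x, e), s)) (e * h ((x, e), s)).
    have := is_derive_addf (is_derive_cst (f (x, 0)) s 1)
      (is_derive_mulf (is_derive_cst e s 1) (dw (x, e) s (conj Ax I))).
    by move=> H; apply: (is_derive_conv H); rewrite mul0r !add0r.
  have := derive_uniq d1 d2; rewrite mul0r w0 // mulr0 addr0 => /(_ erefl 1).
  by rewrite mul1r.
- move=> x Ax.
  have d1 s : is_derive s (1 : R) (fun s => w ((x, 0), s)) ('D_((0, 1) : V * R) f (x, 0)).
    by have := dw (x, 0) s (conj Ax I); rewrite /h /= mulr0.
  have d2 s : is_derive s (1 : R) (fun s => s * 'D_((0, 1) : V * R) f (x, 0)) ('D_((0, 1) : V * R) f (x, 0)).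
    have := is_derive_mulf (is_derive_id s 1) (is_derive_cst ('D_((0, 1) : V * R) f (x, 0)) s (1 : R)).
    by move=> H; apply: (is_derive_conv H); rewrite mul1r mulr0 addr0.
  have := derive_uniq d1 d2; rewrite mul0r w0 // => /(_ erefl 1).
  by rewrite mul1r.
- move=> r Cfr.
  exact: (Cr_slice 1 oAT (Cw _ (Ch _ Cfr))).
Qed.

End Hadamard.

(** * Fundamental matrices and periodic solutions of forced linear equations *)

Section Fundamental.
Context {R : realType} {n : nat}.

Lemma unitmx_inj (M : 'M[R]_n) : (forall v : 'cV_n, M *m v = 0 -> v = 0) -> M \in unitmx.
Proof.
move=> H; rewrite -unitmx_tr -row_free_unit -kermx_eq0.
apply/rowV0P => v /sub_kermxP E; apply: trmx_inj; rewrite trmx0; apply: H.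
by apply: trmx_inj; rewrite trmx_mul trmxK trmx0.
Qed.

Definition fundamental (B : 'I_n -> 'I_n -> R -> R) (Psi : R -> 'M[R]_n) :=
  Psi 0 = 1%:M /\ forall j, lin_ode B (fun _ _ => 0) (fun i s => Psi s i j).

Lemma fundamental_mul B Psi (v : 'cV_n) : fundamental B Psi ->
  lin_ode B (fun _ _ => 0) (fun i s => (Psi s *m v) i 0).
Proof.
move=> [_ F] s i.
have -> : (fun s => (Psi s *m v) i 0) = (fun s => \sum_j Psi s i j * v j 0).
  by apply/funext => r; rewrite mxE.
apply: (is_derive_conv (is_derive_sumf _ (fun j =>
  is_derive_mulf (F j s i) (is_derive_cst (v j 0) s 1)))).
rewrite [RHS]addr0 [RHS](eq_bigr (fun k => \sum_j B i k s * (Psi s k j * v j 0))); last first.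
  by move=> k _; rewrite mxE mulr_sumr.
rewrite [RHS]exchange_big /=; apply: eq_bigr => j _.
by rewrite addr0 mulr0 addr0 mulr_suml; apply: eq_bigr => k _; rewrite mulrA.
Qed.

Lemma lin_ode0 B : lin_ode B (fun _ _ => 0) (fun (_ : 'I_n) (_ : R) => 0 : R).
Proof.
move=> s i; apply: (is_derive_conv (is_derive_cst (0 : R) s 1)).
by rewrite big1 ?addr0 // => j _; rewrite mulr0.
Qed.

(** A kernel vector of [Psi s] generates a solution that vanishes at [s], hence everywhere; at time
    0 this solution is the vector itself. *)
Lemma fundamental_unit B Psi s : (forall i j, continuous (B i j)) ->
  fundamental B Psi -> Psi s \in unitmx.
Proof.
move=> cB F; apply: unitmx_inj => v E.
have := lin_ode_uniq (t0 := s) cB (fundamental_mul v F) (@lin_ode0 B).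
move=> H; have {}H : forall i, (Psi 0 *m v) i 0 = 0.
  by move=> i; apply: H => k; rewrite /= E mxE.
by apply/matrixP => i j; rewrite (ord1 j) mxE -[RHS](H i) F.1 mul1mx.
Qed.

(** The solution is [Psi s] applied to [y0] plus the antiderivative [J] of the inverse of [Psi]
    times [c]. *)
Lemma fundamental_solve B Psi c y0 : (forall i j, continuous (B i j)) ->
  fundamental B Psi -> (forall i, continuous (c i)) ->
  exists2 eta, lin_ode B c eta & forall i, eta i 0 = y0 i.
Proof.
move=> cB F cc.
have U s : Psi s \in unitmx by exact: fundamental_unit F.
have cPsi i j : continuous (fun s => Psi s i j) by exact: (ode_continuous (F.2 j)).
have cI i j : continuous (fun s => invmx (Psi s) i j).
  move=> s; apply: (@Cr_continuous _ _ _ 0 setT) => //.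
  by apply: Cr_invmx => //; [exact: openT|move=> i1 j1 x _; exact: cPsi].
have /choice[J HJ] : forall i, exists J : R -> R, J 0 = 0 /\
   forall t, is_derive t (1 : R) J (\sum_j invmx (Psi t) i j * c j t).
  move=> i; have [|J J0 dJ] := @antiderivative R (fun t => \sum_j invmx (Psi t) i j * c j t).
    by move=> s; apply: continuous_at_sum => j _; apply: cvgM; [exact: cI|exact: cc].
  by exists J.
exists (fun i s => \sum_j Psi s i j * (J j s + y0 j)).
  move=> s i; apply: (is_derive_conv (is_derive_sumf _ (fun j =>
    is_derive_mulf (F.2 j s i) (is_derive_addf ((HJ j).2 s) (is_derive_cst (y0 j) s 1))))).
  rewrite big_split /=; congr (_ + _).
    rewrite [RHS](eq_bigr (fun k => \sum_j B i k s * (Psi s k j * (J j s + y0 j)))); last first.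
      by move=> k _; rewrite mulr_sumr.
    rewrite [RHS]exchange_big /=; apply: eq_bigr => j _.
    by rewrite addr0 mulr_suml; apply: eq_bigr => k _; rewrite mulrA.
  rewrite (eq_bigr (fun j => \sum_k (Psi s i j * invmx (Psi s) j k) * c k s)); last first.
    by move=> j _; rewrite addr0 mulr_sumr; apply: eq_bigr => k _; rewrite mulrA.
  rewrite exchange_big /= (eq_bigr (fun k => (1%:M : 'M[R]_n) i k * c k s)); last first.
    by move=> k _; rewrite -mulr_suml -(mulmxV (U s)) mxE.
  rewrite (bigD1 i) //= mxE eqxx mul1r big1 ?addr0 // => k ki.
  by rewrite mxE eq_sym (negPf ki) mul0r.
move=> i; rewrite F.1 (bigD1 i) //= mxE eqxx mul1r (HJ i).1 add0r big1 ?addr0 // => k ki.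
by rewrite mxE eq_sym (negPf ki) mul0r.
Qed.

End Fundamental.

Section LinComb.
Context {R : realType} {n : nat}.

Lemma lin_ode_add (B : 'I_n -> 'I_n -> R -> R) b b' y y' :
  lin_ode B b y -> lin_ode B b' y' ->
  lin_ode B (fun i s => b i s + b' i s) (fun i s => y i s + y' i s).
Proof.
move=> H H' s i; apply: (is_derive_conv (is_derive_addf (H s i) (H' s i))).
rewrite addrACA; congr (_ + _); rewrite -big_split; apply: eq_bigr => j _.
by rewrite mulrDr.
Qed.

Lemma lin_ode_comb N (B : 'I_n -> 'I_n -> R -> R) (c : 'I_N -> R)
    (b y : 'I_N -> 'I_n -> R -> R) :
  (forall l, lin_ode B (b l) (y l)) ->
  lin_ode B (fun i s => \sum_l c l * b l i s) (fun i s => \sum_l c l * y l i s).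
Proof.
move=> H s i; apply: (is_derive_conv (is_derive_sumf _ (fun l =>
  is_derive_mulf (is_derive_cst (c l) s 1) (H l s i)))).
rewrite (eq_bigr (fun l => \sum_j c l * (B i j s * y l j s) + c l * b l i s)).
  rewrite big_split /=; congr (_ + _); rewrite exchange_big /=; apply: eq_bigr => j _.
  by rewrite mulr_sumr; apply: eq_bigr => l _; rewrite mulrCA.
by move=> l _; rewrite mul0r add0r /cst mulrDr mulr_sumr.
Qed.

Lemma lin_ode_eq (B : 'I_n -> 'I_n -> R -> R) b b' y y' : lin_ode B b y ->
  (forall i s, b i s = b' i s) -> (forall i s, y i s = y' i s) -> lin_ode B b' y'.
Proof.
move=> H Eb Ey s i.
have -> : y' i = y i by apply/funext => r; rewrite Ey.
by rewrite -Eb; under eq_bigr do rewrite -Ey.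
Qed.

End LinComb.

Section PeriodicSolve.
Context {R : realType} {V : normedModType R} (bV : finBasis V) {n N : nat}.
Variables (U : set V) (T : R) (B : 'I_n -> 'I_n -> V * R -> R) (Psi : V -> R -> 'M[R]_n).
Variables (Z Y : 'I_N -> 'I_n -> V * R -> R) (z0 : 'I_N -> 'I_n -> V -> R).

Definition time_periodic (f : V * R -> R) := forall x s, U x -> f (x, s + T) = f (x, s).

Hypothesis oU : open U.
Hypothesis cB : forall i j, Cr 0 (U `*` setT) (B i j).
Hypothesis fundPsi : forall x, U x -> fundamental (fun i j s => B i j (x, s)) (Psi x).
Hypothesis odeY : forall l, par_ode U B (fun i p => - Z l i p) (Y l).
Hypothesis Y0 : forall l i x, U x -> Y l i (x, 0) = 0.
Hypothesis perB : forall i j, time_periodic (B i j).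
Hypothesis perZ : forall l i, time_periodic (Z l i).
Hypothesis inj : forall x (u : 'I_n -> R) (rho : 'I_N -> R), U x ->
  (forall i, u i = \sum_j Psi x T i j * u j + \sum_l rho l * Y l i (x, T)) ->
  (forall l, \sum_i z0 l i x * u i = 0) ->
  (forall i, u i = 0) /\ (forall l, rho l = 0).

Let cBx x i j : U x -> continuous (fun s => B i j (x, s)).
Proof. by move=> Ux; apply: slice_continuous => s; apply: cB. Qed.

Let solB : solvable U B.
Proof.
move=> x Ux c cc y0; apply: fundamental_solve (fundPsi Ux) cc => i j; exact: cBx.
Qed.

(* The bordered monodromy matrix acting on (u(x, 0), rho x): its rows are the
   periodicity of [u] and the phase condition [z0 . u = 0]. *)
Let M x : 'M[R]_(n + N) :=
  block_mx (1%:M - Psi x T) (- \matrix_(i < n, l < N) Y l i (x, T))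
           (\matrix_(l < N, i < n) z0 l i x) 0.

Let M_unit x : U x -> M x \in unitmx.
Proof.
move=> Ux; apply: unitmx_inj => v; rewrite -[v]vsubmxK /M mul_block_col.
move: (usubmx v) (dsubmx v) => u rho; rewrite -col_mx0 => /eq_col_mx[E1 E2].
have H1 i : u i 0 = \sum_j Psi x T i j * u j 0 + \sum_l rho l 0 * Y l i (x, T).
  move/matrixP : E1 => /(_ i 0).
  rewrite mulmxBl mul1mx mulNmx !mxE => /eqP; rewrite -addrA -opprD subr_eq0 => /eqP ->.
  by congr (_ + _); apply: eq_bigr => l _; rewrite mxE mulrC.
have H2 l : \sum_i z0 l i x * u i 0 = 0.
  move/matrixP : E2 => /(_ l 0); rewrite mul0mx addr0 !mxE => E.
  by rewrite -[RHS]E; apply: eq_bigr => i _; rewrite mxE.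
have [u0 rho0] := @inj x (fun i => u i 0) (fun l => rho l 0) Ux H1 H2.
have -> : u = 0 by apply/matrixP => i j; rewrite (ord1 j) u0 mxE.
have -> : rho = 0 by apply/matrixP => i j; rewrite (ord1 j) rho0 mxE.
by rewrite col_mx0.
Qed.

(** The general solution is [Psi] applied to an initial value, plus the responses [Y] weighted by
    [rho], plus the response [X] to [h] from rest. Periodicity becomes a linear system with matrix
    [M]. The pair [u], [rho] is built once, and its regularity is asserted for each [r] separately,
    so the same pair serves all classes. *)
Lemma periodic_solve (h : 'I_n -> V * R -> R) :
  (forall i, Cr 0 (U `*` setT) (h i)) -> (forall i, time_periodic (h i)) ->
  exists (u : 'I_n -> V * R -> R) (rho : 'I_N -> V -> R),
  [/\ par_ode U B (fun i p => h i p - \sum_l rho l p.1 * Z l i p) u,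
      forall i, time_periodic (u i)
    & forall r, (forall i j, Cr r (U `*` setT) (B i j)) ->
       (forall l i, Cr r (U `*` setT) (Z l i)) ->
       (forall l i, Cr r U (z0 l i)) ->
       (forall i, Cr r (U `*` setT) (h i)) ->
       (forall i, Cr r (U `*` setT) (u i)) /\ (forall l, Cr r U (rho l))].
Proof.
move=> ch perh.
have /choice[X HX] : forall x, exists X : 'I_n -> R -> R, U x ->
    lin_ode (fun i j s => B i j (x, s)) (fun i s => h i (x, s)) X /\
    (forall i, X i 0 = 0).
  move=> x; have [Ux|nUx] := pselect (U x); last by exists (fun _ _ => 0).
  have [|X oX X0] := @solB x Ux (fun i s => h i (x, s)) _ (fun=> 0); last by exists X.
  by move=> i; apply: slice_continuous => s; apply: ch.
(* The upper block asks that the drift of [X] over one period be compensated; the zero block is the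
   phase condition. *)
pose S x := invmx (M x) *m col_mx (\col_(i < n) X x i T) 0.
pose u0 x : 'cV[R]_n := usubmx (S x).
pose rho l x := dsubmx (S x) l 0.
have SE x i : U x -> u0 x i 0 =
    (Psi x T *m u0 x) i 0 + \sum_l rho l x * Y l i (x, T) + X x i T.
  move=> Ux; have : M x *m S x = col_mx (\col_(i < n) X x i T) 0.
    by rewrite /S mulmxA mulmxV ?M_unit // mul1mx.
  rewrite -[S x]vsubmxK /M mul_block_col => /eq_col_mx[E _].
  have {}E : u0 x = Psi x T *m u0 x +
      (\matrix_(i < n, l < N) Y l i (x, T)) *m dsubmx (S x) + \col_(i < n) X x i T.
    by rewrite -E mulmxBl mul1mx mulNmx addrC -[_ - _ - _]addrA -opprD subrK.
  rewrite {1}E mxE [X in X + _]mxE [X in _ + _ + X]mxE; congr (_ + _ + _).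
  by rewrite mxE; apply: eq_bigr => l _; rewrite mxE mulrC.
pose u i (p : V * R) := (Psi p.1 p.2 *m u0 p.1) i 0
  + \sum_l rho l p.1 * Y l i p + X p.1 i p.2.
have odeu : par_ode U B (fun i p => h i p - \sum_l rho l p.1 * Z l i p) u.
  move=> x Ux; have [oX _] := HX x Ux.
  have H1 := fundamental_mul (u0 x) (fundPsi Ux).
  have H2 := lin_ode_comb (fun l => rho l x) (fun l => odeY l Ux).
  apply: (lin_ode_eq (lin_ode_add (lin_ode_add H1 H2) oX)) => //= i s.
  rewrite add0r addrC -sumrN; congr (_ + _).
  by apply: eq_bigr => l _; rewrite mulrN.
exists u, rho; split=> //.
(* The translate of [u] by one period solves the same equation, all data being periodic, so
   agreement at time 0, which is [SE], is enough. *)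
- move=> i x s Ux.
  have H1 := lin_ode_shift T (odeu x Ux).
  have H2 : lin_ode (fun i j s => B i j (x, s))
     (fun i s => h i (x, s) - \sum_l rho l x * Z l i (x, s)) (fun i s => u i (x, s + T)).
    move=> r k; have := H1 r k; rewrite perh //.
    rewrite (eq_bigr (fun j => B k j (x, r) * u j (x, r + T))); last first.
      by move=> j _; rewrite perB.
    rewrite (eq_bigr (fun l => rho l x * Z l k (x, r))) //.
    by move=> l _; rewrite perZ.
  have cBs k j : continuous (fun s => B k j (x, s)) by exact: cBx.
  apply: (@lin_ode_uniq R n _ _ (fun i s => u i (x, s + T)) (fun i s => u i (x, s)) 0
    cBs H2 (odeu x Ux) _ i s) => k.
  rewrite add0r /u /= -SE // (fundPsi Ux).1 mul1mx (HX x Ux).2 addr0.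
  by rewrite big1 ?addr0 // => l _; rewrite Y0 // mulr0.
- move=> r CB CZ Cz Ch.
  have oUT := open_slab oU.
  have CY l i : Cr r (U `*` setT) (Y l i).
    apply: (@par_ode_Cr R V n bV r U B _ (Y l) oU solB (odeY l) CB) => //.
      by move=> k; apply: CrN.
    by move=> k; apply: (Cr_ext oU _ (@Cr_cst R V R r U 0)) => x Ux; rewrite Y0.
  have CX i : Cr r (U `*` setT) (fun p => X p.1 i p.2).
    apply: (@par_ode_Cr R V n bV r U B h (fun i p => X p.1 i p.2) oU solB _ CB) => //.
      by move=> x /HX[].
    by move=> k; apply: (Cr_ext oU _ (@Cr_cst R V R r U 0)) => x /HX[_ ->].
  have CPsi i j : Cr r (U `*` setT) (fun p => Psi p.1 p.2 i j).
    apply: (@par_ode_Cr R V n bV r U B (fun _ _ => 0) (fun i p => Psi p.1 p.2 i j) oU solB _ CB).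
    - by move=> x /fundPsi[_ H]; exact: H.
    - by move=> k; exact: Cr_cst.
    - move=> k; apply: (Cr_ext oU _ (@Cr_cst R V R r U ((1%:M : 'M[R]_n) k j))) => x Ux /=.
      by rewrite (fundPsi Ux).1.
  have at_T (f : V * R -> R) : Cr r (U `*` setT) f -> Cr r U (fun x => f (x, T)).
    exact: Cr_slice.
  have CM i j : Cr r U (fun x => M x i j).
    case: (split_ordP i) => i' ->; case: (split_ordP j) => j' ->.
    - apply: (@Cr_ext _ _ _ _ _ (fun x => (1%:M : 'M[R]_n) i' j' - Psi x T i' j')) => //.
        by move=> x _; rewrite block_mxEul !mxE.
      by apply: CrB => //; [exact: Cr_cst|exact: at_T (CPsi _ _)].
    - apply: (@Cr_ext _ _ _ _ _ (fun x => - Y j' i' (x, T))) => //.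
        by move=> x _; rewrite block_mxEur !mxE.
      by apply: CrN => //; exact: at_T.
    - apply: (@Cr_ext _ _ _ _ _ (z0 i' j')) => //.
      by move=> x _; rewrite block_mxEdl mxE.
    - apply: (Cr_ext oU _ (@Cr_cst R V R r U 0)) => x _.
      by rewrite block_mxEdr mxE.
  have CS i : Cr r U (fun x => S x i 0).
    apply: (@Cr_ext _ _ _ _ _ (fun x => \sum_k invmx (M x) i k *
       (col_mx (\col_(i < n) X x i T) (0 : 'cV_N)) k 0)) => //.
      by move=> x _; rewrite /S mxE.
    apply: Cr_sum => // k _; apply: CrM => //.
      by apply: Cr_invmx => // x; exact: M_unit.
    case: (split_ordP k) => k' ->.
      apply: (@Cr_ext _ _ _ _ _ (fun x => X x k' T)) => //; last exact: (at_T _ (CX k')).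
      by move=> x _; rewrite col_mxEu mxE.
    apply: (Cr_ext oU _ (@Cr_cst R V R r U 0)) => x _.
    by rewrite col_mxEd mxE.
  have Cu0 i : Cr r U (fun x => u0 x i 0).
    by apply: (Cr_ext oU _ (CS (lshift N i))) => x _; rewrite /u0 [RHS]mxE.
  have Crho l : Cr r U (rho l).
    by apply: (Cr_ext oU _ (CS (rshift n l))) => x _; rewrite /rho [RHS]mxE.
  have lift (f : V -> R) : Cr r U f -> Cr r (U `*` setT) (fun p : V * R => f p.1).
    move=> Cf; apply: (@Cr_comp R (V * R)%type V bV r _ U f fst) => //.
      by move=> [x s] [].
    exact: Cr_fst.
  split=> // i; apply: CrD => //; apply: CrD => //.
    apply: (@Cr_ext _ _ _ _ _ (fun p => \sum_j Psi p.1 p.2 i j * u0 p.1 j 0)) => //.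
      by move=> p _; rewrite mxE.
    by apply: Cr_sum => // j _; apply: CrM => //; exact: (lift _ (Cu0 j)).
  by apply: Cr_sum => // l _; apply: CrM => //; exact: (lift _ (Crho l)).
Qed.

End PeriodicSolve.

(** * The variational equation along the family of periodic orbits *)

Lemma is_derive_entry (R : realType) (V : normedModType R) m n (f : V -> 'M[R]_(m, n))
    x v d i j : is_derive x v f d -> is_derive x v (fun y => f y i j) (d i j).
Proof.
move=> [df <-]; apply: DeriveDef; first exact: ((derivable_mxP f x v).1 df).
by rewrite (derive_mx df) mxE.
Qed.

Lemma diff_entry (R : realType) (V : normedModType R) m n (f : V -> 'M[R]_(m, n)) x v i j :
  differentiable f x -> 'd f x v i j = 'D_v (fun y => f y i j) x.
Proof.
move=> df; have [_ ->] := is_derive_entry i j (derivableP (diff_derivable (v := v) df)).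
by rewrite deriveE.
Qed.

Lemma Cr_entry (R : realType) (V : normedModType R) r (A : set V) n (f : V -> 'cV[R]_n) i :
  open A -> Cr r A f -> Cr r A (fun x => f x i 0).
Proof. exact: (@Cr_coord _ _ _ (basis_cV n)). Qed.

Lemma diff_basis (R : realType) (V W : normedModType R) (b : finBasis V) (f : V -> W) x v :
  differentiable f x -> 'D_v f x = \sum_i bcoord b i v *: 'D_(bvec b i) f x.
Proof.
move=> df; rewrite deriveE // (linear_bcoord b); last by move=> a u w; rewrite linearP.
by apply: eq_bigr => i _; rewrite deriveE.
Qed.

Section PeriodicOrbits.
Context {R : realType} {k n : nat}.
Variables (F0 : 'cV[R]_n -> 'cV[R]_n) (U : set 'cV[R]_k).
Variables (gamma0 : 'cV[R]_k -> R -> 'cV[R]_n) (tau : 'cV[R]_k -> R).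
Notation om := (frequency tau).
Notation G := (phase_param gamma0 tau).
Notation X := ('cV[R]_k * R)%type.

Definition orbit_coord (i : 'I_n) (p : X) : R := G p.1 p.2 i 0.
Definition jacobian_coord (i j : 'I_n) (z : 'cV[R]_n) : R :=
  'D_(bvec (basis_cV n) j) (fun z => F0 z i 0) z.
(** The factor is the inverse frequency because the phase, not the time, is the independent
    variable; all orbits then share the period 2 pi. *)
Definition orbit_jacobian (i j : 'I_n) (p : X) : R :=
  (om p.1)^-1 * jacobian_coord i j (G p.1 p.2).

Notation G0 := orbit_coord.
Notation Am := jacobian_coord.
Notation B := orbit_jacobian.

Hypothesis oU : open U.
Hypothesis gamma0_ode : forall x t, U x -> is_derive t (1 : R) (gamma0 x) (F0 (gamma0 x t)).
Hypothesis tau_gt0 : forall x, U x -> 0 < tau x.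
Hypothesis Ctau : Cr 2 U tau.
Hypothesis CF0 : Cr 2 setT F0.
Hypothesis G_per : forall x phi, U x -> G x (phi + 2 * pi) = G x phi.
Hypothesis CG : Cr 2 (U `*` setT) (fun p : X => G p.1 p.2).

Let oUT : open (U `*` [set: R]) := open_slab oU.

Lemma frequency_gt0 x : U x -> 0 < om x.
Proof. by move=> Ux; rewrite divr_gt0 ?tau_gt0 // mulr_gt0 // pi_gt0. Qed.

Lemma Cr_inv_frequency r : Cr r U tau -> Cr r U (fun x => (om x)^-1).
Proof.
move=> C; apply: (Cr_ext oU _ (CrM oU (@Cr_cst R _ R r U (2 * pi)^-1) C)) => x Ux.
by rewrite [RHS]invfM invrK.
Qed.

Lemma Cr_frequency r : Cr r U tau -> Cr r U om.
Proof.
move=> C; apply: CrM => //; first exact: Cr_cst.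
by apply: CrV => // x Ux; rewrite gt_eqF // tau_gt0.
Qed.

Lemma Cr_comp_fst (V W : normedModType R) (bV : finBasis V) r (A : set V) (f : V -> R) :
  open A -> Cr r A f -> Cr r (A `*` [set: W]) (fun p : V * W => f p.1).
Proof.
move=> oA Cf; have oAW : open (A `*` [set: W]).
  rewrite openE => -[x t] [/= Ax _]; exists (A, setT) => //=.
  by split; [apply: open_nbhs_nbhs|exact: filterT].
apply: (@Cr_comp R (V * W)%type V bV r _ A f fst) => //; last exact: Cr_fst.
by move=> [x s] [].
Qed.

Lemma Cr_orbit_coord r i : Cr r (U `*` setT) (fun p : X => G p.1 p.2) ->
  Cr r (U `*` setT) (G0 i).
Proof. by move=> C; apply: (Cr_entry i oUT C). Qed.

Lemma Cr_jacobian r i j : Cr r.+1 setT F0 -> Cr r setT (Am i j).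
Proof. by move=> C; apply: (Cr_entry i (@openT _) C).2. Qed.

Lemma Cr_orbit_jacobian r i j : Cr r U tau -> Cr r.+1 setT F0 ->
  Cr r (U `*` setT) (fun p : X => G p.1 p.2) -> Cr r (U `*` setT) (B i j).
Proof.
move=> C1 C2 C3; apply: CrM => //.
  by apply: (@Cr_comp_fst _ R (basis_cV k) _ U (fun x => (om x)^-1) oU); apply: Cr_inv_frequency.
by apply: (Cr_comp (basis_cV n) oUT _ (Cr_jacobian i j C2) C3).
Qed.

Lemma orbit_coord_phase i x phi : U x ->
  is_derive phi (1 : R) (fun s => G0 i (x, s)) ((om x)^-1 * F0 (G x phi) i 0).
Proof.
move=> Ux; rewrite /orbit_coord /phase_param /=.
have := is_derive_dilate (gamma0_ode ((om x)^-1 * phi) Ux).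
rewrite (_ : (fun r => _) = (fun r => gamma0 x (r / om x))); last first.
  by apply/funext => r; rewrite mulrC.
by move/(is_derive_entry i 0); rewrite mxE [(om x)^-1 * phi]mulrC.
Qed.

Lemma D_phase i x phi : U x ->
  'D_((0, 1) : X) (G0 i) (x, phi) = (om x)^-1 * F0 (G x phi) i 0.
Proof. by move=> Ux; have [_ ->] := (is_derive_slice _ _ _ _).1 (orbit_coord_phase i phi Ux). Qed.

Lemma diff_G0 i x phi : U x -> differentiable (G0 i) (x, phi).
Proof. by move=> Ux; apply: (Cr_orbit_coord i CG).1; split. Qed.

Lemma diff_G x phi : U x -> differentiable (fun p : X => G p.1 p.2) (x, phi).
Proof. by move=> Ux; apply: CG.1; split. Qed.

Lemma derive_split (f : X -> R) p (v : X) : differentiable f p -> 'D_v f p =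
  'D_((v.1, 0) : X) f p + v.2 * 'D_((0, 1) : X) f p.
Proof.
move=> d; rewrite !deriveE // addrC.
have -> : v = v.2 *: ((0, 1) : X) + (v.1, 0).
  by case: v => a b; congr (_, _) => /=; [rewrite scaler0 add0r|rewrite addr0 [_ *: _]mulr1].
by rewrite linearP /= !scaler0 !add0r addr0 [_ *: 1]mulr1.
Qed.

Lemma D_F0_orbit i x phi (v : X) : U x ->
  'D_v (fun p : X => F0 (G p.1 p.2) i 0) (x, phi) =
  \sum_j Am i j (G x phi) * 'D_v (G0 j) (x, phi).
Proof.
move=> Ux; rewrite (derive_comp_basis (basis_cV n) (f := fun z => F0 z i 0)
  (g := fun p : X => G p.1 p.2)).
- by apply: eq_bigr => j _; rewrite mulrC.
- exact: diff_G.
- by apply: (Cr_entry i (@openT _) CF0).1.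
Qed.

(* [v.1] moves the orbit, and the frequency with it: hence the resonant term. *)
Lemma tangent_variation (v : X) : par_ode U B
  (fun i p => - ('D_v.1 om p.1 / om p.1 * 'D_((0, 1) : X) (G0 i) p))
  (fun i => 'D_v (G0 i)).
Proof.
move=> x Ux s i.
have om0 : om x != 0 by rewrite gt_eqF // frequency_gt0.
have swap u := derive_swap (f := G0 i) u oU (Cr_orbit_coord i CG) s Ux.
have Dphi (u : X) : 'D_u ('D_((0, 1) : X) (G0 i)) (x, s) =
    \sum_j B i j (x, s) * 'D_u (G0 j) (x, s)
    - 'D_u.1 om x / om x * 'D_((0, 1) : X) (G0 i) (x, s).
  (* The phase equation is differentiated along [u]: the factor [F0] yields the Jacobian term, the
     inverse frequency the resonant one. *)
  rewrite (near_eq_derive (g := fun p : X => (om p.1)^-1 * F0 (G p.1 p.2) i 0)); last first.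
    apply: (@open_near _ _ (U `*` setT)) => //.
    by move=> [y r] [/= Uy _]; rewrite D_phase.
  have C1 : Cr 1 (U `*` setT) (fun p : X => (om p.1)^-1).
    by apply: (@Cr_comp_fst _ R (basis_cV k) _ U (fun x => (om x)^-1) oU); apply: CrS; exact: Cr_inv_frequency.
  have C2 : Cr 1 (U `*` setT) (fun p : X => F0 (G p.1 p.2) i 0).
    apply: (Cr_comp (f := fun z => F0 z i 0) (B := setT) (basis_cV n) oUT) => //.
      exact/CrS/(Cr_entry i (@openT _) CF0).
    exact: CrS.
  have d1 := C1.1 (x, s) (conj Ux I); have d2 := C2.1 (x, s) (conj Ux I).
  rewrite (@deriveM _ _ (fun p : X => (om p.1)^-1) (fun p : X => F0 (G p.1 p.2) i 0));
    [|exact: diff_derivable..].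
  rewrite /= D_F0_orbit // D_phase // [_ *: _]mulr_sumr; congr (_ + _).
    by apply: eq_bigr => j _; rewrite mulrA.
  have dom : differentiable om x by apply: (Cr_frequency Ctau).1.
  have -> : 'D_u (fun p : X => (om p.1)^-1) (x, s) = - (om x) ^- 2 * 'D_u.1 om x.
    have df : differentiable (fun y => (om y)^-1) x by apply: differentiableV.
    have [dfst Efst] : is_diff (x, s) (fst : X -> 'cV[R]_k) fst.
      by apply: linear_is_diff => // p; exact: cvg_fst.
    rewrite deriveE; last exact: (differentiable_comp dfst df).
    rewrite (diff_comp dfst df) /= Efst -deriveE // deriveV //.
    exact: diff_derivable.
  have aux (a b c : R) : a * (- c ^- 2 * b) = - (b / c * (c^-1 * a)).
    by rewrite expr2 invfM; ring.
  exact: aux.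
rewrite -Dphi.
have D2 : is_derive s (1 : R) (fun s => 'D_((0, 1) : X) (G0 i) (x, s))
    ('D_((0, 1) : X) ('D_((0, 1) : X) (G0 i)) (x, s)).
  apply: (is_derive_slice ('D_((0, 1) : X) (G0 i)) _ _ _).2; apply/derivableP/diff_derivable.
  by apply: ((Cr_orbit_coord i CG).2 _).1; split.
have := is_derive_addf (swap v.1) (is_derive_mulf (is_derive_cst v.2 s 1) D2).
rewrite (_ : (fun y => _) = (fun s => 'D_v (G0 i) (x, s))); last first.
  by apply/funext => r; rewrite (derive_split v (diff_G0 i r Ux)).
move=> H; apply: (is_derive_conv H); rewrite mul0r add0r (derive_split v) //.
by apply: ((Cr_orbit_coord i CG).2 _).1; split.
Qed.

End PeriodicOrbits.

(** For nonzero [v] one gets 1 + c j <= exp(c j) <= K for every j, against the Archimedean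
    property. *)
Lemma decay_zero (R : realType) (V : normedModType R) (v : V) (K c : R) : 0 < c ->
  (forall j : nat, `|v| <= K * expR (- (c * j%:R)) * `|v|) -> v = 0.
Proof.
move=> c0 H; apply/eqP; rewrite -normr_eq0; apply/negPn/negP => v0.
have vp : 0 < `|v| by rewrite lt_def v0 normr_ge0.
have H1 (j : nat) : 1 + c * j%:R <= K.
  have := H j; rewrite -[leLHS]mul1r ler_pM2r // expRN.
  rewrite ler_pdivlMr ?expR_gt0 // mul1r; apply: le_trans.
  exact: expR_ge1Dx.
have K0 : 0 <= K by have := H1 0%N; rewrite mulr0 addr0; apply: le_trans.
have := H1 (Num.bound (K / c)); have := archi_boundP (divr_ge0 K0 (ltW c0)).
rewrite ltr_pdivrMr // mulrC => h h'.
by have := lt_le_trans h (le_trans (ltW (ltr_pwDl ltr01 (lexx _))) h'); rewrite ltxx.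
Qed.

Lemma derive_shift_arg (R : realType) (V W : normedModType R) (f : V -> W) (c p v : V) :
  'D_v (fun q => f (q + c)) p = 'D_v f (p + c).
Proof.
have E : (fun h : R => h^-1 *: (((fun q => f (q + c)) \o shift p) (h *: v) - f (p + c))) =
    (fun h => h^-1 *: ((f \o shift (p + c)) (h *: v) - f (p + c))).
  by apply/funext => h /=; rewrite addrA.
by rewrite /derive E.
Qed.

(** Differentiating [s / o] produces the wanted forcing. The resonant forcing of [y], multiplied by
    [s / o], is cancelled by the derivative of the quadratic coefficient. *)
Lemma response_ode (R : realType) n (B : 'I_n -> 'I_n -> R -> R) (y z : 'I_n -> R -> R)
    (o d : R) : o != 0 ->
  lin_ode B (fun i s => - (d / o * z i s)) y -> lin_ode B (fun _ _ => 0) z ->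
  lin_ode B (fun i s => - (o^-1 * y i s))
    (fun i s => - (s / o * y i s + s ^+ 2 * (d / (2 * o ^+ 2)) * z i s)).
Proof.
move=> o0 oy oz s i.
have d1 := is_derive_mulf (is_derive_mulf (is_derive_id s 1) (is_derive_cst o^-1 s 1)) (oy s i).
have d2 := is_derive_mulf (is_derive_mulf
  (is_derive_mulf (is_derive_id s 1) (is_derive_id s 1))
  (is_derive_cst (d / (2 * o ^+ 2)) s 1)) (oz s i).
have := is_deriveN (is_derive_addf d1 d2).
rewrite (_ : - _ = (fun s => - (s / o * y i s + s ^+ 2 * (d / (2 * o ^+ 2)) * z i s))); last first.
  by apply/funext => r; rewrite /= expr2.
move=> H; apply: (is_derive_conv H); rewrite /cst.
rewrite [in RHS](eq_bigr (fun j => - (s / o) * (B i j s * y j s)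
  - s ^+ 2 * (d / (2 * o ^+ 2)) * (B i j s * z j s))); last first.
  by move=> j _; ring.
rewrite sumrB -!mulr_sumr.
set S1 := \sum_j _; set S2 := \sum_j _.
by field.
Qed.

Lemma derive_add_phase (R : realType) k (f : 'cV[R]_k * R -> R) p (v : 'cV[R]_k * R) (c : R) :
  differentiable f p ->
  'D_(v + (0, c)) f p = 'D_v f p + c * 'D_((0, 1) : 'cV[R]_k * R) f p.
Proof.
move=> df; rewrite [LHS]derive_split // [X in _ = X + _]derive_split //=.
by rewrite addr0 mulrDl addrA.
Qed.

Section TangentResponse.
Context {R : realType} {k n : nat}.
Variables (F0 : 'cV[R]_n -> 'cV[R]_n) (U : set 'cV[R]_k).
Variables (gamma0 : 'cV[R]_k -> R -> 'cV[R]_n) (tau : 'cV[R]_k -> R).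
Notation om := (frequency tau).
Notation G := (phase_param gamma0 tau).
Notation X := ('cV[R]_k * R)%type.
Notation G0 := (orbit_coord gamma0 tau).
Notation B := (orbit_jacobian F0 gamma0 tau).
Notation T := (2 * pi).

Hypothesis oU : open U.
Hypothesis gamma0_ode : forall x t, U x -> is_derive t (1 : R) (gamma0 x) (F0 (gamma0 x t)).
Hypothesis tau_gt0 : forall x, U x -> 0 < tau x.
Hypothesis Ctau : Cr 2 U tau.
Hypothesis CF0 : Cr 2 setT F0.
Hypothesis G_per : forall x phi, U x -> G x (phi + T) = G x phi.
Hypothesis CG : Cr 2 (U `*` setT) (fun p : X => G p.1 p.2).

Let oUT : open (U `*` [set: R]) := open_slab oU.

Lemma orbit_coord_periodic i : time_periodic U T (G0 i).
Proof. by move=> x s Ux; rewrite /orbit_coord /= G_per. Qed.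

Lemma derive_periodic (f : X -> R) (v : X) : time_periodic U T f -> time_periodic U T ('D_v f).
Proof.
move=> pf x s Ux.
have -> : (x, s + T) = (x, s) + (0, T) :> X by congr (_, _); rewrite /= addr0.
rewrite -derive_shift_arg; apply: near_eq_derive.
apply: (@open_near _ _ (U `*` setT)) => // -[y r] [/= Uy _].
by rewrite -(pf y r Uy); congr f; congr (_, _); rewrite /= addr0.
Qed.

Lemma orbit_jacobian_periodic i j : time_periodic U T (B i j).
Proof. by move=> x s Ux; rewrite /orbit_jacobian /= G_per. Qed.

Definition scaled_tangent (v : X) (i : 'I_n) (p : X) : R := (om p.1)^-1 * 'D_v (G0 i) p.

Lemma scaled_tangent_periodic v i : time_periodic U T (scaled_tangent v i).
Proof.
move=> x s Ux; rewrite /scaled_tangent /=; congr (_ * _).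
by apply: derive_periodic => //; exact: orbit_coord_periodic.
Qed.

(* Forcing the variational equation by the tangent vector [v] gives a response
   that grows linearly in time, and quadratically when [v] changes the frequency. *)
Definition tangent_response (v : X) (i : 'I_n) (p : X) : R :=
  - (p.2 / om p.1 * 'D_v (G0 i) p
     + p.2 ^+ 2 * ('D_v.1 om p.1 / (2 * om p.1 ^+ 2)) * 'D_((0, 1) : X) (G0 i) p).

Lemma tangent_response0 v i x : tangent_response v i (x, 0) = 0.
Proof. by rewrite /tangent_response /= expr0n /= !mul0r addr0 oppr0. Qed.

Lemma tangent_response_ode v :
  par_ode U B (fun i p => - scaled_tangent v i p) (tangent_response v).
Proof.
move=> x Ux.
have om0 : om x != 0 by rewrite gt_eqF // (frequency_gt0 tau_gt0).
have V1 := tangent_variation oU gamma0_ode tau_gt0 Ctau CF0 CG v Ux.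
have V2 := tangent_variation oU gamma0_ode tau_gt0 Ctau CF0 CG ((0, 1) : X) Ux.
have {}V1 : lin_ode (fun i j s => B i j (x, s))
    (fun i s => - ('D_v.1 om x / om x * 'D_((0, 1) : X) (G0 i) (x, s)))
    (fun i s => 'D_v (G0 i) (x, s)) by exact: V1.
have {}V2 : lin_ode (fun i j s => B i j (x, s)) (fun _ _ => 0)
    (fun i s => 'D_((0, 1) : X) (G0 i) (x, s)).
  by apply: (lin_ode_eq V2) => // i s /=; rewrite derive0 !mul0r oppr0.
exact: (response_ode om0 V1 V2).
Qed.

(** At s = 2 pi the linear coefficient is tau and the quadratic one is tau pi D_v omega / omega. The
    response over one period is thus -tau times the tangent vector obtained by shearing [v] in the
    phase direction. *)
Lemma tangent_response_T v i x : U x -> tangent_response v i (x, T) =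
  - tau x * 'D_(v + (0, pi * ('D_v.1 om x / om x))) (G0 i) (x, 0).
Proof.
move=> Ux; have om0 : om x != 0 by rewrite gt_eqF // (frequency_gt0 tau_gt0).
have tau0 : tau x != 0 by rewrite gt_eqF // tau_gt0.
have pi0 : pi != 0 :> R by rewrite gt_eqF // pi_gt0.
have per u : 'D_u (G0 i) (x, T) = 'D_u (G0 i) (x, 0).
  rewrite -[T in LHS]add0r.
  by apply: derive_periodic => //; exact: orbit_coord_periodic.
have dG : differentiable (G0 i) (x, 0) by exact: (diff_G0 oU CG).
rewrite /tangent_response /= !per.
rewrite derive_add_phase //.
set z1 := 'D_v (G0 i) _; set z2 := 'D_((0, 1) : X) (G0 i) _; set z3 := 'D_v.1 om x.
rewrite (_ : tau x = T / om x); last by rewrite /frequency invfM invrK mulrA mulfV ?mul1r // mulf_neq0.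
by field.
Qed.

End TangentResponse.

(** * Monodromy and normal hyperbolicity *)

Section Monodromy.
Context {R : realType} {k n : nat}.
Variables (F0 : 'cV[R]_n -> 'cV[R]_n) (U : set 'cV[R]_k).
Variables (gamma0 : 'cV[R]_k -> R -> 'cV[R]_n) (tau : 'cV[R]_k -> R).
Notation om := (frequency tau).
Notation G := (phase_param gamma0 tau).
Notation X := ('cV[R]_k * R)%type.
Notation G0 := (orbit_coord gamma0 tau).
Notation B := (orbit_jacobian F0 gamma0 tau).
Notation T := (2 * pi).

Hypothesis oU : open U.
Hypothesis tau_gt0 : forall x, U x -> 0 < tau x.
Hypothesis Ctau : Cr 2 U tau.
Hypothesis CF0 : Cr 2 setT F0.
Hypothesis G_per : forall x phi, U x -> G x (phi + T) = G x phi.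
Hypothesis CG : Cr 2 (U `*` setT) (fun p : X => G p.1 p.2).

Notation dG x phi := ('d (fun p : X => G p.1 p.2) (x, phi)).

Lemma dG_entry x phi (v : X) i : U x -> dG x phi v i 0 = 'D_v (G0 i) (x, phi).
Proof. by move=> Ux; rewrite diff_entry //; exact: (diff_G CG). Qed.

Lemma tangentP x phi (w : 'cV[R]_n) :
  w \in tangent G x phi <-> exists v : X, w = dG x phi v.
Proof.
rewrite /tangent; split.
  by move=> /memv_imgP[v _ ->]; exists v; rewrite lfunE.
move=> [v ->]; apply/memv_imgP; exists v; first exact: memvf.
by rewrite lfunE.
Qed.

Lemma tangent_periodic x phi w : U x ->
  w \in tangent G x (phi + T) -> w \in tangent G x phi.
Proof.
move=> Ux /tangentP[v ->]; apply/tangentP; exists v.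
apply/matrixP => i j; rewrite (ord1 j).
apply: etrans (dG_entry _ _ _ Ux) _; apply: etrans (esym (dG_entry _ _ _ Ux)).
exact: (derive_periodic oU v (orbit_coord_periodic G_per i)).
Qed.

Lemma transition_fundamental Phi x : transition_matrix F0 U gamma0 Phi -> U x ->
  fundamental (fun i j s => B i j (x, s)) (fun s => Phi x ((om x)^-1 * s) 0).
Proof.
move=> tr Ux; have [P0 Pt] := tr x 0 Ux; split; first by rewrite mulr0.
move=> j s i.
have := is_derive_entry i 0 (is_derive_dilate (Pt ((om x)^-1 * s) (delta_mx j 0))).
rewrite (_ : (fun y => _) = (fun s => Phi x ((om x)^-1 * s) 0 i j)); last first.
  by apply/funext => r; rewrite -colE mxE.
move=> H; apply: (is_derive_conv H).
have dF z : differentiable F0 z by apply: CF0.1.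
rewrite mxE diff_entry // (diff_basis (basis_cV n)); last first.
  by apply: (Cr_entry i (@openT _) CF0).1.
rewrite addr0 mulr_sumr; apply: eq_bigr => l _.
rewrite [(om x)^-1 * s]mulrC -colE /= mxE.
have aux (a p d : R) : a * (p * d) = a * d * p by ring.
exact: aux.
Qed.

Hypothesis dG_inj : forall x phi, U x -> injective (dG x phi).

(** By uniqueness a fixed vector of the monodromy generates a periodic solution, which returns after
    any number of periods. Backward times serve the unstable space. *)
Lemma fundamental_iter (Bx : 'I_n -> 'I_n -> R -> R) (Psi : R -> 'M[R]_n) (v : 'cV[R]_n) :
  (forall i j, continuous (Bx i j)) -> (forall i j s, Bx i j (s + T) = Bx i j s) ->
  fundamental Bx Psi -> Psi T *m v = v ->
  forall j : nat, Psi (T * j%:R) *m v = v /\ Psi (- (T * j%:R)) *m v = v.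
Proof.
move=> cB pB F fixv.
have per s : Psi (s + T) *m v = Psi s *m v.
  have H1 := fundamental_mul v F.
  have H2 : lin_ode Bx (fun _ _ => 0) (fun i s => (Psi (s + T) *m v) i 0).
    move=> r i; have := lin_ode_shift T H1 r i.
    by under eq_bigr do rewrite pB.
  apply/matrixP => i j; rewrite (ord1 j).
  apply: (lin_ode_uniq (y := fun i s => (Psi (s + T) *m v) i 0)
    (y' := fun i s => (Psi s *m v) i 0) (t0 := 0) cB H2 H1) => l.
  by rewrite add0r fixv F.1 mul1mx.
elim=> [|j [IH1 IH2]]; first by rewrite mulr0 oppr0 F.1 mul1mx.
have E : T * j.+1%:R = T * j%:R + T :> R by rewrite -[j.+1%:R]natr1 mulrDr mulr1.
split; first by rewrite E per.
by rewrite -per E opprD subrK.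
Qed.

Lemma frequency_period x : (om x)^-1 * T = tau x.
Proof.
rewrite /frequency invfM invrK mulrAC mulVf ?mul1r // mulf_neq0 //.
by rewrite gt_eqF // pi_gt0.
Qed.

Lemma orbit_jacobian_continuous x i j : U x -> continuous (fun s => B i j (x, s)).
Proof.
move=> Ux; apply: slice_continuous => s.
apply: (Cr_continuous (r := 0) (A := U `*` setT)); last by split.
by apply: (Cr_orbit_jacobian oU); apply: CrW (_ : 0 <= 2)%N _ || apply: CrW (_ : 1 <= 2)%N _.
Qed.

(** A vector fixed by the monodromy has the same image after any number of periods, while the
    estimates force decay, forward on the stable and backward on the unstable space. *)
Lemma hyperbolic_kernel Phi (Ns Nu : {vspace 'cV[R]_n}) (K ls lu : R) x v :
  U x -> transition_matrix F0 U gamma0 Phi -> 0 < ls -> 0 < lu ->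
  (forall v, v \in Ns -> forall t, 0 <= t ->
     `|Phi x t 0 *m v| <= K * expR (- ls * (t - 0)) * `|v|) ->
  (forall v, v \in Nu -> forall t, t <= 0 ->
     `|Phi x t 0 *m v| <= K * expR (lu * (t - 0)) * `|v|) ->
  Phi x (tau x) 0 *m v = v ->
  (v \in Ns -> v = 0) /\ (v \in Nu -> v = 0).
Proof.
move=> Ux tr ls0 lu0 Hs Hu fixv.
have F := transition_fundamental tr Ux.
have cB i j : continuous (fun s => B i j (x, s)) by exact: orbit_jacobian_continuous.
have pB i j s : B i j (x, s + T) = B i j (x, s).
  by apply: (orbit_jacobian_periodic F0 G_per).
have it := fundamental_iter cB pB F.
rewrite frequency_period // in it; have {}it := it _ fixv.
have E (j : nat) : (om x)^-1 * (T * j%:R) = tau x * j%:R.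
  by rewrite mulrA frequency_period.
have tau0 := tau_gt0 Ux.
split=> [/Hs|/Hu] {Hs Hu} H.
  apply: (@decay_zero _ _ v K (ls * tau x)) => [|j]; first by rewrite mulr_gt0.
  have := H (tau x * j%:R); rewrite -E (it j).1 E subr0 mulNr mulrA; apply.
  by rewrite mulr_ge0 // ltW.
apply: (@decay_zero _ _ v K (lu * tau x)) => [|j]; first by rewrite mulr_gt0.
have := H (- (tau x * j%:R)); rewrite -E -mulrN (it j).2 mulrN E subr0 mulrN mulrA; apply.
by rewrite oppr_le0 mulr_ge0 // ltW.
Qed.

End Monodromy.

Lemma directv3_eq0 (K : fieldType) (E : vectType K) (A B C : {vspace E}) a b c :
  directv (A + B + C) -> a \in A -> b \in B -> c \in C -> a + b + c = 0 ->
  [/\ a = 0, b = 0 & c = 0].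
Proof.
rewrite directv_addE /= => /and3P[/directv_addP AB _ /eqP ABC] aA bB cC E0.
have c0 : c = 0.
  apply/eqP; rewrite -memv0 -ABC memv_cap cC andbT.
  by rewrite -[c]opprK memvN -(addr0_eq E0) opprK memv_add.
move: E0; rewrite c0 addr0 => E0.
have b0 : b = 0.
  apply/eqP; rewrite -memv0 -AB memv_cap bB andbT.
  by rewrite -(addr0_eq E0) memvN.
by move: E0; rewrite b0 addr0.
Qed.

Section HyperbolicInjective.
Context {R : realType} {k n : nat}.
Variables (F0 : 'cV[R]_n -> 'cV[R]_n) (U : set 'cV[R]_k).
Variables (gamma0 : 'cV[R]_k -> R -> 'cV[R]_n) (tau : 'cV[R]_k -> R).
Notation om := (frequency tau).
Notation G := (phase_param gamma0 tau).
Notation X := ('cV[R]_k * R)%type.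
Notation bX := (basisX (basis_cV k) basisR).
Notation G0 := (orbit_coord gamma0 tau).
Notation B := (orbit_jacobian F0 gamma0 tau).
Notation T := (2 * pi).
Notation dG x phi := ('d (fun p : X => G p.1 p.2) (x, phi)).

Hypothesis oU : open U.
Hypothesis tau_gt0 : forall x, U x -> 0 < tau x.
Hypothesis Ctau : Cr 2 U tau.
Hypothesis CF0 : Cr 2 setT F0.
Hypothesis G_per : forall x phi, U x -> G x (phi + T) = G x phi.
Hypothesis CG : Cr 2 (U `*` setT) (fun p : X => G p.1 p.2).
Hypothesis dG_inj : forall x phi, U x -> injective (dG x phi).

Lemma response_sum x (rho : 'I_(fdim bX) -> R) i : U x ->
  \sum_l rho l * tangent_response gamma0 tau (bvec bX l) i (x, T) =
  - tau x * dG x 0 (\sum_l rho l *: (bvec bX l +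
      ((0, pi * ('D_(bvec bX l).1 om x / om x)) : X))) i 0.
Proof.
move=> Ux; rewrite (dG_entry CG) // deriveE; last exact: (diff_G0 oU CG).
rewrite linear_sum mulr_sumr; apply: eq_bigr => l _.
rewrite (tangent_response_T oU) // linearZ -deriveE; last exact: (diff_G0 oU CG).
exact: mulrCA.
Qed.

(** The shear keeps the component in ['cV_k], and the phase it adds depends linearly on that
    component only. If the image is 0, that component vanishes, then the added phase, then the phase
    itself. *)
Lemma resonance_inj x (rho : 'I_(fdim bX) -> R) : U x ->
  \sum_l rho l *: (bvec bX l + ((0, pi * ('D_(bvec bX l).1 om x / om x)) : X)) = 0 ->
  forall l, rho l = 0.
Proof.
move=> Ux E.
have dom : differentiable om x by apply: (Cr_frequency oU tau_gt0 Ctau).1.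
pose v : X := \sum_l rho l *: bvec bX l.
have fstS (f : 'I_(fdim bX) -> X) : (\sum_l f l).1 = \sum_l (f l).1.
  by apply: (big_morph (fun p : X => p.1)).
have sndS (f : 'I_(fdim bX) -> X) : (\sum_l f l).2 = \sum_l (f l).2.
  by apply: (big_morph (fun p : X => p.2)).
have v1 : v.1 = 0.
  have := congr1 (fun p : X => p.1) E; rewrite /= fstS => <-.
  by rewrite /v fstS; apply: eq_bigr => l _; rewrite /= addr0.
have res : \sum_l rho l * (pi * ('D_(bvec bX l).1 om x / om x)) = 0.
  have -> : \sum_l rho l * (pi * ('D_(bvec bX l).1 om x / om x)) =
      pi / om x * 'd om x v.1.
    rewrite /v fstS linear_sum mulr_sumr; apply: eq_bigr => l _.
    rewrite -[(_ *: bvec bX l).1]/(rho l *: (bvec bX l).1) linearZ -deriveE //.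
    have aux (r p d o : R) : r * (p * (d / o)) = p / o * (r * d) by ring.
    exact: aux.
  by rewrite v1 linear0 mulr0.
have v2 : v.2 = 0.
  have E2 : \sum_l (rho l *: (bvec bX l +
    ((0, pi * ('D_(bvec bX l).1 om x / om x)) : X))).2 = 0 by rewrite -sndS E.
  rewrite /v sndS; apply: (etrans _ E2).
  rewrite [RHS](eq_bigr (fun l => (rho l *: bvec bX l).2 +
    rho l * (pi * ('D_(bvec bX l).1 om x / om x)))); last first.
    by move=> l _; exact: mulrDr.
  by rewrite big_split res; exact: (esym (addr0 _)).
have v0 : v = 0 by rewrite [v]surjective_pairing v1 v2.
by move=> l; have := congr1 (bcoord bX l) v0; rewrite bcoord0 /v bcoord_comb.
Qed.

(** The bordered system is split along the invariant sum. The stable and unstable parts of [u] are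
    fixed by the monodromy, hence 0; so [u] is tangent, and the phase condition makes it orthogonal
    to the tangent space. What remains says that the response to [rho] vanishes. *)
Lemma hyperbolic_injective : normally_hyperbolic F0 U gamma0 tau ->
  exists Psi : 'cV[R]_k -> R -> 'M[R]_n,
  (forall x, U x -> fundamental (fun i j s => B i j (x, s)) (Psi x)) /\
  forall x (u : 'I_n -> R) (rho : 'I_(fdim bX) -> R), U x ->
  (forall i, u i = \sum_j Psi x T i j * u j +
     \sum_l rho l * tangent_response gamma0 tau (bvec bX l) i (x, T)) ->
  (forall l, \sum_i 'D_(bvec bX l) (G0 i) (x, 0) * u i = 0) ->
  (forall i, u i = 0) /\ (forall l, rho l = 0).
Proof.
move=> [Phi [Ns [Nu [K [ls [lu [l0 [tr [l00 Kl] split_ inv_ est]]]]]]]].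
exists (fun x s => Phi x ((om x)^-1 * s) 0); split.
  by move=> x Ux; exact: (transition_fundamental tau CF0 tr Ux).
move=> x u rho Ux E orth.
have [K1 ls0 lu0] := Kl x Ux.
pose P := Phi x (tau x) 0.
pose uv : 'cV[R]_n := \col_i u i.
pose v' := \sum_l rho l *: (bvec bX l + ((0, pi * ('D_(bvec bX l).1 om x / om x)) : X)).
have Eu : uv = P *m uv - tau x *: dG x 0 v'.
  apply/matrixP => i j; rewrite (ord1 j) mxE E response_sum //.
  rewrite [RHS]mxE; congr (_ + _).
    rewrite [RHS]mxE; apply: eq_bigr => l _.
    by rewrite mxE /P -(frequency_period tau).
  by rewrite [RHS]mxE [X in _ = - X]mxE mulNr.
have [full dir] := split_ x 0 Ux; rewrite mulr0 in full dir.
have [[Hs Hu _]] := (est x Ux, tt).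
set T0 := tangent G x 0 in full dir.
have per w t0 : w \in tangent G x 0 -> Phi x t0 0 *m w \in tangent G x (om x * t0).
  by have [+ _ _] := inv_ x t0 0 w Ux; rewrite mulr0; apply.
have omtau : om x * tau x = 0 + T.
  by rewrite add0r /frequency divfK // gt_eqF // tau_gt0.
have PT w : w \in T0 -> P *m w \in T0.
  move=> /per - /(_ (tau x)); rewrite omtau.
  by move=> H; apply: (tangent_periodic oU G_per CG Ux H).
have gper : gamma0 x (tau x) = gamma0 x 0.
  have := G_per 0 Ux; rewrite /phase_param mul0r add0r.
  by rewrite mulrC frequency_period.
have PNs w : w \in Ns (gamma0 x 0) -> P *m w \in Ns (gamma0 x 0).
  by have [_ + _] := inv_ x (tau x) 0 w Ux; rewrite gper; apply.
have PNu w : w \in Nu (gamma0 x 0) -> P *m w \in Nu (gamma0 x 0).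
  by have [_ _] := inv_ x (tau x) 0 w Ux; rewrite gper; apply.
have : uv \in (T0 + Ns (gamma0 x 0) + Nu (gamma0 x 0))%VS by rewrite full memvf.
move=> /memv_addP[as_ /memv_addP[a aT [s sNs Eas]] [w wNu Euv]].
have dGT : dG x 0 v' \in T0 by apply/tangentP; exists v'.
(* The monodromy preserves the three spaces and the response is tangent, so the equation
   decouples. *)
have [a0 s0 w0] : [/\ a - P *m a + tau x *: dG x 0 v' = 0, s - P *m s = 0 & w - P *m w = 0].
  apply: (directv3_eq0 dir).
  - by rewrite memvD ?memvB ?memvZ ?PT.
  - by rewrite memvB ?PNs.
  - by rewrite memvB ?PNu.
  have : uv - P *m uv + tau x *: dG x 0 v' = 0.
    by rewrite {1}Eu addrAC subrK subrr.
  rewrite Euv Eas !mulmxDr => <-.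
  by rewrite !opprD [LHS](AC (3*2*2) ((1*4*6)*(2*5*7)*3)).
have kers : s = 0.
  have [H _] := hyperbolic_kernel oU tau_gt0 Ctau CF0 G_per CG Ux tr
    (lt_le_trans l00 ls0) (lt_le_trans l00 lu0) (Hs 0) (Hu 0) (esym (subr0_eq s0)).
  exact: H.
have kerw : w = 0.
  have [_ H] := hyperbolic_kernel oU tau_gt0 Ctau CF0 G_per CG Ux tr
    (lt_le_trans l00 ls0) (lt_le_trans l00 lu0) (Hs 0) (Hu 0) (esym (subr0_eq w0)).
  exact: H.
have Ea : uv = a by rewrite Euv Eas kers kerw !addr0.
have uv0 : forall i, u i = 0.
  move: aT; rewrite -Ea => /tangentP[c Ec].
  have Ei i : u i = \sum_l bcoord bX l c * 'D_(bvec bX l) (G0 i) (x, 0).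
    have := congr1 (fun M : 'cV[R]_n => M i 0) Ec; rewrite mxE => ->.
    rewrite (dG_entry CG) // (diff_basis bX) //; exact: (diff_G0 oU CG).
  (* Writing one factor of each square as a combination of tangent vectors turns the sum into a
     combination of the phase conditions. *)
  have S0 : \sum_i u i ^+ 2 = 0.
    rewrite (eq_bigr (fun i => \sum_l bcoord bX l c * ('D_(bvec bX l) (G0 i) (x, 0) * u i))).
      rewrite exchange_big big1 //= => l _; by rewrite -mulr_sumr orth mulr0.
    move=> i _; rewrite expr2 {1}Ei mulr_suml; by apply: eq_bigr => l _; rewrite mulrA.
  move=> i; have /psumr_eq0P := S0 => /(_ _ i isT) H.
  by apply/eqP; rewrite -sqrf_eq0 H // => j _; rewrite sqr_ge0.
split=> //.
apply: (resonance_inj Ux); apply: (dG_inj (phi := 0) Ux); rewrite linear0 -/v'.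
have uvz : uv = 0 by apply/matrixP => i j; rewrite !mxE uv0.
move: a0; rewrite -Ea uvz mulmx0 subrr add0r => /eqP.
by rewrite scaler_eq0 gt_eqF ?tau_gt0 //= => /eqP.
Qed.

End HyperbolicInjective.

(** * The homological equation *)

Section Homological.
Context {R : realType} {k n : nat}.
Variables (F0 : 'cV[R]_n -> 'cV[R]_n) (U : set 'cV[R]_k).
Variables (gamma0 : 'cV[R]_k -> R -> 'cV[R]_n) (tau : 'cV[R]_k -> R).
Notation om := (frequency tau).
Notation G := (phase_param gamma0 tau).
Notation X := ('cV[R]_k * R)%type.
Notation bX := (basisX (basis_cV k) basisR).
Notation G0 := (orbit_coord gamma0 tau).
Notation B := (orbit_jacobian F0 gamma0 tau).
Notation T := (2 * pi).

Hypothesis oU : open U.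
Hypothesis gamma0_ode : forall x t, U x -> is_derive t (1 : R) (gamma0 x) (F0 (gamma0 x t)).
Hypothesis tau_gt0 : forall x, U x -> 0 < tau x.
Hypothesis Ctau : Cr 2 U tau.
Hypothesis CF0 : Cr 2 setT F0.
Hypothesis G_per : forall x phi, U x -> G x (phi + T) = G x phi.
Hypothesis CG : Cr 2 (U `*` setT) (fun p : X => G p.1 p.2).
Hypothesis dG_inj : forall x phi, U x ->
  injective ('d (fun p : X => G p.1 p.2) (x, phi)).
Hypothesis hyp : normally_hyperbolic F0 U gamma0 tau.

(** Division by the frequency puts the equation in the form of [periodic_solve]. The coefficients
    contain first derivatives of [F0] and of the orbit map, hence [r.+1] for these two, while [u]
    and [rho] keep the class of [g]. *)
Lemma homological_solve (g : 'I_n -> X -> R) :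
  (forall i, Cr 0 (U `*` setT) (g i)) -> (forall i, time_periodic U T (g i)) ->
  exists (u : 'I_n -> X -> R) (rho : 'I_(fdim bX) -> 'cV[R]_k -> R),
  [/\ forall i p, (U `*` setT) p ->
        g i p + \sum_j jacobian_coord F0 i j (G p.1 p.2) * u j p
        - om p.1 * 'D_((0, 1) : X) (u i) p
        - \sum_l rho l p.1 * 'D_(bvec bX l) (G0 i) p = 0,
      forall i, time_periodic U T (u i)
    & forall r, Cr r U tau -> Cr r.+1 setT F0 ->
       Cr r.+1 (U `*` setT) (fun p : X => G p.1 p.2) ->
       (forall i, Cr r (U `*` setT) (g i)) ->
       (forall i, Cr r (U `*` setT) (u i)) /\ (forall l, Cr r U (rho l))].
Proof.
move=> Cg perg.
have oUT := open_slab oU.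
have [Psi [fund inj]] := hyperbolic_injective oU tau_gt0 Ctau CF0 G_per CG dG_inj hyp.
have Cio r : Cr r U tau -> Cr r (U `*` setT) (fun p : X => (om p.1)^-1).
  move=> Ct; apply: (@Cr_comp_fst R _ R (basis_cV k) _ U (fun x => (om x)^-1) oU).
  exact: Cr_inv_frequency.
have C0 : Cr 0 U tau by apply: CrW Ctau.
have C1F : Cr 1 setT F0 by apply: CrW CF0.
have C0G : Cr 0 (U `*` setT) (fun p : X => G p.1 p.2) by apply: CrW CG.
have CB0 i j : Cr 0 (U `*` setT) (B i j) by apply: (Cr_orbit_jacobian oU).
pose h i p := (om p.1)^-1 * g i p.
have Ch0 i : Cr 0 (U `*` setT) (h i) by apply: CrM => //; exact: Cio.
have perh i : time_periodic U T (h i).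
  by move=> x s Ux; rewrite /h /= perg.
have [u [rho [ode per Cu]]] := periodic_solve (basis_cV k)
   (Z := fun l => scaled_tangent gamma0 tau (bvec bX l))
   (Y := fun l => tangent_response gamma0 tau (bvec bX l))
   (z0 := fun l i x => 'D_(bvec bX l) (G0 i) (x, 0))
   oU CB0 fund
   (fun l => tangent_response_ode oU gamma0_ode tau_gt0 Ctau CF0 CG (bvec bX l))
   (fun l i x _ => tangent_response0 gamma0 tau (bvec bX l) i x)
   (orbit_jacobian_periodic F0 G_per)
   (fun l => scaled_tangent_periodic oU G_per (bvec bX l)) inj Ch0 perh.
exists u, rho; split=> //.
- move=> i [x s] [/= Ux _].
  have om0 : om x != 0 by rewrite gt_eqF // (frequency_gt0 tau_gt0).
  have [_ ->] := (is_derive_slice _ _ _ _).1 (ode x Ux s i).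
  rewrite /h /= /orbit_jacobian /scaled_tangent /=.
  rewrite [X in _ - om x * (X + _)](_ : _ = (om x)^-1 * \sum_j jacobian_coord F0 i j (G x s) * u j (x, s)); last first.
    by rewrite mulr_sumr; apply: eq_bigr => j _; rewrite mulrA.
  rewrite [X in _ - om x * (_ + (_ - X))](_ : _ = (om x)^-1 * \sum_l rho l x * 'D_(bvec bX l) (G0 i) (x, s)); last first.
    by rewrite mulr_sumr; apply: eq_bigr => j _; rewrite mulrCA.
  have aux (a b c o : R) : o != 0 -> a + b - o * (o^-1 * b + (o^-1 * a - o^-1 * c)) - c = 0.
    by move=> o0; field.
  exact: aux.
- move=> r Ct CF Cgam Cgr; apply: Cu.
  + move=> i j; apply: (Cr_orbit_jacobian oU) => //; exact: CrS.
  + move=> l i; apply: CrM => //; first exact: Cio.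
    exact: (Cr_orbit_coord oU i Cgam).2.
  + move=> l i; apply: (Cr_slice (f := 'D_(bvec bX l) (G0 i)) 0 oU).
    exact: (Cr_orbit_coord oU i Cgam).2.
  + by move=> i; apply: CrM => //; exact: Cio.
Qed.

End Homological.

(** * The recursion on the order in eps *)

(** Counts derivatives beyond [q] uniformly in finite and infinite classes: regularity is stated as
    [Cr r] for every admissible [r], and losing a derivative means passing from [s.+1] to [s]. *)
Definition ok_class (q : option nat) (s r : nat) : bool :=
  if q is Some q0 then (r <= q0 + s)%N else true.

Lemma ok_classS q s r : ok_class q s.+1 r.+1 = ok_class q s r.
Proof. by case: q => //= q0; rewrite addnS ltnS. Qed.

Lemma ok_classW q s s' r r' : (s <= s')%N -> (r' <= r)%N -> ok_class q s r -> ok_class q s' r'.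
Proof.
case: q => //= q0 ss rr h; apply: leq_trans rr (leq_trans h _).
by rewrite leq_add2l.
Qed.

Lemma CclassP (R : realType) (V W : normedModType R) q s (A : set V) (f : V -> W) :
  Cclass (class_add q s) A f <-> forall r, ok_class q s r -> Cr r A f.
Proof.
case: q => [q0|] /=; last by split=> H r => [_|]; apply: H.
by split=> [H r h|]; [exact: CrW H|apply].
Qed.

Section Truncation.
Context {R : realType} {n : nat}.

Definition truncation (Y : Type) (N : nat) (c : nat -> Y -> R) (y : Y) (e : R) : R :=
  \sum_(j < N) e ^+ j * c j y.

Lemma truncation0 (Y : Type) N (c : nat -> Y -> R) y : truncation N.+1 c y 0 = c 0%N y.
Proof.
rewrite /truncation big_ord_recl expr0 mul1r big1 ?addr0 // => j _.
by rewrite expr0n mul0r.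
Qed.

Lemma Cr_col r (V : normedModType R) (A : set V) (f : 'I_n -> V -> R) : open A ->
  (forall a, Cr r A (f a)) -> Cr r A (fun w => \col_a f a w).
Proof.
move=> oA Cf; apply: (Cr_of_coord (b := basis_cV n) oA) => i.
by apply: (Cr_ext oA _ (Cf i)) => x _; rewrite /= mxE.
Qed.

Lemma Cr_truncation r (V : normedModType R) (bV : finBasis V) (A : set V) N (c : nat -> V -> R) :
  open A -> (forall j, Cr r A (c j)) ->
  Cr r (A `*` setT) (fun w : V * R => truncation N c w.1 w.2).
Proof.
move=> oA Cc; have oAT := open_slab oA; apply: Cr_sum => // j _; apply: CrM => //.
  by apply: CrX => //; exact: Cr_snd.
exact: (@Cr_comp_fst R V R bV r A (c j) oA (Cc j)).
Qed.

End Truncation.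

Section Expansion.
Context {R : realType} {k n m : nat}.
Variables (q : option nat) (F : nat -> 'cV[R]_n -> 'cV[R]_n) (U : set 'cV[R]_k).
Variables (gamma0 : 'cV[R]_k -> R -> 'cV[R]_n) (tau : 'cV[R]_k -> R).
Notation om := (frequency tau).
Notation G := (phase_param gamma0 tau).
Notation X := ('cV[R]_k * R)%type.
Notation bX := (basisX (basis_cV k) basisR).
Notation G0 := (orbit_coord gamma0 tau).
Notation T := (2 * pi).

Variable L : nat.
Hypothesis L3 : (2 * m + 3 <= L)%N.
Hypothesis oU : open U.
Hypothesis gamma0_ode : forall x t, U x -> is_derive t (1 : R) (gamma0 x) (F 0%N (gamma0 x t)).
Hypothesis tau_gt0 : forall x, U x -> 0 < tau x.
Hypothesis Ctau : forall r, ok_class q L r -> Cr r U tau.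
Hypothesis CF : forall i, (i <= m)%N -> forall r, ok_class q L r -> Cr r setT (F i).
Hypothesis G_per : forall x phi, U x -> G x (phi + T) = G x phi.
Hypothesis CG : forall r, ok_class q L r -> Cr r (U `*` setT) (fun p : X => G p.1 p.2).
Hypothesis dG_inj : forall x phi, U x ->
  injective ('d (fun p : X => G p.1 p.2) (x, phi)).
Hypothesis hyp : normally_hyperbolic (F 0%N) U gamma0 tau.

(** The defect F(Gamma, eps) - DGamma r of the conjugacy equation, in coordinate [a], for the
    expansions cut at [N] terms; the angular and spatial parts of r are merged through the basis
    [bX]. *)
Definition residual (N : nat) (c : nat -> 'I_n -> X -> R)
    (rc : nat -> 'I_(fdim bX) -> 'cV[R]_k -> R) (a : 'I_n) (p : X) (e : R) : R :=
  \sum_(j < m.+1) e ^+ j * F j (\col_b truncation N (fun j => c j b) p e) a 0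
  - \sum_l truncation N (fun j => rc j l) p.1 e *
      truncation N (fun j => 'D_(bvec bX l) (c j a)) p e.

(* After [N] orders the residual is [e ^+ N * H]. The index [s] counts the
   derivatives that are still available beyond [q]; each order costs two of them,
   one in the homological equation and one in the division by [e]. *)
Record expansion (N s : nat) (c : nat -> 'I_n -> X -> R)
    (rc : nat -> 'I_(fdim bX) -> 'cV[R]_k -> R) (H : 'I_n -> X * R -> R) : Prop := {
  expansion_c0 : c 0%N = G0;
  expansion_rc0 : rc 0%N = (fun l x => bcoord bX l ((0, om x) : X));
  expansion_per : forall j a, time_periodic U T (c j a);
  expansion_Cc : forall r, ok_class q s.+1 r -> forall j a, Cr r (U `*` setT) (c j a);
  expansion_Crc : forall r, ok_class q s.+1 r -> forall j l, Cr r U (rc j l);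
  expansion_CH : forall r, ok_class q s r -> forall a, Cr r ((U `*` setT) `*` setT) (H a);
  expansion_perH : forall a x phi e, U x -> H a ((x, phi + T), e) = H a ((x, phi), e);
  expansion_res : forall a p e, U p.1 -> residual N c rc a p e = e ^+ N * H a (p, e) }.

Let oUT : open (U `*` [set: R]) := open_slab oU.
Let oUTT : open ((U `*` [set: R]) `*` [set: R]) := open_slab oUT.

Let ok2 : ok_class q L 2.
Proof.
case: q => //= q0; apply: leq_trans (leq_addl _ _); apply: leq_trans L3.
by rewrite addnC.
Qed.

Lemma phase_equation a x phi : U x ->
  \sum_l bcoord bX l ((0, om x) : X) * 'D_(bvec bX l) (G0 a) (x, phi) = F 0%N (G x phi) a 0.
Proof.
move=> Ux; have om0 : om x != 0 by rewrite gt_eqF // (frequency_gt0 tau_gt0).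
have d := diff_G0 oU (CG ok2) a phi Ux.
have := diff_basis bX ((0, om x) : X) d => <-.
rewrite derive_split //= derive0 add0r (D_phase tau gamma0_ode) // mulrA mulfV // mul1r //.
Qed.

(** The unperturbed family satisfies the conjugacy equation for [F 0] exactly, so the defect
    consists of the terms with j >= 1 and one factor e comes out. *)
Lemma expansion0 : exists c rc H, expansion 1 (2 * m + 1) c rc H.
Proof.
exists (fun j => if j == 0%N then G0 else fun _ _ => 0).
exists (fun j => if j == 0%N then (fun l x => bcoord bX l ((0, om x) : X)) else fun _ _ => 0).
exists (fun a w => \sum_(j < m) w.2 ^+ j * F j.+1 (G w.1.1 w.1.2) a 0).
have okL s r : (s <= 2 * m + 2)%N -> ok_class q s r -> ok_class q L r.
  by move=> sm; apply: ok_classW => //; apply: leq_trans L3; apply: leq_trans sm _; rewrite leq_add2l.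
split=> //.
- move=> j a; case: eqP => _ //; exact: orbit_coord_periodic.
- move=> r okr j a; case: eqP => _; last exact: Cr_cst.
  by apply: (Cr_orbit_coord oU); apply: CG; apply: okL okr; rewrite addn1 addn2.
- move=> r okr j l; case: eqP => _; last exact: Cr_cst.
  apply: (Cr_coord (b := bX) l oU); apply: (Cr_pair oU); first exact: Cr_cst.
  apply: (Cr_frequency oU tau_gt0); apply: Ctau.
  by apply: okL okr; rewrite addn1 addn2.
- move=> r okr a; apply: Cr_sum => // j _; apply: CrM => //.
    by apply: CrX => //; exact: Cr_snd.
  have okr' : ok_class q L r by apply: okL okr; rewrite leq_add2l.
  apply: (@Cr_comp_fst R X R bX r (U `*` setT) (fun p : X => F j.+1 (G p.1 p.2) a 0) oUT).
  apply: (Cr_comp (f := fun z => F j.+1 z a 0) (B := setT) (basis_cV n) oUT) => //.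
    by apply: (Cr_entry a (@openT _)); apply: CF.
  exact: CG.
- by move=> a x phi e Ux /=; apply: eq_bigr => j _; rewrite G_per.
- move=> a [x phi] e /= Ux; rewrite /residual /= /truncation.
  rewrite [X in _ - X](_ : _ = F 0%N (G x phi) a 0); last first.
    rewrite -phase_equation //; apply: eq_bigr => l _.
    by rewrite !big_ord_recl !big_ord0 /= expr0 !mul1r !addr0.
  rewrite (_ : \col_b _ = G x phi); last first.
    apply/matrixP => i j; rewrite (ord1 j) mxE big_ord_recl big_ord0 /= expr0 mul1r addr0.
    by rewrite /orbit_coord.
  rewrite big_ord_recl /= expr0 mul1r [_ + _ - _]addrC addKr expr1 mulr_sumr.
  by apply: eq_bigr => j _; rewrite /bump leq0n add1n exprS mulrA.
Qed.

Lemma truncation_update (Y : Type) N (c : nat -> Y -> R) (u : Y -> R) (c' : nat -> Y -> R) y e :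
  (forall j, c' j = if j == N.+1 then u else c j) ->
  truncation N.+2 c' y e = truncation N.+1 c y e + e ^+ N.+1 * u y.
Proof.
move=> E; rewrite /truncation big_ord_recr /= E eqxx; congr (_ + _).
by apply: eq_bigr => j _; rewrite E ltn_eqF.
Qed.

(** Adding [u] and [rho] at order N + 1 turns the defect into e^(N+1) times [Gp]. The homological
    equation with forcing [H (p, 0)] says precisely that [Gp] vanishes at e = 0, so a further factor
    e can be divided out. *)
Lemma expansion_step N s c rc H : (s.+2 <= 2 * m + 1)%N ->
  expansion N.+1 s.+2 c rc H -> exists c' rc' H', expansion N.+2 s c' rc' H'.
Proof.
move=> sm [c0 rc0 perc Cc Crc CH perH res].
have okL r : ok_class q s.+2 r -> ok_class q L r.+1.
  move=> h; rewrite -ok_classS in h; apply: ok_classW h => //.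
  by apply: leq_trans L3; move: sm; rewrite addn1 addn3 !ltnS; exact: ltnW.
have okw s' r : (s' <= s.+2)%N -> ok_class q s' r -> ok_class q s.+2 r.
  by move=> h; apply: ok_classW.
have Cg r a : ok_class q s.+2 r -> Cr r (U `*` setT) (fun p => H a (p, 0)).
  by move=> okr; apply: Cr_slice => //; exact: CH.
have ok0 s' : ok_class q s' 0 by case: (q).
have [u [rho [homo peru Cur]]] := homological_solve oU gamma0_ode tau_gt0
  (Ctau ok2) (CF (leq0n m) ok2) G_per (CG ok2) dG_inj hyp
  (fun a => Cg 0%N a (ok0 _)) (fun a x phi Ux => perH a x phi 0 Ux).
have {}Cur r : ok_class q s.+2 r ->
    (forall i, Cr r (U `*` setT) (u i)) /\ (forall l, Cr r U (rho l)).
  move=> okr; have okr1 := okL _ okr.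
  apply: Cur; first by apply: Ctau; apply: ok_classW okr1.
  - exact: CF.
  - exact: CG.
  - by move=> i; exact: Cg.
pose z (w : X * R) : 'cV[R]_n := \col_b truncation N.+1 (fun j => c j b) w.1 w.2.
(* The extra variable switches the new term on: 0 gives the old truncation and e^(N+1) the new one.
   Division in this variable replaces a Taylor expansion of [F]. *)
pose f (ja : 'I_m.+1 * 'I_n) (v : (X * R) * R) : R :=
  F ja.1 (\col_b (truncation N.+1 (fun j => c j b) v.1.1 v.1.2 + v.2 * u b v.1.1)) ja.2 0.
have oD3 := open_slab oUTT.
have Ctr r a : ok_class q s.+3 r ->
    Cr r ((U `*` setT) `*` setT) (fun w => truncation N.+1 (fun j => c j a) w.1 w.2).
  by move=> okr; apply: (Cr_truncation bX) => // j; exact: Cc.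
have Cf r ja : ok_class q s.+2 r -> Cr r (((U `*` setT) `*` setT) `*` setT) (f ja).
  move=> okr; rewrite /f.
  apply: (Cr_comp (f := fun z => F ja.1 z ja.2 0) (B := setT) (basis_cV n) oD3) => //.
    apply: (Cr_entry ja.2 (@openT _)); apply: CF; first by rewrite -ltnS.
    by apply: ok_classW (okL _ okr).
  apply: Cr_col => // b; apply: CrD => //.
    apply: (@Cr_comp_fst R (X * R)%type R (basisX bX basisR) r _
      (fun w => truncation N.+1 (fun j => c j b) w.1 w.2) oUTT).
    by apply: Ctr; apply: ok_classW okr.
  apply: CrM => //; first exact: Cr_snd.
  apply: (@Cr_comp_fst R (X * R)%type R (basisX bX basisR) r _ (fun w => u b w.1) oUTT).
  apply: (@Cr_comp_fst R X R bX r _ (u b) oUT).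
  by have [H1 _] := Cur r okr; exact: H1.
have ok1 s' : ok_class q s'.+1 1 by rewrite ok_classS.
have /choice[K HK] : forall ja, exists g : (X * R) * R -> R,
  [/\ forall w e, ((U `*` setT) `*` setT) w -> f ja (w, e) = f ja (w, 0) + e * g (w, e),
      forall w, ((U `*` setT) `*` setT) w -> g (w, 0) = 'D_((0, 1) : (X * R) * R) (f ja) (w, 0),
      forall w w', ((U `*` setT) `*` setT) w -> ((U `*` setT) `*` setT) w' ->
        (forall e, f ja (w, e) = f ja (w', e)) -> forall e, g (w, e) = g (w', e)
    & forall r, Cr r.+1 (((U `*` setT) `*` setT) `*` setT) (f ja) ->
        Cr r (((U `*` setT) `*` setT) `*` setT) g].
  by move=> ja; exact: (hadamard (basisX bX basisR) oUTT (Cf 1%N ja (ok1 _))).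
(* The new defect over e^(N+1): the old remainder, the change of [F], and the cross terms in the
   product of the two truncations. [K] and the derivatives of [u] lower the class from [s.+2] to
   [s.+1]; dividing [Gp] lowers it to [s]. *)
pose Gp a (w : X * R) : R := H a w + \sum_(j < m.+1) w.2 ^+ j * K (j, a) (w, w.2 ^+ N.+1)
  - \sum_l (rho l w.1.1 * truncation N.+1 (fun j => 'D_(bvec bX l) (c j a)) w.1 w.2
     + truncation N.+1 (fun j => rc j l) w.1.1 w.2 * 'D_(bvec bX l) (u a) w.1
     + w.2 ^+ N.+1 * rho l w.1.1 * 'D_(bvec bX l) (u a) w.1).
have CGp r a : ok_class q s.+1 r -> Cr r ((U `*` setT) `*` setT) (Gp a).
  move=> okr.
  have okr2 : ok_class q s.+2 r.+1 by rewrite ok_classS.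
  have okr2' : ok_class q s.+2 r by apply: ok_classW okr.
  have okr3 : ok_class q s.+3 r.+1 by rewrite ok_classS.
  have [Cu1 _] := Cur _ okr2; have [_ Crho] := Cur _ okr2'.
  have Ce : Cr r ((U `*` setT) `*` setT) (fun w : X * R => w.2 ^+ N.+1).
    by apply: CrX => //; exact: Cr_snd.
  have Crho2 l : Cr r ((U `*` setT) `*` setT) (fun w : X * R => rho l w.1.1).
    apply: (@Cr_comp_fst R X R bX r _ (fun p => rho l p.1) oUT).
    exact: (@Cr_comp_fst R _ R (basis_cV k) r _ (rho l) oU).
  have CDu l : Cr r ((U `*` setT) `*` setT) (fun w : X * R => 'D_(bvec bX l) (u a) w.1).
    apply: (@Cr_comp_fst R X R bX r _ ('D_(bvec bX l) (u a)) oUT).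
    exact: (Cu1 a).2.
  apply: CrB => //.
    apply: CrD => //; first by apply: CH.
    apply: Cr_sum => // j _; apply: CrM => //.
      by apply: CrX => //; exact: Cr_snd.
    have [_ _ _ HK4] := HK (j, a).
    apply: (Cr_comp (basisX (basisX bX basisR) basisR) oUTT _ (HK4 r (Cf _ _ okr2))) => //.
    by apply: Cr_pair => //; exact: Cr_id.
  apply: Cr_sum => // l _; apply: CrD => //; last first.
    by apply: CrM => //; apply: CrM.
  apply: CrD => //; apply: CrM => //.
    apply: (Cr_truncation bX) => // j.
    exact: (Cc _ okr3 j a).2.
  have Ctrc : Cr r (U `*` setT) (fun w => truncation N.+1 (fun j => rc j l) w.1 w.2).
    apply: (Cr_truncation (basis_cV k)) => // j; apply: Crc.
    exact: ok_classW (leqW (leqnSn _)) (leqnn _) okr.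
  apply: (Cr_comp (f := fun w => truncation N.+1 (fun j => rc j l) w.1 w.2)
    (g := fun w : X * R => (w.1.1, w.2)) bX oUTT _ Ctrc).
    by move=> w [[]].
  apply: Cr_pair => //; last exact: Cr_snd.
  apply: (@Cr_lincomp R (X * R)%type X 'cV[R]_k r _ fst fst oUTT) => //.
    by move=> p; exact: cvg_fst.
  exact: Cr_fst.
have perGp a x phi e : U x -> Gp a ((x, phi + T), e) = Gp a ((x, phi), e).
  move=> Ux; rewrite /Gp /= perH //; congr (_ + _ - _).
    apply: eq_bigr => j _; congr (_ * _); have [_ _ HK3 _] := HK (j, a).
    apply: HK3 => // d; rewrite /f /=; congr (F j _ a 0); apply/matrixP => b i; rewrite !mxE.
    congr (_ + _ * _); last exact: peru.
    by apply: eq_bigr => i' _; rewrite perc.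
  apply: eq_bigr => l _; rewrite !(derive_periodic oU _ (peru a)) //.
  congr (_ * _ + _ + _); apply: eq_bigr => j _.
  by rewrite (derive_periodic oU _ (perc j a)).
(* At e = 0 only j = 0 survives, where [K] is the derivative of [F 0] along [u], and the truncations
   reduce to their leading terms. *)
have Gp0 a p : U p.1 -> Gp a (p, 0) = 0.
  move=> Up; have := homo a p (conj Up I); rewrite /Gp /=.
  have z0 : \col_b truncation N.+1 (fun j => c j b) p 0 = G p.1 p.2.
    apply/matrixP => b i; rewrite (ord1 i) mxE truncation0 c0 //.
  have -> : \sum_(j < m.+1) 0 ^+ j * K (j, a) ((p, 0), 0 ^+ N.+1) =
      \sum_j jacobian_coord (F 0%N) a j (G p.1 p.2) * u j p.
    rewrite big_ord_recl expr0 mul1r big1 ?addr0; last first.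
      by move=> j _; rewrite expr0n mul0r.
    rewrite expr0n /=; have [_ HK2 _ _] := HK (ord0, a); rewrite HK2; last by [].
    pose v : 'cV[R]_n := \col_b u b p.
    have dF : differentiable (fun z => F 0%N z a 0) (G p.1 p.2).
      by apply: (Cr_entry a (@openT _) (CF (leq0n m) ok2)).1.
    have D1 : is_derive (0 *: v + G p.1 p.2) v (fun z => F 0%N z a 0)
       ('D_v (fun z => F 0%N z a 0) (G p.1 p.2)).
      by rewrite scale0r add0r; apply/derivableP/diff_derivable.
    have D2 := (is_derive_line _ _ _ _ _).2 D1.
    have D3 : is_derive (0 : R) (1 : R) (fun d => f (ord0, a) ((p, 0), d))
      ('D_v (fun z => F 0%N z a 0) (G p.1 p.2)).
      apply: (is_derive_conv _ erefl); move: D2; congr is_derive.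
      apply/funext => d; rewrite /f /=; congr (F 0%N _ a 0); apply/matrixP => b i.
      by rewrite -z0 !mxE addrC.
    have [_ ->] := (is_derive_slice _ _ _ _).1 D3.
    rewrite (diff_basis (basis_cV n) v dF); apply: eq_bigr => b _.
    by rewrite mulrC /= mxE.
  have -> : \sum_l (rho l p.1 * truncation N.+1 (fun j => 'D_(bvec bX l) (c j a)) p 0
     + truncation N.+1 (fun j => rc j l) p.1 0 * 'D_(bvec bX l) (u a) p
     + 0 ^+ N.+1 * rho l p.1 * 'D_(bvec bX l) (u a) p) =
     om p.1 * 'D_((0, 1) : X) (u a) p + \sum_l rho l p.1 * 'D_(bvec bX l) (G0 a) p.
    have du : differentiable (u a) p.
      by have [H1 _] := Cur 1%N (ok1 _); apply: (H1 a).1; split.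
    have -> : om p.1 * 'D_((0, 1) : X) (u a) p = \sum_l bcoord bX l ((0, om p.1) : X) *
        'D_(bvec bX l) (u a) p.
      rewrite -(diff_basis bX ((0, om p.1) : X) du).
      by rewrite [RHS]derive_split //= derive0 add0r.
    rewrite -big_split /=; apply: eq_bigr => l _.
    by rewrite !truncation0 c0 rc0 expr0n /= !mul0r addr0 addrC.
  by rewrite opprD addrA.
have /choice[H' HH'] : forall a, exists g : X * R -> R,
  [/\ forall w e, (U `*` setT) w -> Gp a (w, e) = Gp a (w, 0) + e * g (w, e),
      forall w, (U `*` setT) w -> g (w, 0) = 'D_((0, 1) : X * R) (Gp a) (w, 0),
      forall w w', (U `*` setT) w -> (U `*` setT) w' ->
        (forall e, Gp a (w, e) = Gp a (w', e)) -> forall e, g (w, e) = g (w', e)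
    & forall r, Cr r.+1 ((U `*` setT) `*` setT) (Gp a) ->
        Cr r ((U `*` setT) `*` setT) g].
  by move=> a; exact: (hadamard bX oUT (CGp 1%N a (ok1 _))).
pose c' j := if j == N.+1 then u else c j.
pose rc' j := if j == N.+1 then rho else rc j.
exists c', rc', H'; split.
- by rewrite /c'.
- by rewrite /rc'.
- by move=> j a; rewrite /c'; case: eqP.
- move=> r okr j a; rewrite /c'; case: eqP => _.
    by have [H1 _] := Cur r (ok_classW (leqnSn _) (leqnn _) okr).
  by apply: Cc; apply: ok_classW okr => //; rewrite ltnW // ltnW.
- move=> r okr j l; rewrite /rc'; case: eqP => _.
    by have [_ H1] := Cur r (ok_classW (leqnSn _) (leqnn _) okr).
  by apply: Crc; apply: ok_classW okr => //; rewrite ltnW // ltnW.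
- move=> r okr a; have [_ _ _ H4] := HH' a; apply: H4; apply: CGp.
  by rewrite ok_classS.
- move=> a x phi e Ux; have [_ _ H3 _] := HH' a; apply: H3 => // e'; exact: perGp.
- move=> a p e Up; have [H1 _ _ _] := HH' a.
  have EG : Gp a (p, e) = e * H' a (p, e) by rewrite H1 // Gp0 // add0r.
  rewrite exprSr -mulrA -EG /residual.
  have Ej (j : 'I_m.+1) : F j (\col_b truncation N.+2 (fun j0 => c' j0 b) p e) a 0 =
     F j (\col_b truncation N.+1 (fun j => c j b) p e) a 0 + e ^+ N.+1 * K (j, a) ((p, e), e ^+ N.+1).
    have [K1 _ _ _] := HK (j, a).
    have := K1 (p, e) (e ^+ N.+1) (conj (conj Up I) I); rewrite /f /=.
    rewrite (_ : \col_b (_ + e ^+ N.+1 * _) = \col_b truncation N.+2 (fun j0 => c' j0 b) p e); last first.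
      apply/matrixP => b i; rewrite !mxE.
      rewrite (truncation_update (c := fun j => c j b) (u := u b)) // => j0.
      by rewrite /c'; case: eqP.
    move=> ->; congr (F j _ a 0 + _); apply/matrixP => b i; rewrite !mxE mul0r addr0 //.
  rewrite (eq_bigr (fun j : 'I_m.+1 => e ^+ j * F j (\col_b truncation N.+1 (fun j => c j b) p e) a 0
     + e ^+ N.+1 * (e ^+ j * K (j, a) ((p, e), e ^+ N.+1)))); last first.
    by move=> j _; rewrite Ej mulrDr mulrCA.
  rewrite [X in _ - X](eq_bigr (fun l => truncation N.+1 (fun j => rc j l) p.1 e *
      truncation N.+1 (fun j => 'D_(bvec bX l) (c j a)) p e + e ^+ N.+1 *
      (rho l p.1 * truncation N.+1 (fun j => 'D_(bvec bX l) (c j a)) p e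
     + truncation N.+1 (fun j => rc j l) p.1 e * 'D_(bvec bX l) (u a) p
     + e ^+ N.+1 * rho l p.1 * 'D_(bvec bX l) (u a) p))); last first.
    move=> l _.
    rewrite (truncation_update (c := fun j => rc j l) (u := rho l)); last first.
      by move=> j; rewrite /rc'; case: eqP.
    rewrite (truncation_update (c := fun j => 'D_(bvec bX l) (c j a)) (u := 'D_(bvec bX l) (u a))); last first.
      by move=> j; rewrite /c'; case: eqP.
    by ring.
  have aux (A' B' C' D' h E : R) : A' - C' = E * h ->
      A' + E * B' - (C' + E * D') = E * (h + B' - D').
    by move=> e1; rewrite -[A'](subrK C') e1; ring.
  rewrite [X in X - _]big_split [X in _ - X]big_split -!mulr_sumr.
  apply: aux; exact: (res a p e Up).
Qed.

Lemma expansion_exists : exists c rc H, expansion m.+1 1 c rc H.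
Proof.
(* Two derivatives are reserved for each order still to come; the final surplus of one makes the
   coefficients at least C^1 whatever [q] is. *)
suff key i : (i <= m)%N -> exists c rc H, expansion i.+1 (2 * (m - i) + 1) c rc H.
  by have := key m (leqnn m); rewrite subnn muln0.
elim: i => [_|i IH im]; first by rewrite subn0; exact: expansion0.
have [c [rc [H E]]] := IH (ltnW im).
have Es : (2 * (m - i) + 1 = (2 * (m - i.+1) + 1).+2)%N.
  by rewrite -(subnSK im) mulnS !addSn add0n.
rewrite Es in E; apply: expansion_step E; rewrite -Es leq_add2r leq_mul2l leq_subr.
by rewrite orbT.
Qed.

End Expansion.

(** * Persistence of the embedding for small eps *)

Lemma norm_le_entries (R : realType) n (v : 'cV[R]_n) (b : R) : 0 <= b ->
  (forall a, `|v a 0| <= b) -> `|v| <= b.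
Proof.
move=> b0 H; rewrite [leLHS]/Num.Def.normr/= mx_normrE.
by apply: (bigmax_le _ b0) => -[i j] _; rewrite (ord1 j).
Qed.

Lemma derive_slice_fst (R : realType) (V W : normedModType R) (f : V * R -> W) x t v :
  'D_((v, 0) : V * R) f (x, t) = 'D_v (fun x => f (x, t)) x.
Proof.
have E : (fun h : R => h^-1 *: ((f \o shift (x, t)) (h *: ((v, 0) : V * R)) - f (x, t))) =
    (fun h => h^-1 *: (((fun x => f (x, t)) \o shift x) (h *: v) - f (x, t))).
  apply/funext => h /=; congr (_ *: (f (_, _) - _)) => //=.
  by rewrite scaler0 add0r.
by rewrite /derive E.
Qed.

(** The coordinate matrix of [L] is row free, so [pinvmx] is a right inverse and recovers the
    coordinates of [h] from [L h]; the size of its entries gives [kap]. *)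
Lemma injective_bounded_below (R : realType) (V : normedModType R) (b : finBasis V) n
    (L : V -> 'cV[R]_n) : linear L -> injective L ->
  exists2 kap : R, 0 < kap & forall h, kap * `|h| <= `|L h|.
Proof.
move=> linL injL.
pose A : 'M[R]_(fdim b, n) := \matrix_(l, a) L (bvec b l) a 0.
have L0 : L 0 = 0 by have := linL (-1) 0 0; rewrite scaler0 addr0 scaleN1r addNr.
have AE (h : V) a : L h a 0 = \sum_l bcoord b l h * A l a.
  rewrite (linear_bcoord b h linL) summxE; apply: eq_bigr => l _.
  by rewrite !mxE.
have fA : row_free A.
  rewrite -kermx_eq0; apply/rowV0P => v /sub_kermxP E.
  pose h := \sum_l v 0 l *: bvec b l.
  have ch l : bcoord b l h = v 0 l by exact: bcoord_comb.
  have h0 : h = 0.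
    apply: injL; rewrite L0; apply/matrixP => a j; rewrite (ord1 j) AE [RHS]mxE.
    have := congr1 (fun M : 'rV_n => M 0 a) E; rewrite !mxE => E'; rewrite -[RHS]E'.
    by apply: eq_bigr => l _; rewrite ch.
  by apply/matrixP => i l; rewrite (ord1 i) -ch h0 bcoord0 mxE.
pose M := \sum_l (\sum_a `|pinvmx A a l|) * `|bvec b l|.
have M0 : 0 <= M by apply: sumr_ge0 => l _; rewrite mulr_ge0 // sumr_ge0.
exists (M + 1)^-1; first by rewrite invr_gt0 ltr_wpDl.
move=> h; rewrite mulrC ler_pdivrMr; last by rewrite ltr_wpDl.
apply: (@le_trans _ _ (`|L h| * M)); last by rewrite ler_wpM2l // lerDl.
have cE l : bcoord b l h = \sum_a L h a 0 * pinvmx A a l.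
  have := congr1 (fun N => ((\row_l bcoord b l h) *m N) 0 l) (mulmxVp fA).
  rewrite mulmx1 mulmxA [X in _ = X]mxE => <-.
  rewrite mxE; apply: eq_bigr => a _; congr (_ * _); rewrite mxE AE.
  by apply: eq_bigr => l' _; rewrite [X in X * _]mxE.
rewrite {1}(bcoordK b h) (le_trans (ler_norm_sum _ _ _)) //.
rewrite /M mulr_sumr; apply: ler_sum => l _.
rewrite normrZ mulrA ler_wpM2r // cE (le_trans (ler_norm_sum _ _ _)) //.
rewrite mulr_sumr; apply: ler_sum => a _.
by rewrite normrM ler_wpM2r // coord_le_norm.
Qed.

Lemma periodic_int (R : realType) (Y : Type) (P : R) (f : R -> Y) :
  (forall s, f (s + P) = f s) -> forall s (j : int), f (s + j%:~R * P) = f s.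
Proof.
move=> per; have nper (i : nat) s : f (s + i%:R * P) = f s.
  elim: i => [|i IH]; first by rewrite mul0r addr0.
  by rewrite -[i.+1%:R]natr1 mulrDl mul1r addrA per.
move=> s [i|i]; first exact: nper.
by rewrite NegzE mulrNz mulNr -[LHS](nper i.+1) subrK.
Qed.

Section Perturbation.
Context {R : realType} {k n : nat}.
Notation X := ('cV[R]_k * R)%type.
Notation bX := (basisX (basis_cV k) basisR).
Notation T := (2 * pi).
Variables (U : set 'cV[R]_k) (g : 'I_n -> X * R -> R).
Hypothesis oU : open U.
Hypothesis Cg : forall a, Cr 1 ((U `*` setT) `*` setT) (g a).
Hypothesis perg : forall a x phi e, U x -> g a ((x, phi + T), e) = g a ((x, phi), e).

Definition immersion_at (w : X * R) : 'cV[R]_n := \col_a g a w.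
Notation Gam := immersion_at.

Hypothesis Gam_inj : forall x y phi psi, U x -> U y ->
  Gam ((x, phi), 0) = Gam ((y, psi), 0) ->
  x = y /\ exists j : int, psi = phi + j%:~R * T.
Hypothesis dGam_inj : forall p, (U `*` setT) p ->
  injective ('d (fun p => Gam (p, 0)) p).

Let oUT : open (U `*` [set: R]) := open_slab oU.
Let oUTT : open ((U `*` [set: R]) `*` [set: R]) := open_slab oUT.

Lemma Gam_per_int x phi e (j : int) : U x -> Gam ((x, phi + j%:~R * T), e) = Gam ((x, phi), e).
Proof.
move=> Ux; apply: (periodic_int (f := fun phi => Gam ((x, phi), e))) => psi.
by apply/matrixP => a b; rewrite !mxE perg.
Qed.

(** Strict differentiability is used jointly in the point and in [e], so one [d] serves all small
    [e]. Both points carry the same [e], hence only the derivative at [e = 0] acts on their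
    difference, and the error is at most half of its lower bound. *)
Lemma local_lower_bound p0 : (U `*` setT) p0 ->
  exists2 d : R, 0 < d & forall p p' e, `|p - p0| < d -> `|p' - p0| < d -> `|e| < d ->
    d * `|p - p'| <= `|Gam (p, e) - Gam (p', e)|.
Proof.
move=> Up0.
have C0 : Cr 1 (U `*` setT) (fun p => Gam (p, 0)).
  by apply: Cr_col => // a; exact: (Cr_slice 0 oUT (Cg a)).
have dG := C0.1 _ Up0.
have [kap kap0 Hk] := injective_bounded_below bX (L := 'd (fun p => Gam (p, 0)) p0)
  (fun a u v => linearP _ a u v) (dGam_inj Up0).
have k2 : 0 < kap / 2 by rewrite divr_gt0.
pose bW := basisX bX (@basisR R).
have D0 : ((U `*` setT) `*` setT) (p0, 0 : R) by [].
have /choice[d Hd] : forall a, exists d : R, 0 < d /\ forall w w',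
    `|w - (p0, 0)| < d -> `|w' - (p0, 0)| < d ->
    `|g a w - g a w' - \sum_i bcoord bW i (w - w') * 'D_(bvec bW i) (g a) (p0, 0)| <= kap / 2 * `|w - w'|.
  move=> a; have [||d d0 H] := @strict_diff R (X * R)%type bW (g a) (p0, 0) _ _ (kap / 2) k2.
  - move=> i; apply: (open_near oUTT D0) => y Dy.
    by apply/diff_derivable; apply: (Cg a).1.
  - move=> i; exact: ((Cg a).2 _ _ D0).
  by exists d.
have [d1 d10 Hd1] : exists2 d1 : R, 0 < d1 & forall a, d1 <= d a.
  exists (\big[Num.min/1]_a d a).
    by elim/big_ind : _ => // [x y x0 y0|a _]; [rewrite lt_min x0|have [] := Hd a].
  by move=> a; rewrite (bigminD1 a) // ge_min lexx.
exists (Num.min d1 (kap / 2)); first by rewrite lt_min d10.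
move=> p p' e; rewrite !lt_min => /andP[pd _] /andP[p'd _] /andP[ed _].
apply: (@le_trans _ _ (kap / 2 * `|p - p'|)).
  by rewrite ler_wpM2r // ge_min lexx orbT.
set L := 'd (fun p => Gam (p, 0)) p0.
have step : `|Gam (p, e) - Gam (p', e) - L (p - p')| <= kap / 2 * `|p - p'|.
  apply: norm_le_entries => [|a]; first by rewrite mulr_ge0 // ltW.
  have nw (r : X) : `|r - p0| < d1 -> `|(r, e) - (p0, 0)| < d a.
    have -> : (r, e) - (p0, 0) = (r - p0, e) :> X * R by congr (_, _); rewrite /= subr0.
    by move=> rd; rewrite prod_normE /= gt_max !(lt_le_trans _ (Hd1 a)).
  have [_ H] := Hd a; have := H (p, e) (p', e) (nw _ pd) (nw _ p'd).
  have -> : (p, e) - (p', e) = (p - p', 0) :> X * R by congr (_, _); rewrite /= subrr.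
  have -> : `|(p - p', 0) : X * R| = `|p - p'|.
    by rewrite prod_normE /= normr0; apply/max_idPl.
  rewrite -(diff_basis bW (p - p', 0)); last exact: (Cg a).1.
  rewrite derive_slice_fst /L !mxE diff_entry //.
  rewrite (_ : (fun y => Gam (y, 0) a 0) = (fun x => g a (x, 0))) //.
  by apply/funext => y; rewrite mxE.
have := Hk (p - p'); rewrite -/L => h.
have := ler_normB (Gam (p, e) - Gam (p', e)) (Gam (p, e) - Gam (p', e) - L (p - p')).
rewrite opprB addrC subrK => h2.
have -> : kap / 2 * `|p - p'| = kap * `|p - p'| - kap / 2 * `|p - p'| by field.
by rewrite lerBlDr (le_trans h) // (le_trans h2) // lerD.
Qed.

Lemma reduce_period (phi : R) : exists j : int, 0 <= phi - j%:~R * T <= T.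
Proof.
have T0 : 0 < T :> R by rewrite mulr_gt0 // pi_gt0.
exists (Num.floor (phi / T)); apply/andP; split.
  by rewrite subr_ge0 -ler_pdivlMr // floor_le.
rewrite lerBlDl -[X in _ + X]mul1r -mulrDl -ler_pdivrMr //.
by have := floorD1_gt (phi / T); rewrite intrD => /ltW.
Qed.

(** The constant of the lower bound travels with [e] in the filter, so that compactness selects the
    range of [e] and the constant together. *)
Let Feps : set_system (R * R) := filter_prod (nbhs (0 : R)) (at_right (0 : R)).

(* [j] selects the lift of the angle of [pp.2] that is closest to that of [pp.1]. *)
Let P (ec : R * R) (pp : X * X) : Prop := exists j : int,
  ec.2 * `|pp.1 - (pp.2 + (0, j%:~R * T))| <= `|Gam (pp.1, ec.1) - Gam (pp.2, ec.1)|.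

(** Either the two points have the same image at [e = 0], hence differ by whole periods and the
    local bound applies after a translation, or the images stay apart and a small constant suffices,
    the points being at bounded distance. *)
Lemma near_lower_bound (p0 p1 : X) : (U `*` setT) p0 -> (U `*` setT) p1 ->
  \forall pp \near (p0, p1) & ec \near Feps, P ec pp.
Proof.
move=> Up0 Up1.
have CGam : Cr 0 ((U `*` setT) `*` setT) Gam.
  by apply: Cr_col => // a; exact: (CrS (Cg a)).
have [E|neq] := pselect (Gam (p0, 0) = Gam (p1, 0)).
  move: p0 p1 Up0 Up1 E => [x phi] [y psi] /= [Ux _] [Uy _] E.
  have [xy [j0 Ej]] := Gam_inj Ux Uy E; subst y psi.
  have [d d0 Hd] := local_lower_bound (conj Ux I : (U `*` setT) (x, phi)).
  exists ([set pp | `|pp.1 - (x, phi)| < d /\ (`|pp.2 - (x, phi + j0%:~R * T)| < d /\ U pp.2.1)],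
    [set ec | `|ec.1| < d /\ ec.2 <= d]).
    split => /=.
      exists ([set p | `|p - (x, phi)| < d],
        [set p | `|p - (x, phi + j0%:~R * T)| < d /\ U p.1]) => //=.
      split.
        by apply/nbhs_ballP; exists d => //= p; rewrite -ball_normE /= distrC.
      apply: filterI.
        by apply/nbhs_ballP; exists d => //= p; rewrite -ball_normE /= distrC.
      have : nbhs (x, phi + j0%:~R * T) (U `*` [set: R]) by apply: open_nbhs_nbhs.
      by apply: filterS => p [].
    exists ([set e | `|e| < d], [set c | c <= d]) => //=; split.
      exact: (@nbhs0_lt _ (R : normedModType R)).
    exact: nbhs_right_le.
  move=> [[p p'] [e c]] /= [[pd [p'd Up']] [ed cd]].
  (* Translating the second point back by [j0] periods brings both points close to [(x, phi)]. *)
  exists (- j0); rewrite /P /=.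
  have E' : Gam (p', e) = Gam (p' + (0, (- j0)%:~R * T), e).
    have -> : p' + (0, (- j0)%:~R * T) = (p'.1, p'.2 + (- j0)%:~R * T).
      by congr (_, _); rewrite /= addr0.
    by rewrite Gam_per_int // -surjective_pairing.
  rewrite E'; apply: le_trans (Hd _ _ _ pd _ ed); first by rewrite ler_wpM2r.
  apply: le_lt_trans p'd; rewrite (_ : _ - _ = p' - (x, phi + j0%:~R * T)) //.
  have e1 : (0, (- j0)%:~R * T) = - (0, j0%:~R * T) :> X.
    by congr (_, _); rewrite /= ?oppr0 // mulrNz mulNr.
  have e2 : (x, phi + j0%:~R * T) = (x, phi) + (0, j0%:~R * T) :> X.
    by congr (_, _); rewrite /= addr0.
  by rewrite e1 e2 opprD addrA addrAC.
have a0 : 0 < `|Gam (p0, 0) - Gam (p1, 0)|.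
  by rewrite normr_gt0 subr_eq0; apply/eqP.
set a := `|_| in a0.
(* Each image moves by at most a quarter of the gap, so half of the gap remains. *)
have a40 : 0 < a / 4 by rewrite divr_gt0.
have [[/= A0 E0] [nA0 nE0] H0] : \forall w \near (p0, 0 : R), `|Gam (p0, 0) - Gam w| <= a / 4.
  by apply: continuous_dist_le => //; apply: CGam; split.
have [[/= A1 E1] [nA1 nE1] H1] : \forall w \near (p1, 0 : R), `|Gam (p1, 0) - Gam w| <= a / 4.
  by apply: continuous_dist_le => //; apply: CGam; split.
pose M := `|p0 - p1| + 2.
have M0 : 0 < M by rewrite ltr_wpDl.
exists ([set pp | [/\ A0 pp.1, A1 pp.2, `|p0 - pp.1| < 1 & `|p1 - pp.2| < 1]],
    [set ec | [/\ E0 ec.1, E1 ec.1, 0 < ec.2 & ec.2 <= a / 2 / M]]).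
  split => /=.
    exists ([set p | A0 p /\ `|p0 - p| < 1], [set p | A1 p /\ `|p1 - p| < 1]) => /=.
      by split; apply: filterI => //; apply/nbhs_ballP; exists 1 => //= p; rewrite -ball_normE.
    by move=> [p p'] /= [[? ?] [? ?]].
  exists ([set e | E0 e /\ E1 e], [set c | 0 < c /\ c <= a / 2 / M]) => /=.
    split; first exact: filterI.
    by apply: filterI; [exact: nbhs_right_gt|apply: nbhs_right_le; rewrite !divr_gt0].
  by move=> [e c] /= [[? ?] [? ?]].
move=> [[p p'] [e c]] /= [[A0p A1p' pd p'd] [E0e E1e c0 cM]].
exists 0; rewrite /P /= mul0r.
have -> : p' + (0, 0) = p' by case: p' {A1p' p'd} => u v; congr (_, _); rewrite /= addr0.
have h0 := H0 (p, e) (conj A0p E0e); have h1 := H1 (p', e) (conj A1p' E1e).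
have low : a / 2 <= `|Gam (p, e) - Gam (p', e)|.
  have : a <= `|Gam (p0, 0) - Gam (p, e)| + `|Gam (p, e) - Gam (p', e)| + `|Gam (p1, 0) - Gam (p', e)|.
    rewrite [X in _ <= _ + X]distrC (le_trans _ (lerD (ler_normD _ _) (lexx _))) //.
    rewrite addrA subrK (le_trans _ (ler_normD _ _)) // addrA subrK //.
  by move=> h; lra.
apply: le_trans low.
have up : `|p - p'| <= M.
  rewrite /M (_ : p - p' = (p0 - p1) - (p0 - p) + (p1 - p')); last first.
    by rewrite opprB [X in _ = X + _]addrC !subrKA.
  rewrite (le_trans (ler_normD _ _)) // [2]mulr2n addrA.
  apply: lerD; last exact: ltW.
  by rewrite (le_trans (ler_normB _ _)) //; apply: lerD => //; exact: ltW.
apply: (@le_trans _ _ (a / 2 / M * M)); last by rewrite divfK // gt_eqF.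
by rewrite ler_pM // ltW.
Qed.

(** Compactness is applied to pairs of points with angles in one period; other angles are first
    reduced, which only shifts the integer [j]. *)
Lemma uniform_lower_bound (V : set 'cV[R]_k) : compact (closure V) -> closure V `<=` U ->
  exists eps0 c : R, [/\ 0 < eps0, 0 < c & forall e, `|e| < eps0 ->
    forall p p' : X, closure V p.1 -> closure V p'.1 -> exists j : int,
    c * `|p - (p' + (0, j%:~R * T))| <= `|Gam (p, e) - Gam (p', e)| ].
Proof.
move=> cV VU.
have cI : compact `[0, T : R]%classic by exact: segment_compact.
have cK : compact (((closure V) `*` `[0, T : R]%classic) `*` ((closure V) `*` `[0, T : R]%classic)).
  by apply: compact_setX; exact: compact_setX.
have /compact_near_coveringP /(_ _ Feps P _) := cK.
case.
  move=> [p0 p1] [[/= V0 _] [/= V1 _]].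
  by apply: near_lower_bound; split => //; exact: VU.
move=> [E C] /= [nE nC] EC.
have [c [Cc c0]] := filter_ex (filterI nC (nbhs_right_gt (0 : R))).
have [eps0 e00 Ee] := (nbhs_ballP _ _).1 nE.
exists eps0, c; split=> // e ed p p' Vp Vp'.
have Ee' : E e by apply: Ee; rewrite -ball_normE /= sub0r normrN.
have [a1 A1] := reduce_period p.2; have [a2 A2] := reduce_period p'.2.
have [] := EC (e, c) (conj Ee' Cc) ((p.1, p.2 - a1%:~R * T), (p'.1, p'.2 - a2%:~R * T)).
  by split; split => //=; rewrite in_itv.
move=> j /=.
have red (r : X) (a : int) : closure V r.1 -> Gam ((r.1, r.2 - a%:~R * T), e) = Gam (r, e).
  move=> Vr; have Ur : U r.1 by exact: VU.
  by rewrite -mulNr -mulrNz Gam_per_int // -surjective_pairing.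
rewrite !red // => H; exists (j + a1 - a2).
apply: le_trans H; rewrite le_eqVlt; apply/orP; left; apply/eqP; congr (_ * `|_|).
congr (_, _) => //=.
by rewrite intrD intrN intrD; ring.
Qed.

(** The bound says that the inverse is Lipschitz modulo periods: injectivity is the case of equal
    images, immersivity its infinitesimal form, and openness onto the image the continuity of the
    inverse. *)
Lemma lower_bound_embedding q (V : set 'cV[R]_k) (e c : R) : open V -> V `<=` U -> 0 < c ->
  (forall p p' : X, V p.1 -> V p'.1 -> exists j : int,
    c * `|p - (p' + (0, j%:~R * T))| <= `|Gam (p, e) - Gam (p', e)|) ->
  Cclass q (V `*` setT) (fun p => Gam (p, e)) ->
  embedding q V (fun x phi => Gam ((x, phi), e)).
Proof.
move=> oV VU c0 low Cq.
have eG : (fun p : X => Gam ((p.1, p.2), e)) = (fun p => Gam (p, e)).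
  by apply/funext => -[].
have CGe : Cr 1 (U `*` setT) (fun p => Gam (p, e)).
  by apply: Cr_col => // a; exact: (Cr_slice e oUT (Cg a)).
split; rewrite ?eG //.
- by move=> x phi Vx; apply/matrixP => a b; rewrite !mxE perg //; exact: VU.
- move=> x y phi psi Vx Vy E.
  have [j] := low (x, phi) (y, psi) Vx Vy.
  rewrite E subrr normr0 pmulr_rle0 // normr_le0 subr_eq0 => /eqP[-> ->].
  split; first by rewrite addr0.
  by exists (- j); rewrite mulrNz mulNr addrK.
- move=> p [/= Vp _].
  have Up : (U `*` [set: R]) p by split => //; exact: VU.
  have dGe := CGe.1 p Up.
  have key h : 'd (fun p => Gam (p, e)) p h = 0 -> h = 0.
    move=> dh; apply/eqP; rewrite -normr_eq0; apply/negPn/negP => hn0.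
    have hp : 0 < `|h| by rewrite lt_def hn0 normr_ge0.
    have c20 : 0 < c / 2 by rewrite divr_gt0.
    have [r1 r10 H1] := (nbhs_ballP _ _).1 (diff_eps dGe c20).
    have [r2 r20 H2] := (nbhs_ballP _ _).1 (open_nbhs_nbhs (conj (open_slab oV) (conj Vp I : (V `*` [set: R]) p))).
    (* [r1] makes the linearisation error at most half of the lower bound, [r2] keeps the displaced
       point over [V], and [pi] prevents a nonzero number of periods from shortening the
       displacement. *)
    pose r := Num.min (Num.min r1 r2) pi.
    have r0 : 0 < r by rewrite !lt_min r10 r20 pi_gt0.
    pose h' := (r / 2 / `|h|) *: h.
    have nh' : `|h'| = r / 2.
      by rewrite normrZ ger0_norm ?divfK ?gt_eqF // !divr_ge0 // ltW.
    have rr : r / 2 < r by rewrite ltr_pdivrMr // ltr_pMr // ltr1n.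
    have lt1 : `|h'| < r1 by rewrite nh' (lt_le_trans rr) // /r !ge_min lexx.
    have lt2 : `|h'| < r2 by rewrite nh' (lt_le_trans rr) // /r !ge_min lexx orbT.
    have lepi : `|h'| <= pi by rewrite nh' (le_trans (ltW rr)) // /r !ge_min lexx !orbT.
    have B1 : `|Gam (h' + p, e) - Gam (p, e)| <= c / 2 * `|h'|.
      have := H1 h'; rewrite -ball_normE /= sub0r normrN => /(_ lt1).
      by rewrite /h' linearZ /= dh scaler0 subr0.
    have [Vh' _] : (V `*` [set: R]) (h' + p).
      by apply: H2; rewrite -ball_normE /= opprD addrC subrK normrN.
    have [l] := low (h' + p) p Vh' Vp.
    rewrite opprD addrA addrK => Hl.
    have far : `|h'| <= `|h' - (0, l%:~R * T)|.
      have [->|l0] := eqVneq l 0; first by rewrite mul0r (_ : (0, 0) = 0) // subr0.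
      have Tl : T <= `|((0, l%:~R * T) : X)|.
        rewrite prod_normE /= normr0 (max_idPr _) // normrM (ger0_norm (x := T)); last first.
          by rewrite mulr_ge0 // pi_ge0.
        rewrite -[leLHS]mul1r ler_wpM2r // ?mulr_ge0 ?pi_ge0 //.
        by rewrite -intr_norm -[1]/(1%:~R) ler_int -gtz0_ge1 normr_gt0.
      rewrite distrC; apply: le_trans (lerB_dist _ _).
      rewrite lerBrDr (le_trans _ Tl) // mulr_natl mulr2n lerD //.
    have := le_trans (ler_wpM2l (ltW c0) far) (le_trans Hl B1).
    rewrite leNgt ltr_pM2r ?nh' ?divr_gt0 // => /negP; apply.
    by rewrite ltr_pdivrMr // ltr_pMr // ltr1n.
  by move=> u v E; apply: subr0_eq; apply: key; rewrite linearB /= E subrr.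
- move=> O oO OD.
  (* The union of balls of radius [c * d] about the images: a point of the image in such a ball has,
     by the lower bound, a lift within [d] of [p], hence in [O]. *)
  exists [set z | exists p d, [/\ O p, 0 < d, forall p' : X, `|p - p'| < d -> O p'
     & `|Gam (p, e) - z| < c * d]].
    rewrite openE => z [p [d [Op d0 Hd zd]]]; apply/nbhs_ballP.
    exists (c * d - `|Gam (p, e) - z|) => /=; first by rewrite subr_gt0.
    move=> z'; rewrite -ball_normE /= => zz'; exists p, d; split=> //.
    rewrite -[_ - z'](subrKA z) (le_lt_trans (ler_normD _ _)) //.
    by rewrite -ltrBrDl.
  apply/seteqP; split=> z /=.
    move=> [p Op <-]; split; first by exists p => //; exact: OD.
    have [d d0 Hd] := (nbhs_ballP _ _).1 (open_nbhs_nbhs (conj oO Op)).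
    exists p, d; split=> //; last by rewrite subrr normr0 mulr_gt0.
    by move=> p' pp'; apply: Hd; rewrite -ball_normE.
  move=> [[p' Dp' <-] [p [d [Op d0 Hd zd]]]].
  have [l] := low p p' (OD _ Op).1 Dp'.1.
  move=> /le_lt_trans /(_ zd); rewrite ltr_pM2l // => /Hd Op''.
  exists (p' + (0, l%:~R * T)) => //.
  have -> : p' + (0, l%:~R * T) = (p'.1, p'.2 + l%:~R * T).
    by congr (_, _); rewrite /= addr0.
  by rewrite Gam_per_int -?surjective_pairing //; apply: VU; exact: Dp'.1.
Qed.

End Perturbation.

(** * Assembly: components, smoothness and the uniform remainder *)

Lemma class_add0 q : class_add q 0 = q.
Proof. by case: q => //= q0; rewrite addn0. Qed.

Lemma CrZ (R : realType) (V W : normedModType R) (b : finBasis W) r (A : set V)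
    (f : V -> R) (v : V -> W) : open A -> Cr r A f -> Cr r A v -> Cr r A (fun x => f x *: v x).
Proof.
move=> oA Cf Cv; apply: (Cr_of_coord (b := b) oA) => i.
apply: (Cr_ext oA _ (CrM oA Cf (Cr_coord (b := b) i oA Cv))) => x _.
by rewrite bcoordZ.
Qed.

Lemma Cr_comp_fst_vec (R : realType) (V V' W : normedModType R) (bV : finBasis V)
    (b : finBasis W) r (A : set V) (v : V -> W) : open A -> Cr r A v ->
  Cr r (A `*` [set: V']) (fun p : V * V' => v p.1).
Proof.
move=> oA Cv; have oAV : open (A `*` [set: V']).
  rewrite openE => -[x t] [/= Ax _]; exists (A, setT) => //=.
  by split; [apply: open_nbhs_nbhs|exact: filterT].
apply: (Cr_of_coord (b := b) oAV) => i.
exact: (@Cr_comp_fst R V V' bV r A (fun x => bcoord b i (v x)) oA (Cr_coord i oA Cv)).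
Qed.

Lemma compact_bounded_fun (R : realType) (Y : topologicalType) (K : set Y) (f : Y -> R) :
  compact K -> (forall y, K y -> {for y, continuous f}) ->
  exists C, forall y, K y -> `|f y| <= C.
Proof.
move=> cK cf; have /compact_near_coveringP /(_ R +oo%R (fun C y => `|f y| <= C) _) := cK.
case.
  move=> y Ky; have N := continuous_dist_le ltr01 (cf y Ky).
  exists ([set y' | `|f y - f y'| <= 1], [set C | `|f y| + 1 <= C]).
    by split=> //=; apply: nbhs_pinfty_ge; rewrite num_real.
  move=> [y' C] /= [h hC]; apply: le_trans hC.
  rewrite -[f y'](subKr (f y)) (le_trans (ler_normB _ _)) //.
  by rewrite (le_trans (lerD (lexx _) h)).
move=> C [_ HC]; exists (C + 1) => y Ky; apply: (HC (C + 1)) => //.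
by rewrite ltrDl.
Qed.

Lemma is_derive_pair (R : realType) (V W : normedModType R) (f : R -> V) (g : R -> W) t d e :
  is_derive t (1 : R) f d -> is_derive t (1 : R) g e ->
  is_derive t (1 : R) (fun s => (f s, g s)) (d, e).
Proof.
move=> [df <-] [dg <-].
move/derivable1_diffP : df => df; move/derivable1_diffP : dg => dg.
have dfg := differentiable_pair df dg.
split; first exact/derivable1_diffP.
by rewrite !deriveE // diff_pair.
Qed.

Lemma derive_truncation (R : realType) (V : normedModType R) N (c : nat -> V -> R) p v e :
  (forall j, differentiable (c j) p) ->
  'D_v (fun p => truncation N c p e) p = truncation N (fun j => 'D_v (c j)) p e.
Proof.
move=> dc; rewrite /truncation.
have H (j : 'I_N) : is_derive p v (fun p => e ^+ j * c j p) (e ^+ j * 'D_v (c j) p).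
  apply: (is_derive_conv (is_derive_mulf (is_derive_cst (e ^+ j) p v)
    (derivableP (diff_derivable (dc j))))).
  by rewrite mul0r add0r.
by have [_ ->] := is_derive_sumf (index_enum 'I_N) H.
Qed.

(* "Sufficiently smooth": data of class C^(q+l) give r_x, r_phi and Gamma of class
   C^q, for every q in {1, 2, ..., infinity}, with l depending only on m, n, k.
   The smallness of eps and the constant in O(eps^(m+1)) are uniform on
   relatively compact open subsets V of U. *)
Theorem theorem4p1 (R : realType) (m n k : nat)
    (hm : (1 <= m)%N) (hk : (1 <= k)%N) (hkn : (k < n - 1)%N) :
  exists l : nat, forall (q : option nat), class_ge1 q ->
  forall (F : nat -> 'cV[R]_n -> 'cV[R]_n) (U : set 'cV[R]_k)
    (gamma0 : 'cV[R]_k -> R -> 'cV[R]_n) (tau : 'cV[R]_k -> R),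
  (forall i, (i <= m)%N -> Cclass (class_add q l) setT (F i)) ->
  open U ->
  periodic_family (class_add q l) (F 0%N) U gamma0 tau ->
  normally_hyperbolic (F 0%N) U gamma0 tau ->
  exists (rx : 'cV[R]_k -> R -> 'cV[R]_k) (rphi : 'cV[R]_k -> R -> R)
    (Gamma : 'cV[R]_k -> R -> R -> 'cV[R]_n)
    (rxc : nat -> 'cV[R]_k -> 'cV[R]_k) (rphic : nat -> 'cV[R]_k -> R)
    (Gammac : nat -> 'cV[R]_k -> R -> 'cV[R]_n),
  [/\ [/\ Cclass q (U `*` setT) (fun p : 'cV[R]_k * R => rx p.1 p.2),
          Cclass q (U `*` setT)
            ((fun p => rphi p.1 p.2) : 'cV[R]_k * R -> R^o),
          Cclass q ((U `*` setT) `*` setT)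
            (fun p : ('cV[R]_k * R) * R => Gamma p.1.1 p.1.2 p.2)
        & forall i x phi, U x ->
            Gammac i x (phi + 2 * pi) = Gammac i x phi],
      forall x eps, U x ->
        [/\ rx x eps = \sum_(1 <= i < m.+1) eps ^+ i *: rxc i x,
            rphi x eps = frequency tau x
              + \sum_(1 <= i < m.+1) eps ^+ i * rphic i x
          & forall phi, Gamma x phi eps = phase_param gamma0 tau x phi
              + \sum_(1 <= i < m.+1) eps ^+ i *: Gammac i x phi]
    & forall V : set 'cV[R]_k,
        open V -> compact (closure V) -> closure V `<=` U ->
        exists eps0 C : R, 0 < eps0 /\
        forall eps : R, `|eps| < eps0 ->
          embedding q V (fun x phi => Gamma x phi eps) /\
          forall (I : set R) (x : R -> 'cV[R]_k) (phi : R -> R),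
            open I -> is_interval I ->
            skew_solution rx rphi eps V I x phi ->
            let z := fun t : R => Gamma (x t) (phi t) eps in
            forall t, I t ->
              derivable z t 1 /\
              `|'D_1 z t - eps_field m F (z t) eps| <= C * `|eps| ^+ m.+1].
Proof.
(* Two derivatives are spent at each of the [m] orders; three more leave room for the derivatives of
   the data in the homological equation and for the surplus kept at the end. *)
exists (2 * m + 3)%N => q _ F U gamma0 tau CF oU [ode per_tau [ta [tb [ta0 tab]]] Ctau
  [G_per CG G_inj dG_inj _]] hyp.
have tau_gt0 x : U x -> 0 < tau x.
  by move=> Ux; have /andP[h _] := tab x Ux; exact: lt_le_trans h.
have Ctau' r (okr : ok_class q (2 * m + 3) r) : Cr r U tau by exact: ((CclassP _ _ _ _).1 Ctau).
have CF' i (im : (i <= m)%N) r (okr : ok_class q (2 * m + 3) r) : Cr r setT (F i).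
  exact: ((CclassP _ _ _ _).1 (CF i im)).
have CG' r (okr : ok_class q (2 * m + 3) r) :
    Cr r (U `*` setT) (fun p : 'cV[R]_k * R => phase_param gamma0 tau p.1 p.2).
  exact: ((CclassP _ _ _ _).1 CG).
have dG_inj' x phi : U x ->
    injective ('d (fun p : 'cV[R]_k * R => phase_param gamma0 tau p.1 p.2) (x, phi)).
  by move=> Ux; apply: (dG_inj (x, phi)); split.
have [c [rc [H [c0 rc0 perc Cc Crc CH perH res]]]] := expansion_exists (leqnn _) oU ode tau_gt0
  Ctau' CF' G_per CG' dG_inj' hyp.
pose X : Type := ('cV[R]_k * R)%type.
pose bX := basisX (basis_cV k) (@basisR R).
pose om := frequency tau.
have oUT : open (U `*` [set: R]) := open_slab oU.
have oUTT : open ((U `*` [set: R]) `*` [set: R]) := open_slab oUT.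
pose rv i x : 'cV[R]_k * R := \sum_l rc i l x *: bvec bX l.
pose rxc i x := (rv i x).1.
pose rphic i x := (rv i x).2.
pose Gammac i x phi : 'cV[R]_n := \col_a c i a (x, phi).
pose rx x (eps : R) : 'cV[R]_k := \sum_(1 <= i < m.+1) eps ^+ i *: rxc i x.
pose rphi x (eps : R) : R := om x + \sum_(1 <= i < m.+1) eps ^+ i * rphic i x.
pose Gamma x phi (eps : R) : 'cV[R]_n := phase_param gamma0 tau x phi
  + \sum_(1 <= i < m.+1) eps ^+ i *: Gammac i x phi.
pose g a (w : (('cV[R]_k * R) * R)%type) := truncation m.+1 (fun j => c j a) w.1 w.2.
have truncE (Y : Type) (f : nat -> Y -> R) y e : truncation m.+1 f y e =
    f 0%N y + \sum_(1 <= i < m.+1) e ^+ i * f i y.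
  by rewrite /truncation -(big_mkord xpredT (fun j => e ^+ j * f j y)) big_ltn // expr0 mul1r.
have GE x phi e : Gamma x phi e = immersion_at g ((x, phi), e).
  apply/matrixP => a b; rewrite (ord1 b) !mxE /g truncE c0 /orbit_coord /=; congr (_ + _).
  by rewrite summxE; apply: eq_bigr => i _; rewrite !mxE.
have G0E (p : 'cV[R]_k * R) : immersion_at g (p, 0) = phase_param gamma0 tau p.1 p.2.
  by apply/matrixP => a b; rewrite (ord1 b) mxE /g truncation0 c0.
have okle r s : ok_class q 0 r -> ok_class q s r by apply: ok_classW.
have Cg r : ok_class q 0 r -> forall a, Cr r ((U `*` setT) `*` setT) (g a).
  by move=> okr a; rewrite /g; apply: (Cr_truncation bX) => // j; apply: Cc; exact: okle.
have Cg1 a : Cr 1 ((U `*` setT) `*` setT) (g a).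
  by rewrite /g; apply: (Cr_truncation bX) => // j; apply: Cc; rewrite ok_classS; case: (q).
have perg a x phi e : U x -> g a ((x, phi + 2 * pi), e) = g a ((x, phi), e).
  by move=> Ux; apply: eq_bigr => j _; rewrite /= perc.
have g_inj x y phi psi : U x -> U y ->
  immersion_at g ((x, phi), 0) = immersion_at g ((y, psi), 0) ->
  x = y /\ exists j : int, psi = phi + j%:~R * (2 * pi).
  by move=> Ux Uy; rewrite !G0E; exact: G_inj.
have dg_inj (p : 'cV[R]_k * R) : (U `*` setT) p ->
    injective ('d (fun p : 'cV[R]_k * R => immersion_at g (p, 0)) p).
  rewrite (_ : (fun p => immersion_at g (p, 0)) = (fun p => phase_param gamma0 tau p.1 p.2)).
    exact: dG_inj.
  exact/funext.
have Crv r i : ok_class q 0 r -> Cr r U (rv i).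
  move=> okr; apply: Cr_sum => // l _; apply: Cr_scalev => //.
  by apply: Crc; exact: okle.
have Crxc r i : ok_class q 0 r -> Cr r U (rxc i).
  move=> okr; apply: (Cr_lincomp (c := fst) oU _ _ (Crv r i okr)) => // p; exact: cvg_fst.
have Crphic r i : ok_class q 0 r -> Cr r U (rphic i).
  move=> okr; apply: (Cr_lincomp (c := snd) oU _ _ (Crv r i okr)) => // p; exact: cvg_snd.
have rvE x : rv 0%N x = (0, om x).
  by rewrite /rv rc0 [RHS](bcoordK bX).
have rE x e : (rx x e, rphi x e) = \sum_l truncation m.+1 (fun j => rc j l) x e *: bvec bX l.
  have -> : \sum_l truncation m.+1 (fun j => rc j l) x e *: bvec bX l =
      rv 0%N x + \sum_(1 <= i < m.+1) e ^+ i *: rv i x.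
    under eq_bigr do rewrite truncE scalerDl scaler_suml.
    rewrite big_split /=; congr (_ + _); rewrite exchange_big /=; apply: eq_bigr => i _.
    by rewrite scaler_sumr; apply: eq_bigr => l _; rewrite scalerA.
  rewrite rvE [RHS]surjective_pairing; congr (_, _) => /=.
    by rewrite add0r (big_morph (fst : 'cV[R]_k * R -> _) (id1 := 0) (op1 := +%R)).
  by rewrite (big_morph (snd : 'cV[R]_k * R -> R) (id1 := 0) (op1 := +%R)).
exists rx, rphi, Gamma, rxc, rphic, Gammac; split.
- split.
  + rewrite -(class_add0 q); apply/CclassP => r okr.
    apply: Cr_sum => // i _; apply: (CrZ (basis_cV k)) => //.
      by apply: CrX => //; exact: Cr_snd.
    by apply: (@Cr_comp_fst_vec R _ R _ (basis_cV k) (basis_cV k) r U (rxc i) oU); exact: Crxc.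
  + rewrite -(class_add0 q); apply/CclassP => r okr.
    apply: CrD => //.
      apply: (@Cr_comp_fst R _ R (basis_cV k) r U om oU).
      by apply: (Cr_frequency oU tau_gt0); apply: Ctau'; exact: okle.
    apply: Cr_sum => // i _; apply: CrM => //; first by apply: CrX => //; exact: Cr_snd.
    by apply: (@Cr_comp_fst R _ R (basis_cV k) r U (rphic i) oU); exact: Crphic.
  + rewrite -(class_add0 q); apply/CclassP => r okr.
    rewrite (_ : (fun p => _) = immersion_at g); first by apply: Cr_col => // a; exact: Cg.
    by apply/funext => -[[x phi] e]; exact: GE.
  + by move=> i x phi Ux; apply/matrixP => a b; rewrite !mxE perc.
- by move=> x eps Ux; split.
move=> V oV cV VU.
have subV : V `<=` U by apply: subset_trans VU; exact: subset_closure.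
have [eps1 [cc [eps10 cc0 low]]] := uniform_lower_bound oU Cg1 perg g_inj dg_inj cV VU.
(* [H] is continuous and periodic in the angle, so one period and [eps] in [[-1, 1]] suffice to
   bound it over [V]; this is why [eps0] is capped at 1 below. *)
have cK : compact ((closure V `*` `[0, (2 * pi : R)]%classic) `*` `[-1, (1 : R)]%classic).
  by apply: compact_setX; [apply: compact_setX|]; rewrite //; exact: segment_compact.
have /choice[Cb HCb] : forall a, exists C, forall w,
    ((closure V `*` `[0, (2 * pi : R)]%classic) `*` `[-1, (1 : R)]%classic) w -> `|H a w| <= C.
  move=> a; apply: (compact_bounded_fun cK) => -[[x phi] e] /= [[Vx _] _].
  apply: (Cr_continuous (r := 0) (A := (U `*` setT) `*` setT)); last by split => //; split => //; exact: VU.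
  by apply: CH; case: (q).
exists (Num.min eps1 1), (\sum_a `|Cb a|); split; first by rewrite lt_min eps10 ltr01.
move=> eps; rewrite lt_min => /andP[eps_1 eps_2].
have EG : (fun x phi => Gamma x phi eps) = (fun x phi => immersion_at g ((x, phi), eps)).
  by apply/funext => x; apply/funext => phi; exact: GE.
split.
  rewrite EG; apply: (lower_bound_embedding oU Cg1 perg oV subV cc0) => [p p' Vp Vp'|].
    by apply: low => //; exact: subset_closure.
  rewrite -(class_add0 q); apply/CclassP => r okr.
  apply: (@Cr_subset _ _ _ r (U `*` setT)); first by move=> [x phi] [/= Vx _]; split => //; exact: subV.
  by apply: Cr_col => // a; exact: (Cr_slice eps oUT (Cg r okr a)).
move=> I x phi oI _ sol z t It.
have [Vx dx dphi] := sol t It.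
have Ux := subV _ Vx.
have dxp := is_derive_pair dx (dphi : is_derive t 1 phi (rphi (x t) eps)).
have zE : z = (fun p => immersion_at g (p, eps)) \o (fun s => (x s, phi s)).
  by apply/funext => s; rewrite /z /= GE.
have dGe : differentiable (fun p => immersion_at g (p, eps)) (x t, phi t).
  have : Cr 1 (U `*` setT) (fun p => immersion_at g (p, eps)).
    by apply: Cr_col => // a; exact: (Cr_slice eps oUT (Cg1 a)).
  by case=> D _; apply: D; split.
have dp : differentiable (fun s => (x s, phi s)) t by apply/derivable1_diffP; case: dxp.
have dz : differentiable z t by rewrite zE; exact: differentiable_comp.
split; first exact/derivable1_diffP.
have dc j a : differentiable (c j a) (x t, phi t).
  by have := Cc 1%N; rewrite ok_classS => /(_ _ j a) [|D _]; [case: (q)|apply: D; split].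
have dzE : 'D_1 z t = 'D_((rx (x t) eps, rphi (x t) eps) : 'cV[R]_k * R)
    (fun p => immersion_at g (p, eps)) (x t, phi t).
  have [_ dpE] := dxp.
  rewrite [LHS]deriveE // zE diff_comp //= [RHS]deriveE // -dpE.
  by congr ('d _ _ _); rewrite deriveE.
(* Along a solution of the reduced system the chain rule makes z' equal to DGamma r, so the error is
   exactly minus the residual. *)
have entry a : ('D_1 z t - eps_field m F (z t) eps) a 0 = - (eps ^+ m.+1 * H a ((x t, phi t), eps)).
  rewrite -(res a (x t, phi t) eps Ux) /residual opprB mxE [X in _ + X]mxE.
  have -> : eps_field m F (z t) eps a 0 = \sum_(j < m.+1) eps ^+ j *
      F j (\col_b truncation m.+1 (fun j => c j b) (x t, phi t) eps) a 0.
    rewrite /eps_field big_mkord summxE; apply: eq_bigr => j _.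
    by rewrite mxE /z GE.
  congr (_ - _); rewrite dzE.
  have [dga <-] := is_derive_entry a 0 (derivableP (diff_derivable
    (v := ((rx (x t) eps, rphi (x t) eps) : 'cV[R]_k * R)) dGe)).
  rewrite (_ : (fun p => immersion_at g (p, eps) a 0) = (fun p => truncation m.+1 (fun j => c j a) p eps)); last first.
    by apply/funext => p; rewrite mxE.
  rewrite (diff_basis bX); last first.
    have C1 := Cr_slice eps oUT (Cg1 a).
    by have [D _] := C1; apply: D; split.
  by apply: eq_bigr => l _; rewrite rE bcoord_comb derive_truncation.
apply: norm_le_entries => [|a]; first by rewrite mulr_ge0 ?exprn_ge0 ?sumr_ge0.
rewrite entry normrN normrM normrX mulrC ler_wpM2r ?exprn_ge0 //.
(* The lifted angle [phi t] may be arbitrarily large; periodicity brings it back to the compact set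
   on which [H] is bounded. *)
have [j jT] := reduce_period (phi t).
have -> : H a ((x t, phi t), eps) = H a ((x t, phi t - j%:~R * (2 * pi)), eps).
  rewrite -mulNr -mulrNz (periodic_int (f := fun s => H a ((x t, s), eps))) // => s.
  exact: perH.
apply: (@le_trans _ _ (Cb a)).
  apply: HCb; split=> /=; last first.
    by rewrite in_itv /= -ler_norml ltW.
  by split => /=; [exact: subset_closure|rewrite in_itv].
rewrite (le_trans (ler_norm _)) // (bigD1 a) //= lerDl sumr_ge0 //.
Qed.
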